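(* Let $\Omega\subset\mathbb{C}^2$ be a bounded pseudoconvex domain with smooth boundary, and let $\Sigma\subset\partial\Omega$ denote the set of Levi-flat points of $\partial\Omega$. Assume that there exists a defining function $\rho$ of $\Omega$ such that $$\mathrm{Hess}_\rho(L,N)=0\quad\text{on }\Sigma,$$ where $L$ is the normalized holomorphic tangential vector field of $\partial\Omega$ and $N$ is the normalized complex normal vector field of $\partial\Omega$. Then the Diederich--Fornæss index of $\Omega$ is $1$.
   Context: Coordinates on $\mathbb{C}^2$ are $(z,w)$. A defining function of a bounded domain $\Omega$ with smooth boundary is a smooth real-valued function $\rho$ on a neighborhood of $\overline\Omega$ with $\Omega=\{\rho<0\}$, $\partial\Omega=\{\rho=0\}$ and $\nabla\rho\ne0$ on $\partial\Omega$. For a smooth function $f$ and $(1,0)$ vectors $Z=Z_1\frac{\partial}{\partial z}+Z_2\frac{\partial}{\partial w}$, $W=W_1\frac{\partial}{\partial z}+W_2\frac{\partial}{\partial w}$, the complex Hessian is $\mathrm{Hess}_f(Z,W)=Z(\overline W f)-(\nabla_Z\overline W)f=\sum_{j,k=1}^2\frac{\partial^2 f}{\partial z_j\partial\bar z_k}Z_j\overline{W_k}$, where $(z_1,z_2)=(z,w)$ and $\nabla$ is the flat connection. Given a defining function $\rho$, on $\partial\Omega$ put $$L=\frac{1}{\sqrt{|\rho_z|^2+|\rho_w|^2}}\Big(\rho_w\frac{\partial}{\partial z}-\rho_z\frac{\partial}{\partial w}\Big),\qquad N=\frac{1}{\sqrt{|\rho_z|^2+|\rho_w|^2}}\Big(\rho_{\bar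 z}\frac{\partial}{\partial z}+\rho_{\bar w}\frac{\partial}{\partial w}\Big)$$ (the normalized holomorphic tangential vector field and the normalized complex normal vector field); on $\partial\Omega$ these do not depend on the choice of $\rho$. A point of $\partial\Omega$ is Levi-flat if the Levi form $\mathrm{Hess}_\rho(L,L)$ vanishes there. A number $0<\tau<1$ is a Diederich--Fornæss exponent of $\Omega$ if there is a defining function $\rho$ of $\Omega$ such that $-(-\rho)^{\tau}$ is plurisubharmonic on $\Omega$. The Diederich--Fornæss index of $\Omega$ is the supremum of all such $\tau$ over all defining functions of $\Omega$. *)

(* Defs.v *)
From HB Require Import structures.
From mathcomp Require Import all_boot all_order all_algebra.
From mathcomp Require Import complex.
From mathcomp Require Import all_classical all_reals all_analysis.
Set Implicit Arguments.
Unset Strict Implicit.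
Unset Printing Implicit Defensive.
Import Order.TTheory GRing.Theory Num.Theory numFieldNormedType.Exports.
Local Open Scope classical_set_scope.
Local Open Scope ring_scope.
Local Open Scope complex_scope.

(* The real normed space underlying C^2: (x, y) stands for x + i y, so that
   z = x_0 + i y_0 and w = x_1 + i y_1. (The norm is the sup norm, which gives
   the usual topology and the usual bounded sets.) *)
Notation C2 R := ('rV[R]_2 * 'rV[R]_2)%type.

(* Multiplication of a vector of C^2 by a complex scalar. *)
Definition cscale (R : realType) (a : R[i]) (v : C2 R) : C2 R :=
  (complex.Re a *: v.1 - complex.Im a *: v.2, complex.Im a *: v.1 + complex.Re a *: v.2).

Definition dirx (R : realType) (j : 'I_2) : C2 R := (delta_mx 0 j, 0).
Definition diry (R : realType) (j : 'I_2) : C2 R := (0, delta_mx 0 j).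

(* C^k on an open set U, with derivatives in every fixed real direction; on a
   finite-dimensional space this is the usual notion. *)
Fixpoint Ck_on (R : realType) (k : nat) (U : set (C2 R)) (f : C2 R -> R) : Prop :=
  match k with
  | 0%N => forall p, U p -> {for p, continuous f}
  | k'.+1 => (forall p, U p -> differentiable f p) /\
             (forall v : C2 R, Ck_on k' U ('D_v f))
  end.

Definition smooth_on (R : realType) (U : set (C2 R)) (f : C2 R -> R) : Prop :=
  forall k, Ck_on k U f.

Definition boundary (T : topologicalType) (A : set T) : set T :=
  closure A `\` interior A.

Definition bounded_domain (R : realType) (Omega : set (C2 R)) : Prop :=
  [/\ Omega !=set0, open Omega, connected Omega & bounded_set Omega].

(* rho is a total function, but only its values on the neighborhood U of the
   closure of Omega matter. *)
Definition defining_function (R : realType) (Omega : set (C2 R))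
    (rho : C2 R -> R) : Prop :=
  exists U : set (C2 R),
    [/\ open U, closure Omega `<=` U, smooth_on U rho,
        (forall p, U p -> (Omega p <-> rho p < 0)) /\
        (forall p, U p -> (boundary Omega p <-> rho p = 0))
      & forall p, boundary Omega p ->
          exists j : 'I_2, 'D_(dirx R j) rho p != 0 \/ 'D_(diry R j) rho p != 0].

Definition smooth_boundary (R : realType) (Omega : set (C2 R)) : Prop :=
  exists rho, defining_function Omega rho.

(* Real directional derivative of a complex-valued function. *)
Definition cderive (R : realType) (v : C2 R) (f : C2 R -> R[i]) (p : C2 R) : R[i] :=
  'D_v (fun q => complex.Re (f q)) p +i* 'D_v (fun q => complex.Im (f q)) p.

(* The Wirtinger derivatives d/dz_j and d/dzbar_j. *)
Definition dz (R : realType) (j : 'I_2) (f : C2 R -> R[i]) (p : C2 R) : R[i] :=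
  (cderive (dirx R j) f p - 'i * cderive (diry R j) f p) / 2.
Definition dzbar (R : realType) (j : 'I_2) (f : C2 R -> R[i]) (p : C2 R) : R[i] :=
  (cderive (dirx R j) f p + 'i * cderive (diry R j) f p) / 2.

(* The (1,0) vector Z_0 d/dz + Z_1 d/dw is the row vector Z. *)
Definition Hess (R : realType) (f : C2 R -> R) (Z W : 'rV[R[i]]_2) (p : C2 R) : R[i] :=
  \sum_(j < 2) \sum_(k < 2)
    dz j (dzbar k (fun q => (f q)%:C)) p * Z 0 j * (W 0 k)^*%C.

Definition dnorm (R : realType) (rho : C2 R -> R) (p : C2 R) : R[i] :=
  sqrtC (\sum_(j < 2) `|dz j (fun q => (rho q)%:C) p| ^+ 2).

Definition Lfield (R : realType) (rho : C2 R -> R) (p : C2 R) : 'rV[R[i]]_2 :=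
  (dnorm rho p)^-1 *:
  \row_(j < 2) (if j == 0 then dz 1 (fun q => (rho q)%:C) p
                else - dz 0 (fun q => (rho q)%:C) p).

Definition Nfield (R : realType) (rho : C2 R -> R) (p : C2 R) : 'rV[R[i]]_2 :=
  (dnorm rho p)^-1 *: \row_(j < 2) dzbar j (fun q => (rho q)%:C) p.

Definition Levi_form (R : realType) (rho : C2 R -> R) (p : C2 R) : R[i] :=
  Hess rho (Lfield rho p) (Lfield rho p) p.

(* On the boundary, the Levi forms of two defining functions differ by a
   positive factor: "every" in [pseudoconvex] and "some" in [Levi_flat] may be
   interchanged. The order on R[i] is such that 0 <= c means that c is a
   nonnegative real number. *)
Definition pseudoconvex (R : realType) (Omega : set (C2 R)) : Prop :=
  forall rho, defining_function Omega rho ->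
  forall p, boundary Omega p -> 0 <= Levi_form rho p.

Definition Levi_flat (R : realType) (Omega : set (C2 R)) : set (C2 R) :=
  [set p | boundary Omega p /\
           exists2 rho, defining_function Omega rho & Levi_form rho p = 0].

(* Upper semicontinuity, and the sub-mean value property on every closed disc
   {p + zeta v : |zeta| <= 1} of a complex line that lies in Omega. *)
Definition plurisubharmonic_on (R : realType) (Omega : set (C2 R))
    (u : C2 R -> R) : Prop :=
  (forall p a, Omega p -> u p < a -> \forall q \near p, u q < a) /\
  (forall p v : C2 R,
     (forall zeta : R[i], `|zeta| <= 1 -> Omega (p + cscale zeta v)) ->
     ((2 * pi * u p)%:E <=
      \int[lebesgue_measure]_(t in `[0%R, (2 * pi)%R])
        (u (p + cscale (cos t +i* sin t) v))%:E)%E).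

Definition DF_exponent (R : realType) (Omega : set (C2 R)) (tau : R) : Prop :=
  0 < tau < 1 /\
  exists2 rho, defining_function Omega rho &
    plurisubharmonic_on Omega (fun p => - ((- rho p) `^ tau)).

(* [sup] of the empty set is 0. *)
Definition DF_index (R : realType) (Omega : set (C2 R)) : R :=
  sup [set tau | DF_exponent Omega tau].

(* Main.v *)
Require Import Defs.
From HB Require Import structures.
From mathcomp Require Import all_boot all_order all_algebra.
From mathcomp Require Import complex.
From mathcomp Require Import all_classical all_reals all_analysis.
From mathcomp Require Import ring lra.
Import Order.TTheory GRing.Theory Num.Theory numFieldNormedType.Exports.
Local Open Scope classical_set_scope.
Local Open Scope ring_scope.
Set Implicit Arguments.
Unset Strict Implicit.
Unset Printing Implicit Defensive.

(** Fix 0 < tau < 1 and start from the given defining function rho, with L and N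
    the (unnormalized) tangential and normal fields. Put r = rho exp(-psi), with
    the weight psi = M |mixed|^2 + eps |z|^2, where mixed = Hess_rho(N, L).

    Up to a positive factor, the complex Hessian of -(-r)^tau is a Hermitian
    matrix h (DF_matrix) which, for d = -rho > 0, satisfies
    h(L, L) = d levi + d^2 A, h(L, N) = d B, and h(N, N) tends to
    (1 - tau) |grad rho|^4 at the boundary. Thus h is nonnegative near a boundary
    point p as soon as levi >= m rho near p for some m with
    |B|^2 < (A - m) h(N, N) at p (DF_matrix_near). Where the Levi form is positive,
    every m will do. At a Levi-flat point both h(L, L) and h(L, N) vanish for the
    complex Hessian of rho, so that this Hessian kills L; the symmetry of third
    derivatives then shows that the normal derivative of the Levi form is the
    tangential derivative L mixed (normal_derivative_levi). As the Levi form is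
    nonnegative on the boundary, this yields the bound with m about
    Re (L mixed) / |grad rho|^2 (levi_lower_bound). This loss, linear in L mixed,
    is absorbed by the term M |L mixed|^2 of A for M large (choose_slope), while B
    only sees the gradient eps |z| of psi. So -(-r)^tau is plurisubharmonic near
    the boundary (boundary_DF_ge0), with constants that are uniform because the
    boundary is compact.

    To reach the whole domain, r is replaced by bend c r, where bend c is constant
    on s <= -c and such that -(- bend c s)^tau is an increasing convex function of
    -(-s)^tau for -c < s < 0 (bend_convex, DFpower_laplacian). Smooth functions
    with nonnegative Laplacian on every complex line have the sub-mean value
    property (laplacian_submean). Hence every tau in ]0, 1[ is an exponent, and
    the supremum is 1. *)

(** * Smooth functions *)

Section RealCalculus.
Variable R : realType.
Implicit Types (U : set (C2 R)) (f g : C2 R -> R) (p v : C2 R).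

Lemma near_differentiable (V W : normedModType R) (f g : V -> W) (p : V) :
  (\near p, f p = g p) -> differentiable f p -> differentiable g p.
Proof.
move=> fg df; have [cdf /eqaddoP dfo] := (diff_locallyP p f).1 df.
have dgo : g \o shift p = cst (g p) + 'd f p +o_ 0 id.
  apply/eqaddoP => e e0; have := dfo e e0.
  have fg0 : \forall h \near (0 : V), f (h + p) = g (h + p).
    by move: fg; rewrite (near_shift 0)/= subr0.
  move=> dfe; near=> h.
  have -> : (g \o shift p - (cst (g p) + 'd f p)) h =
            (f \o shift p - (cst (f p) + 'd f p)) h.
    by rewrite /= !fctE /= (nbhs_singleton fg) (near fg0 h).
  exact: (near dfe h).
by apply/diff_locallyP; rewrite (diff_unique cdf dgo).
Unshelve. all: by end_near. Qed.

Lemma eq_on_near U f g p : open U -> (forall q, U q -> f q = g q) -> U p ->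
  \near p, f p = g p.
Proof.
move=> oU fg Up; near=> q; apply: fg; near: q.
exact: open_nbhs_nbhs.
Unshelve. all: by end_near. Qed.

Lemma eq_on_derive U f g v p : open U -> (forall q, U q -> f q = g q) -> U p ->
  'D_v f p = 'D_v g p.
Proof. by move=> oU fg Up; apply: near_eq_derive; exact: eq_on_near Up. Qed.

Lemma Ck_on_ext k U f g : open U -> (forall q, U q -> f q = g q) ->
  Ck_on k U f -> Ck_on k U g.
Proof.
move=> oU; elim: k f g => [|k IH] f g fg /=.
  move=> cf p Up; have /= := cf p Up.
  rewrite /prop_for /continuous_at -(fg p Up); apply: cvg_trans.
  by apply: near_eq_cvg; exact: eq_on_near Up.
move=> [df Df]; split.
  by move=> p Up; apply: near_differentiable (df p Up); exact: eq_on_near Up.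
move=> v; apply: IH (Df v) => q Uq; exact: eq_on_derive Uq.
Qed.

Lemma Ck_onW k U f : Ck_on k.+1 U f -> Ck_on k U f.
Proof.
elim: k f => [|k IH] f.
  by move=> [df _] p Up; exact: differentiable_continuous (df p Up).
by move=> [df Df]; split => // v; exact: IH (Df v).
Qed.

Lemma Ck_onS k U V f : V `<=` U -> Ck_on k U f -> Ck_on k V f.
Proof.
move=> VU; elim: k f => [|k IH] f /=; first by move=> cf p /VU; exact: cf.
by move=> [df Df]; split=> [p /VU|v]; [exact: df|exact: IH].
Qed.

Lemma Ck_on_cst k U (a : R) : open U -> Ck_on k U (fun=> a).
Proof.
move=> oU; elim: k a => [|k IH] a /=; first by move=> p _; exact: cvg_cst.
split=> [p _|v]; first exact: differentiable_cst.
by apply: Ck_on_ext (IH 0) => // q _; rewrite derive_cst.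
Qed.

Lemma Ck_onD k U f g : open U -> Ck_on k U f -> Ck_on k U g ->
  Ck_on k U (fun q => f q + g q).
Proof.
move=> oU; elim: k f g => [|k IH] f g /=.
  by move=> cf cg p Up; exact: cvgD (cf p Up) (cg p Up).
move=> [df Df] [dg Dg]; split=> [p Up|v].
  exact: differentiableD (df p Up) (dg p Up).
apply: Ck_on_ext (IH _ _ (Df v) (Dg v)) => // q Uq; apply/esym/deriveD.
  exact/diff_derivable/df.
exact/diff_derivable/dg.
Qed.

Lemma Ck_onM k U f g : open U -> Ck_on k U f -> Ck_on k U g ->
  Ck_on k U (fun q => f q * g q).
Proof.
move=> oU; elim: k f g => [|k IH] f g.
  by move=> cf cg p Up; exact: cvgM (cf p Up) (cg p Up).
move=> sf sg; have [df Df] := sf; have [dg Dg] := sg; split=> [p Up|v].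
  exact: differentiableM (df p Up) (dg p Up).
have := Ck_onD oU (IH _ _ (Ck_onW sf) (Dg v)) (IH _ _ (Ck_onW sg) (Df v)).
apply: Ck_on_ext => // q Uq; apply/esym/deriveM.
  exact/diff_derivable/df.
exact/diff_derivable/dg.
Qed.

Lemma derive_comp (h : R -> R) (h' : R) f v p : differentiable f p ->
  is_derive (f p) 1 h h' -> 'D_v (fun q => h (f q)) p = h' * 'D_v f p.
Proof.
move=> df [dh hh']; have dh' : differentiable h (f p) by exact/derivable1_diffP.
rewrite -[fun q => _]/(h \o f) deriveE; last exact: differentiable_comp.
by rewrite diff_comp//= deriv1E// derive1E hh' -deriveE// mulrC.
Qed.

(** The chain rule for C^k without iterated derivatives: the family H is closed
    under differentiation, the derivative of each member being a combination of
    two members, so that the induction on k needs no formula for the k-th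
    derivative. The exponential, the real powers and the functions
    x^-n exp(-1/x) are such families. *)
Lemma Ck_on_comp_family (I : Type) (H : I -> R -> R) (J : set R)
    (a b : I -> R) (i1 i2 : I -> I) U f k :
  open U -> (forall q, U q -> J (f q)) ->
  (forall i x, J x ->
     is_derive x 1 (H i) (a i * H (i1 i) x + b i * H (i2 i) x)) ->
  Ck_on k U f -> forall i, Ck_on k U (fun q => H i (f q)).
Proof.
move=> oU UJ dH; elim: k => [|k IH] sf i.
  move=> p Up; apply: continuous_comp; first exact: sf.
  apply/differentiable_continuous/derivable1_diffP.
  by have [] := dH i _ (UJ p Up).
have [df Df] := sf; split=> [p Up|v].
  apply: differentiable_comp; first exact: df.
  by apply/derivable1_diffP; have [] := dH i _ (UJ p Up).
have IH' := IH (Ck_onW sf).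
have := Ck_onM oU (Ck_onD oU
  (Ck_onM oU (Ck_on_cst k (a i) oU) (IH' (i1 i)))
  (Ck_onM oU (Ck_on_cst k (b i) oU) (IH' (i2 i)))) (Df v).
apply: Ck_on_ext => // q Uq /=.
by rewrite (derive_comp v (df q Uq) (dH i _ (UJ q Uq))).
Qed.

Lemma smooth_cst U a : open U -> smooth_on U (fun=> a).
Proof. by move=> ? k; exact: Ck_on_cst. Qed.

Lemma smoothD U f g : open U -> smooth_on U f -> smooth_on U g ->
  smooth_on U (fun q => f q + g q).
Proof. by move=> oU sf sg k; exact: Ck_onD. Qed.

Lemma smoothM U f g : open U -> smooth_on U f -> smooth_on U g ->
  smooth_on U (fun q => f q * g q).
Proof. by move=> oU sf sg k; exact: Ck_onM. Qed.

Lemma smoothZ U a f : open U -> smooth_on U f -> smooth_on U (fun q => a * f q).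
Proof. by move=> oU sf; apply: smoothM => //; exact: smooth_cst. Qed.

Lemma smoothN U f : open U -> smooth_on U f -> smooth_on U (fun q => - f q).
Proof.
move=> oU sf k; apply: Ck_on_ext (smoothZ (-1) oU sf k) => // q _.
by rewrite mulN1r.
Qed.

Lemma smoothB U f g : open U -> smooth_on U f -> smooth_on U g ->
  smooth_on U (fun q => f q - g q).
Proof. by move=> oU sf sg; apply: smoothD => //; exact: smoothN. Qed.

Lemma smooth_derive U f v : smooth_on U f -> smooth_on U ('D_v f).
Proof. by move=> sf k; have [_ /(_ v)] := sf k.+1. Qed.

Lemma smooth_diff U f p : smooth_on U f -> U p -> differentiable f p.
Proof. by move=> sf Up; have [/(_ p Up)] := sf 1%N. Qed.

Lemma smooth_derivable U f v p : smooth_on U f -> U p -> derivable f p v.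
Proof. by move=> sf Up; exact/diff_derivable/(smooth_diff sf Up). Qed.

Lemma smooth_continuous U f p : smooth_on U f -> U p -> {for p, continuous f}.
Proof. by move=> sf Up; exact: (sf 0%N). Qed.

Lemma smooth_ext U f g : open U -> (forall q, U q -> f q = g q) ->
  smooth_on U f -> smooth_on U g.
Proof. by move=> oU fg sf k; exact: Ck_on_ext (sf k). Qed.

Lemma smoothS U V f : V `<=` U -> smooth_on U f -> smooth_on V f.
Proof. by move=> VU sf k; exact: Ck_onS (sf k). Qed.

Lemma smooth_comp_family (I : Type) (H : I -> R -> R) (J : set R)
    (a b : I -> R) (i1 i2 : I -> I) U f :
  open U -> (forall q, U q -> J (f q)) ->
  (forall i x, J x ->
     is_derive x 1 (H i) (a i * H (i1 i) x + b i * H (i2 i) x)) ->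
  smooth_on U f -> forall i, smooth_on U (fun q => H i (f q)).
Proof.
by move=> oU UJ dH sf i k; exact: (Ck_on_comp_family oU UJ dH (sf k)).
Qed.

Lemma smooth_expR U f : open U -> smooth_on U f ->
  smooth_on U (fun q => expR (f q)).
Proof.
move=> oU sf.
apply: (@smooth_comp_family unit (fun _ => expR) setT (fun=> 1) (fun=> 0) id id
  U f oU _ _ sf tt) => // _ x _.
by rewrite mul1r mul0r addr0; exact: is_derive_expR.
Qed.

Lemma smooth_powR U f a : open U -> (forall q, U q -> 0 < f q) ->
  smooth_on U f -> smooth_on U (fun q => f q `^ a).
Proof.
move=> oU f0 sf.
apply: (@smooth_comp_family R (fun b x => x `^ b) [set x | 0 < x] id (fun=> 0)
  (fun b => b - 1) id U f oU f0 _ sf a) => b x /= x0.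
by rewrite mul0r addr0; exact: is_derive1_powR.
Qed.

Lemma smooth_linear U (f : {linear C2 R -> R}) : open U -> continuous f ->
  smooth_on U f.
Proof.
move=> oU cf [|k] /=; first by move=> p _; exact: cf.
split=> [p _|v]; first exact: linear_differentiable.
apply: Ck_on_ext (Ck_on_cst k (f v) oU) => // q _.
by rewrite deriveE ?diff_lin//; exact: linear_differentiable.
Qed.

Lemma deriveDdir U f u v p : smooth_on U f -> U p ->
  'D_(u + v) f p = 'D_u f p + 'D_v f p.
Proof. by move=> sf /(smooth_diff sf) df; rewrite !deriveE// linearD. Qed.

Lemma deriveZdir U f a v p : smooth_on U f -> U p ->
  'D_(a *: v) f p = a * 'D_v f p.
Proof. by move=> sf /(smooth_diff sf) df; rewrite !deriveE// linearZ. Qed.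

Lemma smooth_deriveD U f g v p : smooth_on U f -> smooth_on U g -> U p ->
  'D_v (fun q => f q + g q) p = 'D_v f p + 'D_v g p.
Proof.
by move=> sf sg Up; apply: deriveD; [exact: smooth_derivable sf Up|
  exact: smooth_derivable sg Up].
Qed.

Lemma smooth_deriveB U f g v p : smooth_on U f -> smooth_on U g -> U p ->
  'D_v (fun q => f q - g q) p = 'D_v f p - 'D_v g p.
Proof.
by move=> sf sg Up; apply: deriveB; [exact: smooth_derivable sf Up|
  exact: smooth_derivable sg Up].
Qed.

Lemma smooth_deriveN U f v p : smooth_on U f -> U p ->
  'D_v (fun q => - f q) p = - 'D_v f p.
Proof. by move=> sf Up; apply: deriveN; exact: smooth_derivable sf Up. Qed.

Lemma smooth_deriveM U f g v p : smooth_on U f -> smooth_on U g -> U p ->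
  'D_v (fun q => f q * g q) p = 'D_v f p * g p + f p * 'D_v g p.
Proof.
move=> sf sg Up.
transitivity (f p *: 'D_v g p + g p *: 'D_v f p).
  by apply: deriveM; [exact: smooth_derivable sf Up|
    exact: smooth_derivable sg Up].
rewrite addrC; congr (_ + _).
exact: mulrC.
Qed.

Lemma is_derive_line U f p v t : smooth_on U f -> U (p + t *: v) ->
  is_derive t 1 (fun s : R => f (p + s *: v)) ('D_v f (p + t *: v)).
Proof.
move=> sf Upt; have df := smooth_diff sf Upt.
have dl : is_diff t (fun s : R => p + s *: v) (fun s : R => s *: v).
  have := is_diffD (is_diff_cst p t) (is_diff_scalel t v).
  by rewrite add0r.
have dc : differentiable (fun s : R => f (p + s *: v)) t.
  by apply: (@differentiable_comp _ _ _ _ (fun s : R => p + s *: v) f).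
apply: DeriveDef; first exact/derivable1_diffP.
rewrite !deriveE// (@diff_comp _ _ _ _ (fun s : R => p + s *: v) f)//=.
by rewrite diff_val scale1r.
Qed.

End RealCalculus.

(** * Symmetry of second derivatives *)

Section Schwarz.
Variable R : realType.
Implicit Types (U : set (C2 R)) (f g : C2 R -> R) (p u v : C2 R).

Lemma continuous_near (f : C2 R -> R) p (e : R) : {for p, continuous f} ->
  0 < e -> \forall q \near p, `|f p - f q| < e.
Proof. by move=> /cvgrPdist_lt cf /cf. Qed.

Lemma near_parallelogram (P : C2 R -> Prop) p u v : (\forall q \near p, P q) ->
  exists2 r : R, 0 < r &
    forall s t, 0 <= s <= r -> 0 <= t <= r -> P (p + s *: u + t *: v).
Proof.
move=> /nbhs_normP[e /= e0 eP].
have d0 : 0 < `|u| + `|v| + 1 by rewrite ltr_wpDl ?addr_ge0.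
exists (e / (`|u| + `|v| + 1)) => [|s t /andP[s0 sr] /andP[t0 tr]].
  exact: divr_gt0.
apply: eP; rewrite /= -[p + _ + _]addrA opprD addrA subrr sub0r normrN.
rewrite (le_lt_trans (ler_normD _ _))// !normrZ !ger0_norm//.
apply: (@le_lt_trans _ _ (e / (`|u| + `|v| + 1) * (`|u| + `|v|))).
  by rewrite mulrDr lerD// ler_wpM2r.
by rewrite mulrAC ltr_pdivrMr// ltr_pM2l// ltrDl.
Qed.

Lemma within_continuous_line U f p v (h : R) : smooth_on U f ->
  (forall t, 0 <= t <= h -> U (p + t *: v)) ->
  {within `[0, h], continuous (fun t : R => f (p + t *: v))}.
Proof.
move=> sf Uh; apply: derivable_within_continuous => t; rewrite in_itv/= => th.
by have [] := is_derive_line sf (Uh t th).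
Qed.

Lemma MVT_line U f p v (h : R) : 0 < h -> smooth_on U f ->
  (forall t, 0 <= t <= h -> U (p + t *: v)) ->
  exists2 t, 0 < t < h & f (p + h *: v) - f p = h * 'D_v f (p + t *: v).
Proof.
move=> h0 sf Uh.
have [t|t] := @MVT R (fun t => f (p + t *: v)) (fun t => 'D_v f (p + t *: v))
  0 h h0 _ (within_continuous_line sf Uh).
  rewrite in_itv/= => /andP[/ltW t0 /ltW th]; apply: is_derive_line sf _.
  by apply: Uh; rewrite t0.
rewrite in_itv/= scale0r addr0 subr0 => th ->.
by exists t => //; rewrite mulrC.
Qed.

(** The left side is symmetric in u and v whereas the right side is not: two
    applications equate the two mixed derivatives, at two different points of
    the parallelogram. *)
Lemma second_difference U f p u v (h : R) : 0 < h -> smooth_on U f ->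
  (forall s t, 0 <= s <= h -> 0 <= t <= h -> U (p + s *: u + t *: v)) ->
  exists s t, [/\ 0 <= s <= h, 0 <= t <= h &
    f (p + h *: u + h *: v) - f (p + h *: u) - f (p + h *: v) + f p
    = h ^+ 2 * 'D_v ('D_u f) (p + s *: u + t *: v)].
Proof.
move=> h0 sf Uh; have hh : 0 <= h <= h by rewrite ltW/=.
have z0 : 0 <= (0 : R) <= h by rewrite lexx ltW.
have U1 s : 0 <= s <= h -> U (p + h *: v + s *: u).
  by move=> sh; rewrite addrAC; exact: Uh.
have U0 s : 0 <= s <= h -> U (p + s *: u).
  by move=> sh; have := Uh s 0 sh z0; rewrite scale0r addr0.
pose F s := f (p + h *: v + s *: u) - f (p + s *: u).
have dF s : 0 <= s <= h -> is_derive s 1 F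
    ('D_u f (p + h *: v + s *: u) - 'D_u f (p + s *: u)).
  move=> sh; apply: is_deriveB; apply: is_derive_line sf _; by [exact: U1|exact: U0].
have cF : {within `[0, h], continuous F}.
  apply: derivable_within_continuous => s.
  by rewrite in_itv/= => sh; have [] := dF s sh.
have [s|s] := @MVT R F
  (fun s => 'D_u f (p + h *: v + s *: u) - 'D_u f (p + s *: u)) 0 h h0 _ cF.
  by rewrite in_itv/= => /andP[/ltW s0 /ltW sh]; apply: dF; rewrite s0.
rewrite in_itv/= => /andP[/ltW s0 /ltW sh].
have ssh : 0 <= s <= h by rewrite s0.
have [t /andP[/ltW t0 /ltW th]] := MVT_line h0 (smooth_derive u sf)
  (fun t th => Uh s t ssh th).
rewrite [in X in X -> _]addrAC => E1.
rewrite E1 subr0 /F !scale0r !addr0 => E2.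
exists s, t; split; rewrite ?s0 ?t0//.
have -> : f (p + h *: u + h *: v) = f (p + h *: v + h *: u) by rewrite addrAC.
by rewrite expr2 -mulrA [h * (h * _)]mulrC -E2 opprB -[LHS]addrA [- _ + f p]addrC.
Qed.

(** The mean value theorem only gives A = B at two points close to p, which
    depend on the scale; continuity turns this into an equality at p. *)
Lemma eq_of_coincidence_near (A B : C2 R -> R) p :
  {for p, continuous A} -> {for p, continuous B} ->
  (forall P : C2 R -> Prop, (\forall q \near p, P q) ->
     exists q1 q2, [/\ P q1, P q2 & A q1 = B q2]) ->
  A p = B p.
Proof.
move=> cA cB AB; apply/eqP; rewrite -subr_eq0 -normr_le0.
apply/ler_addgt0Pr => e e0; rewrite add0r.
have e2 : 0 < e / 2 by rewrite divr_gt0.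
have nA := continuous_near cA e2; have nB := continuous_near cB e2.
have [q1 [q2 [[/ltW P1 _] [_ P2] E]]] := AB _ (filterI nA nB).
rewrite (le_trans (ler_distD (A q1) _ _))// [e]splitr lerD//.
by rewrite E distrC ltW.
Qed.

Lemma derive_comm U f u v p : open U -> smooth_on U f -> U p ->
  'D_u ('D_v f) p = 'D_v ('D_u f) p.
Proof.
move=> oU sf Up; apply: (@eq_of_coincidence_near ('D_u ('D_v f)) ('D_v ('D_u f)) p) => [||P nP].
- exact: (smooth_continuous (smooth_derive u (smooth_derive v sf)) Up).
- exact: (smooth_continuous (smooth_derive v (smooth_derive u sf)) Up).
have nU : \forall q \near p, U q by exact: open_nbhs_nbhs.
have [r r0 Pr] := near_parallelogram u v (filterI nU nP).
have [s [t [sr tr E1]]] := @second_difference U f p u v r r0 sf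
  (fun s t sr tr => (Pr s t sr tr).1).
have [t' [s' [tr' sr' E2]]] := @second_difference U f p v u r r0 sf
  (fun t s tr sr => eq_ind _ U (Pr s t sr tr).1 _ (addrAC _ _ _)).
exists (p + t' *: v + s' *: u), (p + s *: u + t *: v); split.
- by rewrite addrAC; exact: (Pr s' t' sr' tr').2.
- exact: (Pr s t sr tr).2.
apply: (@mulfI _ (r ^+ 2)); first by rewrite expf_neq0// gt_eqF.
apply: etrans (esym E2) (etrans _ E1).
rewrite [p + r *: v + _]addrAC; congr (_ + _).
by rewrite [LHS]addrAC.
Qed.

End Schwarz.

(** * Wirtinger calculus *)

Section ComplexCalculus.
Variable R : realType.
Local Open Scope complex_scope.
Implicit Types (U : set (C2 R)) (f g : C2 R -> R) (F G : C2 R -> R[i]).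
Implicit Types (p u v : C2 R) (j k : 'I_2).

Definition csmooth U F :=
  smooth_on U (fun q => complex.Re (F q)) /\
  smooth_on U (fun q => complex.Im (F q)).

Lemma complex_ReD (x y : R[i]) : complex.Re (x + y) = complex.Re x + complex.Re y.
Proof. by case: x => a b; case: y. Qed.

Lemma complex_ImD (x y : R[i]) : complex.Im (x + y) = complex.Im x + complex.Im y.
Proof. by case: x => a b; case: y. Qed.

Lemma complex_ReM (x y : R[i]) :
  complex.Re (x * y) = complex.Re x * complex.Re y - complex.Im x * complex.Im y.
Proof. by case: x => a b; case: y. Qed.

Lemma complex_ImM (x y : R[i]) :
  complex.Im (x * y) = complex.Re x * complex.Im y + complex.Im x * complex.Re y.
Proof. by case: x => a b; case: y. Qed.

Lemma complex_ext (x y : R[i]) : complex.Re x = complex.Re y ->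
  complex.Im x = complex.Im y -> x = y.
Proof. by case: x => a b; case: y => c d /= -> ->. Qed.

Lemma csmooth_ext U F G : open U -> (forall q, U q -> F q = G q) ->
  csmooth U F -> csmooth U G.
Proof.
move=> oU FG [sR sI].
by split; [apply: smooth_ext sR|apply: smooth_ext sI] => // q /FG ->.
Qed.

Lemma csmooth_real U f : open U -> smooth_on U f -> csmooth U (fun q => (f q)%:C).
Proof. by move=> oU sf; split => //=; exact: smooth_cst. Qed.

Lemma csmooth_cst U (a : R[i]) : open U -> csmooth U (fun=> a).
Proof. by move=> oU; split; exact: smooth_cst. Qed.

Lemma csmoothD U F G : open U -> csmooth U F -> csmooth U G ->
  csmooth U (fun q => F q + G q).
Proof.
move=> oU [sF1 sF2] [sG1 sG2]; split.
  by apply: smooth_ext (smoothD oU sF1 sG1) => // q _; case: (F q) (G q) => ? ? [].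
by apply: smooth_ext (smoothD oU sF2 sG2) => // q _; case: (F q) (G q) => ? ? [].
Qed.

Lemma csmoothM U F G : open U -> csmooth U F -> csmooth U G ->
  csmooth U (fun q => F q * G q).
Proof.
move=> oU [sF1 sF2] [sG1 sG2]; split.
  apply: smooth_ext (smoothB oU (smoothM oU sF1 sG1) (smoothM oU sF2 sG2)) => //.
  by move=> q _; rewrite complex_ReM.
apply: smooth_ext (smoothD oU (smoothM oU sF1 sG2) (smoothM oU sF2 sG1)) => //.
by move=> q _; rewrite complex_ImM.
Qed.

Lemma csmoothZ U (a : R[i]) F : open U -> csmooth U F ->
  csmooth U (fun q => a * F q).
Proof. by move=> oU sF; apply: csmoothM => //; exact: csmooth_cst. Qed.

Lemma csmoothN U F : open U -> csmooth U F -> csmooth U (fun q => - F q).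
Proof.
move=> oU sF; apply: csmooth_ext (csmoothZ (-1) oU sF) => // q _.
by rewrite mulN1r.
Qed.

Lemma csmoothB U F G : open U -> csmooth U F -> csmooth U G ->
  csmooth U (fun q => F q - G q).
Proof. by move=> oU sF sG; apply: csmoothD => //; exact: csmoothN. Qed.

Lemma csmooth_conj U F : open U -> csmooth U F -> csmooth U (fun q => (F q)^*%C).
Proof.
move=> oU [s1 s2]; split.
  by apply: smooth_ext s1 => // q _; case: (F q).
by apply: smooth_ext (smoothN oU s2) => // q _; case: (F q).
Qed.

Lemma csmooth_cderive U v F : csmooth U F -> csmooth U (cderive v F).
Proof. by move=> [s1 s2]; split; exact: smooth_derive. Qed.

Lemma cderive_ext U v F G p : open U -> (forall q, U q -> F q = G q) -> U p ->
  cderive v F p = cderive v G p.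
Proof.
by move=> oU FG Up; congr Complex; apply: eq_on_derive Up => // q /FG ->.
Qed.

Lemma cderive_cst v (a : R[i]) p : cderive v (fun=> a) p = 0.
Proof. by rewrite /cderive !derive_cst. Qed.

Lemma cderiveD U v F G p : csmooth U F -> csmooth U G -> U p ->
  cderive v (fun q => F q + G q) p = cderive v F p + cderive v G p.
Proof.
move=> [sF1 sF2] [sG1 sG2] Up; apply: complex_ext => /=.
  rewrite -(smooth_deriveD v sF1 sG1 Up).
  by congr ('D_v _ p); apply/funext => q; case: (F q) (G q) => ? ? [].
rewrite -(smooth_deriveD v sF2 sG2 Up).
by congr ('D_v _ p); apply/funext => q; case: (F q) (G q) => ? ? [].
Qed.

Lemma cderiveM U v F G p : open U -> csmooth U F -> csmooth U G -> U p ->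
  cderive v (fun q => F q * G q) p = cderive v F p * G p + F p * cderive v G p.
Proof.
move=> oU [sF1 sF2] [sG1 sG2] Up; apply: complex_ext.
  transitivity ('D_v (fun q => complex.Re (F q) * complex.Re (G q) -
                            complex.Im (F q) * complex.Im (G q)) p).
    by congr ('D_v _ p); apply/funext => q; rewrite complex_ReM.
  rewrite (smooth_deriveB v (smoothM oU sF1 sG1) (smoothM oU sF2 sG2) Up).
  rewrite (smooth_deriveM v sF1 sG1 Up) (smooth_deriveM v sF2 sG2 Up).
  by rewrite complex_ReD !complex_ReM /cderive /=; ring.
transitivity ('D_v (fun q => complex.Re (F q) * complex.Im (G q) +
                          complex.Im (F q) * complex.Re (G q)) p).
  by congr ('D_v _ p); apply/funext => q; rewrite complex_ImM.
rewrite (smooth_deriveD v (smoothM oU sF1 sG2) (smoothM oU sF2 sG1) Up).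
rewrite (smooth_deriveM v sF1 sG2 Up) (smooth_deriveM v sF2 sG1 Up).
by rewrite complex_ImD !complex_ImM /cderive /=; ring.
Qed.

Lemma cderive_conj U v F p : csmooth U F -> U p ->
  cderive v (fun q => (F q)^*%C) p = (cderive v F p)^*%C.
Proof.
move=> [s1 s2] Up; apply: complex_ext => /=.
  by congr ('D_v _ p); apply/funext => q; case: (F q).
rewrite -(smooth_deriveN v s2 Up).
by congr ('D_v _ p); apply/funext => q; case: (F q).
Qed.

Lemma cderive_comm U u v F p : open U -> csmooth U F -> U p ->
  cderive u (cderive v F) p = cderive v (cderive u F) p.
Proof.
move=> oU [s1 s2] Up.
have E1 := derive_comm u v oU s1 Up.
have E2 := derive_comm u v oU s2 Up.
rewrite /cderive /=.
exact: (f_equal2 (@Complex R) E1 E2).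
Qed.

Lemma cderiveDdir U u v F p : csmooth U F -> U p ->
  cderive (u + v) F p = cderive u F p + cderive v F p.
Proof.
move=> [s1 s2] Up; apply: complex_ext => /=; rewrite (@deriveDdir _ U)//.
Qed.

Lemma cderiveZdir U (a : R) v F p : csmooth U F -> U p ->
  cderive (a *: v) F p = a%:C * cderive v F p.
Proof.
move=> [s1 s2] Up; apply: complex_ext => /=; rewrite (@deriveZdir _ U)//.
  by rewrite ?mul0r ?subr0.
by rewrite ?mul0r ?addr0.
Qed.

Lemma cderive_real v f p : cderive v (fun q => (f q)%:C) p = ('D_v f p)%:C.
Proof. by apply: complex_ext => //=; rewrite derive_cst. Qed.

(* Both Wirtinger operators have the form (x - c y) / 2, with c = 'i or - 'i. *)
Let wirtD (c x1 x2 y1 y2 : R[i]) :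
  (x1 + x2 - c * (y1 + y2)) / 2 = (x1 - c * y1) / 2 + (x2 - c * y2) / 2.
Proof. by ring. Qed.

Let wirtM (c f g x1 x2 y1 y2 : R[i]) :
  (x1 * g + f * x2 - c * (y1 * g + f * y2)) / 2 =
  (x1 - c * y1) / 2 * g + f * ((x2 - c * y2) / 2).
Proof. by ring. Qed.

Let wirt_comm (c d xx xy yx yy xx' xy' yx' yy' : R[i]) :
  xx = xx' -> xy = yx' -> yx = xy' -> yy = yy' ->
  ((xx - d * xy) / 2 - c * ((yx - d * yy) / 2)) / 2 =
  ((xx' - c * xy') / 2 - d * ((yx' - c * yy') / 2)) / 2.
Proof. by move=> -> -> -> ->; ring. Qed.

Let dzbarE j F p : dzbar j F p =
  (cderive (dirx R j) F p - (- 'i) * cderive (diry R j) F p) / 2.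
Proof. by rewrite mulNr opprK. Qed.

Lemma dz_ext U j F G p : open U -> (forall q, U q -> F q = G q) -> U p ->
  dz j F p = dz j G p.
Proof. by move=> oU FG Up; rewrite /dz !(cderive_ext _ oU FG Up). Qed.

Lemma dzbar_ext U j F G p : open U -> (forall q, U q -> F q = G q) -> U p ->
  dzbar j F p = dzbar j G p.
Proof. by move=> oU FG Up; rewrite /dzbar !(cderive_ext _ oU FG Up). Qed.

Lemma csmooth_dz U j F : open U -> csmooth U F -> csmooth U (dz j F).
Proof.
move=> oU sF; rewrite /dz.
apply: csmoothM; [by []| |exact: csmooth_cst].
by apply: csmoothB => //; [|apply: csmoothZ => //]; exact: csmooth_cderive.
Qed.

Lemma csmooth_dzbar U j F : open U -> csmooth U F -> csmooth U (dzbar j F).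
Proof.
move=> oU sF; rewrite /dzbar.
apply: csmoothM; [by []| |exact: csmooth_cst].
by apply: csmoothD => //; [|apply: csmoothZ => //]; exact: csmooth_cderive.
Qed.

Lemma dz_cst j (a : R[i]) p : dz j (fun=> a) p = 0.
Proof. by rewrite /dz !cderive_cst mulr0 subrr mul0r. Qed.

Lemma dzbar_cst j (a : R[i]) p : dzbar j (fun=> a) p = 0.
Proof. by rewrite /dzbar !cderive_cst mulr0 addr0 mul0r. Qed.

Lemma dzD U j F G p : csmooth U F -> csmooth U G -> U p ->
  dz j (fun q => F q + G q) p = dz j F p + dz j G p.
Proof.
move=> sF sG Up; rewrite /dz (cderiveD (dirx R j) sF sG Up).
by rewrite (cderiveD (diry R j) sF sG Up) wirtD.
Qed.

Lemma dzbarD U j F G p : csmooth U F -> csmooth U G -> U p ->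
  dzbar j (fun q => F q + G q) p = dzbar j F p + dzbar j G p.
Proof.
move=> sF sG Up; rewrite !dzbarE (cderiveD (dirx R j) sF sG Up).
by rewrite (cderiveD (diry R j) sF sG Up) wirtD.
Qed.

Lemma dzM U j F G p : open U -> csmooth U F -> csmooth U G -> U p ->
  dz j (fun q => F q * G q) p = dz j F p * G p + F p * dz j G p.
Proof.
move=> oU sF sG Up; rewrite /dz (cderiveM (dirx R j) oU sF sG Up).
by rewrite (cderiveM (diry R j) oU sF sG Up) wirtM.
Qed.

Lemma dzbarM U j F G p : open U -> csmooth U F -> csmooth U G -> U p ->
  dzbar j (fun q => F q * G q) p = dzbar j F p * G p + F p * dzbar j G p.
Proof.
move=> oU sF sG Up; rewrite !dzbarE (cderiveM (dirx R j) oU sF sG Up).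
by rewrite (cderiveM (diry R j) oU sF sG Up) wirtM.
Qed.

Lemma dzZ U j (a : R[i]) F p : open U -> csmooth U F -> U p ->
  dz j (fun q => a * F q) p = a * dz j F p.
Proof.
by move=> oU sF Up; rewrite (dzM _ oU (csmooth_cst a oU) sF Up) dz_cst mul0r add0r.
Qed.

Lemma dzbarZ U j (a : R[i]) F p : open U -> csmooth U F -> U p ->
  dzbar j (fun q => a * F q) p = a * dzbar j F p.
Proof.
by move=> oU sF Up; rewrite (dzbarM _ oU (csmooth_cst a oU) sF Up) dzbar_cst mul0r add0r.
Qed.

Lemma conjcD (x y : R[i]) : (x + y)^*%C = x^*%C + y^*%C.
Proof. exact: rmorphD. Qed.

Lemma conjcN (x : R[i]) : (- x)^*%C = - x^*%C.
Proof. exact: rmorphN. Qed.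

Lemma conjcB (x y : R[i]) : (x - y)^*%C = x^*%C - y^*%C.
Proof. exact: rmorphB. Qed.

Lemma conjcM (x y : R[i]) : (x * y)^*%C = x^*%C * y^*%C.
Proof. exact: rmorphM. Qed.

Lemma conjc_i : ('i : R[i])^*%C = - 'i.
Proof. by apply: complex_ext; rewrite /= ?oppr0. Qed.

Lemma conjc_half (x : R[i]) : (x / 2)^*%C = x^*%C / 2.
Proof. by rewrite rmorphM fmorphV rmorph_nat. Qed.

Lemma dz_conj U j F p : csmooth U F -> U p ->
  dz j (fun q => (F q)^*%C) p = (dzbar j F p)^*%C.
Proof.
move=> sF Up; rewrite /dz /dzbar !(cderive_conj _ sF Up) conjc_half.
by rewrite conjcD conjcM conjc_i mulNr.
Qed.

Lemma dzbar_conj U j F p : csmooth U F -> U p ->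
  dzbar j (fun q => (F q)^*%C) p = (dz j F p)^*%C.
Proof.
move=> sF Up; rewrite /dz /dzbar !(cderive_conj _ sF Up) conjc_half.
by rewrite conjcB conjcM conjc_i mulNr opprK.
Qed.

Lemma dz_real U j f p : open U -> smooth_on U f -> U p ->
  dzbar j (fun q => (f q)%:C) p = (dz j (fun q => (f q)%:C) p)^*%C.
Proof.
move=> oU sf Up; rewrite -(dzbar_conj _ (csmooth_real oU sf) Up).
by congr (dzbar j _ p); apply/funext => q; rewrite conjc_real.
Qed.

Lemma cderive_dz U v j F p : open U -> csmooth U F -> U p ->
  cderive v (dz j F) p =
  (cderive v (cderive (dirx R j) F) p - 'i * cderive v (cderive (diry R j) F) p) / 2.
Proof.
move=> oU sF Up.
have sx := csmooth_cderive (dirx R j) sF; have sy := csmooth_cderive (diry R j) sF.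
rewrite /dz (cderiveM v oU (csmoothB oU sx (csmoothZ 'i oU sy)) (csmooth_cst _ oU) Up).
rewrite cderive_cst mulr0 addr0; congr (_ * _).
rewrite (cderiveD v sx (csmoothN oU (csmoothZ 'i oU sy)) Up); congr (_ + _).
rewrite (@cderive_ext U _ _ (fun q => (- 'i) * cderive (diry R j) F q))//; last first.
  by move=> q _; rewrite mulNr.
by rewrite (cderiveM v oU (csmooth_cst _ oU) sy Up) cderive_cst mul0r add0r mulNr.
Qed.

Lemma cderive_dzbar U v j F p : open U -> csmooth U F -> U p ->
  cderive v (dzbar j F) p =
  (cderive v (cderive (dirx R j) F) p -
   (- 'i) * cderive v (cderive (diry R j) F) p) / 2.
Proof.
move=> oU sF Up; rewrite mulNr opprK.
have sx := csmooth_cderive (dirx R j) sF; have sy := csmooth_cderive (diry R j) sF.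
rewrite /dzbar (cderiveM v oU (csmoothD oU sx (csmoothZ 'i oU sy)) (csmooth_cst _ oU) Up).
rewrite cderive_cst mulr0 addr0; congr (_ * _).
rewrite (cderiveD v sx (csmoothZ 'i oU sy) Up); congr (_ + _).
by rewrite (cderiveM v oU (csmooth_cst _ oU) sy Up) cderive_cst mul0r add0r.
Qed.

Lemma dz_comm U j k F p : open U -> csmooth U F -> U p ->
  dz j (dz k F) p = dz k (dz j F) p.
Proof.
move=> oU sF Up.
rewrite [LHS]/dz (cderive_dz (dirx R j) k oU sF Up) (cderive_dz (diry R j) k oU sF Up).
rewrite [RHS]/dz (cderive_dz (dirx R k) j oU sF Up) (cderive_dz (diry R k) j oU sF Up).
by apply: wirt_comm; exact: cderive_comm oU sF Up.
Qed.

Lemma dz_dzbar_comm U j k F p : open U -> csmooth U F -> U p ->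
  dz j (dzbar k F) p = dzbar k (dz j F) p.
Proof.
move=> oU sF Up.
rewrite [LHS]/dz (cderive_dzbar (dirx R j) k oU sF Up)
  (cderive_dzbar (diry R j) k oU sF Up).
rewrite [RHS]dzbarE (cderive_dz (dirx R k) j oU sF Up)
  (cderive_dz (diry R k) j oU sF Up).
by apply: wirt_comm; exact: cderive_comm oU sF Up.
Qed.

Lemma cderive_dirx j F p : cderive (dirx R j) F p = dz j F p + dzbar j F p.
Proof.
rewrite /dz /dzbar; move: (cderive _ F p) (cderive (diry R j) F p) => x y.
by field.
Qed.

Lemma cderive_diry j F p :
  cderive (diry R j) F p = 'i * (dz j F p - dzbar j F p).
Proof.
rewrite /dz /dzbar; move: (cderive _ F p) (cderive (diry R j) F p) => x y.
have ii : 'i * 'i = -1 :> R[i] by rewrite -expr2 sqrCi.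
transitivity (- ('i * 'i) * y); first by rewrite ii opprK mul1r.
by field.
Qed.

End ComplexCalculus.

(** * The Laplacian along a complex line *)

Section Laplacian.
Variable R : realType.
Local Open Scope complex_scope.
Implicit Types (U : set (C2 R)) (f g : C2 R -> R) (F G : C2 R -> R[i]).
Implicit Types (p u v w : C2 R) (j k : 'I_2) (Z W : 'I_2 -> R[i]).

Definition ccoord v j : R[i] := (v.1 ord0 j) +i* (v.2 ord0 j).
Definition cvector Z : C2 R :=
  (\row_j complex.Re (Z j), \row_j complex.Im (Z j)).
Definition J v : C2 R := Defs.cscale 'i%C v.

Lemma sum2 (V : nmodType) (a : 'I_2 -> V) : \sum_(j < 2) a j = a 0 + a 1.
Proof.
rewrite !big_ord_recl big_ord0 addr0; congr (a _ + a _); exact: val_inj.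
Qed.

Lemma ccoord_cvector Z j : ccoord (cvector Z) j = Z j.
Proof. by rewrite /ccoord !mxE; case: (Z j). Qed.

Lemma ccoord_cscale a v j : ccoord (Defs.cscale a v) j = a * ccoord v j.
Proof.
case: a => a b; rewrite /ccoord /Defs.cscale !mxE/=.
by apply: complex_ext => //=; rewrite addrC.
Qed.

Lemma ccoordJ v j : ccoord (J v) j = 'i%C * ccoord v j.
Proof. exact: ccoord_cscale. Qed.

Lemma dir_decomposition v :
  v = (v.1 ord0 0 *: dirx R 0 + v.2 ord0 0 *: diry R 0) +
      (v.1 ord0 1 *: dirx R 1 + v.2 ord0 1 *: diry R 1).
Proof.
have I2 j : j = 0 \/ j = 1.
  by case: j => -[|[|//]] ?; [left|right]; exact: val_inj.
case: v => a b; congr pair; apply/rowP => j.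
  rewrite !mxE /= ?mxE; have [->|->] := I2 j;
  by rewrite /= ?mulr0 ?mulr1 ?addr0 ?add0r.
rewrite !mxE /= ?mxE; have [->|->] := I2 j;
by rewrite /= ?mulr0 ?mulr1 ?addr0 ?add0r.
Qed.

Definition pairing (a : 'I_2 -> R[i]) Z := a 0 * Z 0 + a 1 * Z 1.

Definition herm (h : 'I_2 -> 'I_2 -> R[i]) Z W : R[i] :=
  (h 0 0 * Z 0 * (W 0)^*%C + h 0 1 * Z 0 * (W 1)^*%C) +
  (h 1 0 * Z 1 * (W 0)^*%C + h 1 1 * Z 1 * (W 1)^*%C).

Lemma cderiveE U v F p : csmooth U F -> U p -> cderive v F p =
  pairing (fun j => dz j F p) (ccoord v) +
  pairing (fun j => dzbar j F p) (fun j => (ccoord v j)^*%C).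
Proof.
move=> sF Up; rewrite [in LHS](dir_decomposition v).
rewrite !(cderiveDdir _ _ sF Up) !(cderiveZdir _ _ sF Up).
rewrite !cderive_dirx !cderive_diry /pairing /ccoord.
have conjE (a b : R) : (a +i* b)^*%C = a%:C - 'i * b%:C.
  rewrite -complexiE.
  by apply: complex_ext => /=; rewrite ?mul0r ?mul1r ?subr0 ?addr0 ?sub0r ?add0r.
have cE (a b : R) : (a +i* b) = a%:C + 'i * b%:C.
  rewrite -complexiE.
  by apply: complex_ext => /=; rewrite ?mul0r ?mul1r ?subr0 ?addr0 ?sub0r ?add0r.
rewrite !conjE !cE.
move: (dz 0 F p) (dz 1 F p) (dzbar 0 F p) (dzbar 1 F p) => a b c d.
move: (_%:C) (_%:C) (_%:C) (_%:C) => x y z t; ring.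
Qed.

Lemma cderiveJE U v F p : csmooth U F -> U p -> cderive (J v) F p =
  'i * (pairing (fun j => dz j F p) (ccoord v) -
        pairing (fun j => dzbar j F p) (fun j => (ccoord v j)^*%C)).
Proof.
move=> sF Up; rewrite (cderiveE (J v) sF Up) /pairing !ccoordJ.
rewrite !conjcM complexiE conjc_i.
move: (dz 0 F p) (dz 1 F p) (dzbar 0 F p) (dzbar 1 F p) => a b c d.
move: (ccoord v 0) (ccoord v 1) ((ccoord v 0)^*%C) ((ccoord v 1)^*%C) => x y z t.
by ring.
Qed.

Definition del f v p : R[i] := pairing (fun j => dz j (fun q => (f q)%:C) p) (ccoord v).

Lemma del_conj U f v p : open U -> smooth_on U f -> U p -> (del f v p)^*%C =
  pairing (fun j => dzbar j (fun q => (f q)%:C) p) (fun j => (ccoord v j)^*%C).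
Proof.
move=> oU sf Up; rewrite /del /pairing; cbv beta.
rewrite !(dz_real _ oU sf Up); move: (dz 0 _ p) (dz 1 _ p) => a b.
by rewrite conjcD !conjcM.
Qed.

Lemma derive_del U f v p : open U -> smooth_on U f -> U p ->
  ('D_v f p)%:C = del f v p + (del f v p)^*%C.
Proof.
move=> oU sf Up; rewrite -cderive_real (cderiveE v (csmooth_real oU sf) Up).
by rewrite (del_conj v oU sf Up).
Qed.

Lemma deriveJ_del U f v p : open U -> smooth_on U f -> U p ->
  ('D_(J v) f p)%:C = 'i * (del f v p - (del f v p)^*%C).
Proof.
move=> oU sf Up; rewrite -cderive_real (cderiveJE v (csmooth_real oU sf) Up).
by rewrite (del_conj v oU sf Up).
Qed.

(** The Laplacian at zeta = 0 of the function zeta |-> f (p + zeta v) on the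
    complex line through p spanned by v; line_grad is the scalar product of the
    gradients of two such functions. *)
Definition line_laplacian f v p : R := 'D_v ('D_v f) p + 'D_(J v) ('D_(J v) f) p.
Definition line_grad f g v p : R := 'D_v f p * 'D_v g p + 'D_(J v) f p * 'D_(J v) g p.

Let line_grad_alg (a b c d : R) (x y x' y' : R[i]) :
  a%:C = x + x' -> b%:C = y + y' ->
  c%:C = 'i * (x - x') -> d%:C = 'i * (y - y') ->
  (a * b + c * d)%:C = 2 * (x * y' + x' * y).
Proof.
move=> Ea Eb Ec Ed; rewrite rmorphD !rmorphM /= Ea Eb Ec Ed.
have ii : 'i * 'i = -1 :> R[i] by rewrite -expr2 sqrCi.
by rewrite mulrACA ii; ring.
Qed.

Let real_complexD_eq (a b : R) (x y : R[i]) : a%:C = x -> b%:C = y ->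
  (a + b)%:C = x + y.
Proof. by move=> <- <-; exact: rmorphD. Qed.

Lemma line_gradE U f g v p : open U -> smooth_on U f -> smooth_on U g -> U p ->
  (line_grad f g v p)%:C =
  2 * (del f v p * (del g v p)^*%C + (del f v p)^*%C * del g v p).
Proof.
move=> oU sf sg Up.
exact: line_grad_alg (derive_del v oU sf Up) (derive_del v oU sg Up)
  (deriveJ_del v oU sf Up) (deriveJ_del v oU sg Up).
Qed.

Let laplacian_alg (a b c d h : R[i]) : b + c = 2 * h ->
  a + b + (c + d) + ('i * ('i * (a - b)) + - 'i * ('i * (c - d))) = 4 * h.
Proof.
have ii : 'i * 'i = -1 :> R[i] by rewrite -expr2 sqrCi.
move=> bch; have -> : 4 * h = 2 * (2 * h) by ring.
by rewrite -bch mulNr !mulrA ii; ring.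
Qed.

Let laplacian_alg2 (a b c d x y x' y' : R[i]) :
  (x * a + y * c) * x' + (x * b + y * d) * y' +
  ((x' * a + y' * b) * x + (x' * c + y' * d) * y) =
  2 * ((a * x * x' + b * x * y') + (c * y * x' + d * y * y')).
Proof. by ring. Qed.

(** With A and B the (1,0) and (0,1) parts of the derivative along v, that is
    D_v = A + B and D_Jv = i (A - B), one has D_v^2 + D_Jv^2 = 2 (A B + B A):
    only the mixed derivatives remain. *)
Lemma line_laplacianE U f v p : open U -> smooth_on U f -> U p ->
  (line_laplacian f v p)%:C =
  4 * herm (fun j k => dz j (dzbar k (fun q => (f q)%:C)) p) (ccoord v) (ccoord v).
Proof.
move=> oU sf Up; set F := fun q => (f q)%:C.
have sF : csmooth U F := csmooth_real oU sf.
pose c0 := ccoord v 0; pose c1 := ccoord v 1.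
pose G1 q := c0 * dz 0 F q + c1 * dz 1 F q.
pose G2 q := c0^*%C * dzbar 0 F q + c1^*%C * dzbar 1 F q.
have s0 : csmooth U (fun q => c0 * dz 0 F q) by apply: csmoothZ => //; exact: csmooth_dz.
have s1 : csmooth U (fun q => c1 * dz 1 F q) by apply: csmoothZ => //; exact: csmooth_dz.
have t0 : csmooth U (fun q => c0^*%C * dzbar 0 F q).
  by apply: csmoothZ => //; exact: csmooth_dzbar.
have t1 : csmooth U (fun q => c1^*%C * dzbar 1 F q).
  by apply: csmoothZ => //; exact: csmooth_dzbar.
have sG1 : csmooth U G1 by exact: csmoothD.
have sG2 : csmooth U G2 by exact: csmoothD.
have E1 : (('D_v ('D_v f)) p)%:C = cderive v (fun q => G1 q + G2 q) p.
  rewrite -cderive_real; apply: cderive_ext Up => // q Uq.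
  rewrite -cderive_real (cderiveE v sF Uq) /pairing /G1 /G2 -/c0 -/c1.
  move: (dz 0 F q) (dz 1 F q) (dzbar 0 F q) (dzbar 1 F q) => a b c d.
  by move: (c0^*%C) (c1^*%C) => x y; ring.
have E2 : (('D_(J v) ('D_(J v) f)) p)%:C =
    cderive (J v) (fun q => 'i * G1 q + (- 'i) * G2 q) p.
  rewrite -cderive_real; apply: cderive_ext Up => // q Uq.
  rewrite -cderive_real (cderiveJE v sF Uq) /pairing /G1 /G2 -/c0 -/c1.
  move: (dz 0 F q) (dz 1 F q) (dzbar 0 F q) (dzbar 1 F q) => a b c d.
  by move: (c0^*%C) (c1^*%C) => x y; ring.
rewrite /line_laplacian (real_complexD_eq E1 E2).
rewrite (cderiveD v sG1 sG2 Up).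
have siG1 := csmoothZ 'i oU sG1; have siG2 := csmoothZ (- 'i) oU sG2.
rewrite (cderiveD (J v) siG1 siG2 Up).
rewrite (cderiveM (J v) oU (csmooth_cst 'i oU) sG1 Up).
rewrite (cderiveM (J v) oU (csmooth_cst (- 'i) oU) sG2 Up) !cderive_cst.
rewrite !mul0r !add0r (cderiveE v sG1 Up) (cderiveE v sG2 Up).
rewrite (cderiveJE v sG1 Up) (cderiveJE v sG2 Up).
have dzG2 j : dz j G2 p = c0^*%C * dz j (dzbar 0 F) p + c1^*%C * dz j (dzbar 1 F) p.
  exact: (etrans (dzD j t0 t1 Up) (f_equal2 +%R
    (dzZ j (c0^*%C) oU (csmooth_dzbar 0 oU sF) Up)
    (dzZ j (c1^*%C) oU (csmooth_dzbar 1 oU sF) Up))).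
have dzbG1 j : dzbar j G1 p = c0 * dz 0 (dzbar j F) p + c1 * dz 1 (dzbar j F) p.
  exact: (etrans (dzbarD j s0 s1 Up) (f_equal2 +%R
    (etrans (dzbarZ j c0 oU (csmooth_dz 0 oU sF) Up)
       (f_equal (fun x => c0 * x) (esym (dz_dzbar_comm 0 j oU sF Up))))
    (etrans (dzbarZ j c1 oU (csmooth_dz 1 oU sF) Up)
       (f_equal (fun x => c1 * x) (esym (dz_dzbar_comm 1 j oU sF Up)))))).
apply: laplacian_alg; rewrite /pairing /herm; cbv beta; rewrite !dzG2 !dzbG1.
exact: laplacian_alg2.
Qed.

End Laplacian.

(** * Hermitian forms in the tangential and normal frame *)

Section HermitianAlgebra.
Variable R : realType.
Local Open Scope complex_scope.
Implicit Types (h : 'I_2 -> 'I_2 -> R[i]) (L N V Z W : 'I_2 -> R[i]).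

Definition hermitian_mx h := forall j k, h k j = (h j k)^*%C.

Lemma herm_conj h Z W : hermitian_mx h -> (herm h Z W)^*%C = herm h W Z.
Proof.
move=> hh; rewrite /herm !conjcD !conjcM !conjcK -!hh; ring.
Qed.

(** Completing the square: with A, B, D the entries h(L, L), h(L, N), h(N, N),
    D |s|^2 h(V, V) = |b D + a B|^2 + |a|^2 (A D - |B|^2). *)
Lemma herm_ge0 h L N V (a b s : R[i]) : hermitian_mx h -> s != 0 ->
  (forall j, s * V j = a * L j + b * N j) -> 0 < herm h N N ->
  herm h L N * (herm h L N)^*%C <= herm h L L * herm h N N ->
  0 <= herm h V V.
Proof.
move=> hh s0 sV D0 BAD.
have E : (s * s^*%C) * herm h V V =
    a * a^*%C * herm h L L + a * b^*%C * herm h L N +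
    (b * a^*%C * (herm h L N)^*%C + b * b^*%C * herm h N N).
  have -> : s * s^*%C * herm h V V = herm h (fun j => s * V j) (fun j => s * V j).
    by rewrite /herm !conjcM; ring.
  rewrite (herm_conj L N hh) /herm !sV !conjcD !conjcM.
  move: (a^*%C) (b^*%C) ((L 0)^*%C) ((L 1)^*%C) ((N 0)^*%C) ((N 1)^*%C) => *.
  by ring.
have ss0 : 0 < s * s^*%C by rewrite lt0r mulf_neq0 ?conjc_eq0//= mulcJ_ge0.
rewrite -(pmulr_rge0 _ ss0) -(pmulr_rge0 _ D0) E.
have Dr : (herm h N N)^*%C = herm h N N by exact: herm_conj.
move: Dr BAD {E D0}; move: (herm h L L) (herm h N N) (herm h L N) => A D B Dr BAD.
have -> : D * (a * a^*%C * A + a * b^*%C * B + (b * a^*%C * B^*%C + b * b^*%C * D)) =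
    (b * D + a * B) * (b * D + a * B)^*%C + a * a^*%C * (A * D - B * B^*%C).
  by rewrite conjcD !conjcM Dr; move: (a^*%C) (b^*%C) (B^*%C) => *; ring.
by rewrite addr_ge0// ?mulcJ_ge0// mulr_ge0 ?mulcJ_ge0// subr_ge0.
Qed.

(** The tangential and normal vectors attached to a gradient r, up to scale. *)
Definition tangential (r : 'I_2 -> R[i]) (j : 'I_2) := if j == 0 then r 1 else - r 0.
Definition normal (r : 'I_2 -> R[i]) (j : 'I_2) := (r j)^*%C.
Definition gradsq (r : 'I_2 -> R[i]) := r 0 * (r 0)^*%C + r 1 * (r 1)^*%C.

Lemma tangential0 r : tangential r 0 = r 1. Proof. by []. Qed.
Lemma tangential1 r : tangential r 1 = - r 0. Proof. by []. Qed.

Lemma pairing_tangential r : pairing r (tangential r) = 0.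
Proof. by rewrite /pairing /tangential/=; ring. Qed.

Lemma pairing_normal r : pairing r (normal r) = gradsq r.
Proof. by []. Qed.

Lemma gradsq_conj r : (gradsq r)^*%C = gradsq r.
Proof. by rewrite /gradsq conjcD !conjcM !conjcK; ring. Qed.

Lemma tangential_normal_basis r V j : gradsq r * V j =
  (V 0 * (r 1)^*%C - V 1 * (r 0)^*%C) * tangential r j + pairing r V * normal r j.
Proof.
rewrite /gradsq /pairing /normal; case: j => -[|[|//]] i.
  rewrite (_ : Ordinal i = 0) ?tangential0; last exact: val_inj.
  by ring.
rewrite (_ : Ordinal i = 1) ?tangential1; last exact: val_inj.
by ring.
Qed.

(** The complex Hessian of -(-r)^tau for r = rho exp(-psi), up to a positive
    factor: d = -rho, r and H are the gradient and the complex Hessian of rho,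
    g and K those of psi. *)
Definition DF_matrix (tau d : R[i]) (r g : 'I_2 -> R[i])
    (H K : 'I_2 -> 'I_2 -> R[i]) (j k : 'I_2) :=
  d * H j k + (1 - tau) * (r j * (r k)^*%C) + d ^+ 2 * K j k
  - tau * d * (r j * (g k)^*%C + g j * (r k)^*%C)
  - tau * d ^+ 2 * (g j * (g k)^*%C).

Lemma herm_DF_matrix tau d r g H K Z W : herm (DF_matrix tau d r g H K) Z W =
  d * herm H Z W + (1 - tau) * (pairing r Z * (pairing r W)^*%C)
  + d ^+ 2 * herm K Z W
  - tau * d * (pairing r Z * (pairing g W)^*%C + pairing g Z * (pairing r W)^*%C)
  - tau * d ^+ 2 * (pairing g Z * (pairing g W)^*%C).
Proof.
rewrite /herm /DF_matrix /pairing !conjcD !conjcM.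
move: ((r 0)^*%C) ((r 1)^*%C) ((g 0)^*%C) ((g 1)^*%C) ((W 0)^*%C) ((W 1)^*%C) => *.
by ring.
Qed.

Lemma DF_matrix_hermitian tau d r g H K : tau^*%C = tau -> d^*%C = d ->
  hermitian_mx H -> hermitian_mx K -> hermitian_mx (DF_matrix tau d r g H K).
Proof.
move=> ct cd hH hK j k; rewrite /DF_matrix !(conjcB, conjcD, conjcM, conjcK).
rewrite (hH j k) (hK j k) ?expr2 ?conjcM cd ct conjc1.
move: ((r j)^*%C) ((r k)^*%C) ((g j)^*%C) ((g k)^*%C) => *.
by ring.
Qed.

Lemma herm_kernel h r V : gradsq r != 0 ->
  herm h (tangential r) (tangential r) = 0 ->
  herm h (normal r) (tangential r) = 0 -> herm h V (tangential r) = 0.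
Proof.
move=> s0 hLL hNL; apply: (mulfI s0); rewrite mulr0.
transitivity (herm h (fun j => gradsq r * V j) (tangential r)).
  by rewrite /herm; ring.
set a := V 0 * (r 1)^*%C - V 1 * (r 0)^*%C; set b := pairing r V.
transitivity (a * herm h (tangential r) (tangential r) +
              b * herm h (normal r) (tangential r)).
  rewrite /herm !tangential_normal_basis -/a -/b.
  move: ((tangential r 0)^*%C) ((tangential r 1)^*%C) (normal r 0) (normal r 1) => *.
  by ring.
by rewrite hLL hNL !mulr0 addr0.
Qed.

(** Here h is the complex Hessian, T its derivatives, dl and dm are the
    derivatives of h(L, L) and h(N, L), A and C those of the coefficients of L and
    N, and B the derivatives of the coefficients of L in the conjugate variables.
    As h(L, L) = h(N, L) = 0, the whole of h kills L, so that the
    terms with derivatives of coefficients drop out, and the symmetry of third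
    derivatives exchanges N and L. *)
Lemma third_order_identity r h (T : 'I_2 -> 'I_2 -> 'I_2 -> R[i])
    (A B C : 'I_2 -> 'I_2 -> R[i]) (dl dm : 'I_2 -> R[i]) :
  gradsq r != 0 -> hermitian_mx h ->
  herm h (tangential r) (tangential r) = 0 ->
  herm h (normal r) (tangential r) = 0 ->
  (forall m j k, T m j k = T j m k) ->
  (forall m, dl m = herm (T m) (tangential r) (tangential r) +
     herm h (A m) (tangential r) + herm h (tangential r) (B m)) ->
  (forall m, dm m = herm (T m) (normal r) (tangential r) +
     herm h (C m) (tangential r) + herm h (normal r) (B m)) ->
  (forall m, B m 0 = h 1 m) -> (forall m, B m 1 = - h 0 m) ->
  pairing dl (normal r) = pairing dm (tangential r).
Proof.
move=> s0 hh hLL hNL symT dlE dmE B0 B1.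
have ker V : herm h V (tangential r) = 0 by exact: herm_kernel.
have ker' V : herm h (tangential r) V = 0 by rewrite -herm_conj ?ker ?conjc0.
have k0 : h 0 0 * (tangential r 0)^*%C + h 0 1 * (tangential r 1)^*%C = 0.
  by rewrite -(ker (fun j => (j == 0)%:R)) /herm /=; ring.
have k1 : h 1 0 * (tangential r 0)^*%C + h 1 1 * (tangential r 1)^*%C = 0.
  by rewrite -(ker (fun j => (j == 1)%:R)) /herm /=; ring.
have {}k0 : (h 0 0)^*%C * tangential r 0 + (h 0 1)^*%C * tangential r 1 = 0.
  by rewrite -[tangential r 0]conjcK -[tangential r 1]conjcK -!conjcM -conjcD k0 conjc0.
have {}k1 : (h 1 0)^*%C * tangential r 0 + (h 1 1)^*%C * tangential r 1 = 0.
  by rewrite -[tangential r 0]conjcK -[tangential r 1]conjcK -!conjcM -conjcD k1 conjc0.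
have E : herm h (normal r) (B 0) * tangential r 0 +
         herm h (normal r) (B 1) * tangential r 1 = 0.
  rewrite /herm !B0 !B1 !conjcN.
  transitivity ((h 0 0 * normal r 0 + h 1 0 * normal r 1) *
      ((h 1 0)^*%C * tangential r 0 + (h 1 1)^*%C * tangential r 1) -
    (h 0 1 * normal r 0 + h 1 1 * normal r 1) *
      ((h 0 0)^*%C * tangential r 0 + (h 0 1)^*%C * tangential r 1)).
    move: ((h 0 0)^*%C) ((h 0 1)^*%C) ((h 1 0)^*%C) ((h 1 1)^*%C) => *.
    by ring.
  by rewrite k0 k1 !mulr0 subrr.
rewrite /pairing !dlE !dmE !ker !ker' !addr0.
have alg (x y u w a b : R[i]) : u * a + w * b = 0 ->
    x * a + y * b = (x + u) * a + (y + w) * b.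
  by move=> e; rewrite -[LHS]addr0 -e; ring.
apply: etrans _ (alg _ _ _ _ _ _ E); rewrite /herm !(symT 1 0).
move: ((tangential r 0)^*%C) ((tangential r 1)^*%C) => *.
move: (T 0 0 0) (T 0 0 1) (T 0 1 0) (T 0 1 1) (T 1 1 0) (T 1 1 1) => *.
by ring.
Qed.

End HermitianAlgebra.

(** * The Levi form and the mixed term of the complex Hessian *)

Section LeviGeometry.
Variable R : realType.
Local Open Scope complex_scope.
Implicit Types (U : set (C2 R)) (f rho : C2 R -> R) (F : C2 R -> R[i]).
Implicit Types (p q v : C2 R) (Z W : C2 R -> 'I_2 -> R[i]).

Definition cgrad rho q (j : 'I_2) : R[i] := dz j (fun q => (rho q)%:C) q.
Definition chess rho q (j k : 'I_2) : R[i] :=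
  dz j (dzbar k (fun q => (rho q)%:C)) q.

(** The Levi form and the mixed term Hess(N, L), for the unnormalized fields. *)
Definition levi rho q :=
  herm (chess rho q) (tangential (cgrad rho q)) (tangential (cgrad rho q)).
Definition mixed rho q :=
  herm (chess rho q) (normal (cgrad rho q)) (tangential (cgrad rho q)).

Lemma csmooth_cgrad U rho j : open U -> smooth_on U rho ->
  csmooth U (fun q => cgrad rho q j).
Proof. by move=> oU sr; apply: csmooth_dz => //; exact: csmooth_real. Qed.

Lemma csmooth_chess U rho j k : open U -> smooth_on U rho ->
  csmooth U (fun q => chess rho q j k).
Proof.
move=> oU sr; apply: csmooth_dz => //; apply: csmooth_dzbar => //.
exact: csmooth_real.
Qed.

Lemma csmooth_tangential U Z j : open U -> (forall j, csmooth U (fun q => Z q j)) ->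
  csmooth U (fun q => tangential (Z q) j).
Proof.
move=> oU sZ; rewrite /tangential; case: (j == 0); first exact: (sZ 1).
exact: csmoothN oU (sZ 0).
Qed.

Lemma csmooth_normal U Z j : open U -> (forall j, csmooth U (fun q => Z q j)) ->
  csmooth U (fun q => normal (Z q) j).
Proof. by move=> oU sZ; exact: csmooth_conj oU (sZ j). Qed.

Lemma csmooth_pairing U Z W : open U -> (forall j, csmooth U (fun q => Z q j)) ->
  (forall j, csmooth U (fun q => W q j)) -> csmooth U (fun q => pairing (Z q) (W q)).
Proof.
move=> oU sZ sW.
exact: csmoothD oU (csmoothM oU (sZ 0) (sW 0)) (csmoothM oU (sZ 1) (sW 1)).
Qed.

Lemma csmooth_herm U (h : C2 R -> 'I_2 -> 'I_2 -> R[i]) Z W : open U ->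
  (forall j k, csmooth U (fun q => h q j k)) ->
  (forall j, csmooth U (fun q => Z q j)) ->
  (forall j, csmooth U (fun q => W q j)) ->
  csmooth U (fun q => herm (h q) (Z q) (W q)).
Proof.
move=> oU sh sZ sW.
have s j k : csmooth U (fun q => h q j k * Z q j * (W q k)^*%C).
  exact: csmoothM oU (csmoothM oU (sh j k) (sZ j)) (csmooth_conj oU (sW k)).
exact: csmoothD oU (csmoothD oU (s 0 0) (s 0 1)) (csmoothD oU (s 1 0) (s 1 1)).
Qed.

Lemma csmooth_levi U rho : open U -> smooth_on U rho -> csmooth U (levi rho).
Proof.
move=> oU sr; apply: csmooth_herm => // [j k|j|j].
- exact: csmooth_chess.
- by apply: csmooth_tangential => // k; exact: csmooth_cgrad.
- by apply: csmooth_tangential => // k; exact: csmooth_cgrad.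
Qed.

Lemma csmooth_mixed U rho : open U -> smooth_on U rho -> csmooth U (mixed rho).
Proof.
move=> oU sr; apply: csmooth_herm => // [j k|j|j].
- exact: csmooth_chess.
- by apply: csmooth_normal => // k; exact: csmooth_cgrad.
- by apply: csmooth_tangential => // k; exact: csmooth_cgrad.
Qed.

Lemma dzbar_cgrad U rho j k p : open U -> smooth_on U rho -> U p ->
  dzbar k (fun q => cgrad rho q j) p = chess rho p j k.
Proof. by move=> oU sr Up; exact/esym/(dz_dzbar_comm _ _ oU (csmooth_real oU sr) Up). Qed.

Lemma chess_hermitian U rho p : open U -> smooth_on U rho -> U p ->
  hermitian_mx (chess rho p).
Proof.
move=> oU sr Up j k; have sC := csmooth_real oU sr.
have -> : (chess rho p j k)^*%C =
    dzbar j (fun q => (dzbar k (fun q => (rho q)%:C) q)^*%C) p.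
  exact/esym/(dzbar_conj j (csmooth_dzbar k oU sC) Up).
rewrite -(dzbar_cgrad k j oU sr Up); apply: dzbar_ext Up => // q Uq.
by rewrite (dz_real k oU sr Uq) conjcK.
Qed.

Lemma dz_herm U m (h : C2 R -> 'I_2 -> 'I_2 -> R[i]) Z W p : open U ->
  (forall j k, csmooth U (fun q => h q j k)) ->
  (forall j, csmooth U (fun q => Z q j)) ->
  (forall j, csmooth U (fun q => W q j)) -> U p ->
  dz m (fun q => herm (h q) (Z q) (W q)) p =
  herm (fun j k => dz m (fun q => h q j k) p) (Z p) (W p) +
  herm (h p) (fun j => dz m (fun q => Z q j) p) (W p) +
  herm (h p) (Z p) (fun j => dzbar m (fun q => W q j) p).
Proof.
move=> oU sh sZ sW Up.
have s2 j k : csmooth U (fun q => h q j k * Z q j).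
  exact: csmoothM oU (sh j k) (sZ j).
have sc k : csmooth U (fun q => (W q k)^*%C) by exact: csmooth_conj oU (sW k).
have s3 j k : csmooth U (fun q => h q j k * Z q j * (W q k)^*%C).
  exact: csmoothM oU (s2 j k) (sc k).
have E j k : dz m (fun q => h q j k * Z q j * (W q k)^*%C) p =
    (dz m (fun q => h q j k) p * Z p j + h p j k * dz m (fun q => Z q j) p)
      * (W p k)^*%C + h p j k * Z p j * (dzbar m (fun q => W q k) p)^*%C.
  apply: etrans (dzM m oU (s2 j k) (sc k) Up) _.
  rewrite (dzM m oU (sh j k) (sZ j) Up).
  by rewrite (dz_conj m (sW k) Up).
apply: etrans (dzD m (csmoothD oU (s3 0 0) (s3 0 1)) (csmoothD oU (s3 1 0) (s3 1 1)) Up) _.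
rewrite (dzD m (s3 0 0) (s3 0 1) Up) (dzD m (s3 1 0) (s3 1 1) Up) !E /herm.
move: ((dzbar m (fun q => W q 0) p)^*%C) ((dzbar m (fun q => W q 1) p)^*%C) => x0 x1.
move: (dz m (fun q => Z q 0) p) (dz m (fun q => Z q 1) p) => y0 y1.
move: (dz m (fun q => h q 0 0) p) (dz m (fun q => h q 0 1) p) => *.
move: (dz m (fun q => h q 1 0) p) (dz m (fun q => h q 1 1) p) => *.
move: ((W p 0)^*%C) ((W p 1)^*%C) => *; ring.
Qed.

(** At a Levi-flat point where the mixed term vanishes, the
    growth of the Levi form off the boundary is governed by a tangential
    derivative of mixed, which a multiple of |mixed|^2 in the weight dominates. *)
Lemma normal_derivative_levi U rho p : open U -> smooth_on U rho -> U p ->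
  gradsq (cgrad rho p) != 0 -> levi rho p = 0 -> mixed rho p = 0 ->
  pairing (fun m => dz m (levi rho) p) (normal (cgrad rho p)) =
  pairing (fun m => dz m (mixed rho) p) (tangential (cgrad rho p)).
Proof.
move=> oU sr Up s0 l0 f0.
have sC := csmooth_real oU sr.
have sH j k := csmooth_chess j k oU sr.
have sL j := csmooth_tangential j oU (fun k => csmooth_cgrad k oU sr).
have sN j := csmooth_normal j oU (fun k => csmooth_cgrad k oU sr).
apply: (third_order_identity s0 (chess_hermitian oU sr Up) l0 f0
  (T := fun m j k => dz m (fun q => chess rho q j k) p)
  (B := fun m j => dzbar m (fun q => tangential (cgrad rho q) j) p)
  _ (fun m => dz_herm m oU sH sL sL Up) (fun m => dz_herm m oU sH sN sL Up)).
- by move=> m j k; exact: (dz_comm m j oU (csmooth_dzbar k oU sC) Up).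
- by move=> m; exact: (dzbar_cgrad 1 m oU sr Up).
move=> m; apply: etrans (_ : _ = dzbar m (fun q => -1 * cgrad rho q 0) p) _.
  by apply: dzbar_ext oU _ Up => q _; rewrite mulN1r.
apply: etrans (dzbarZ m (-1) oU (csmooth_cgrad 0 oU sr) Up) _.
by rewrite mulN1r (dzbar_cgrad 0 m oU sr Up).
Qed.

End LeviGeometry.

(** * The Hessian of -(-r)^tau near a boundary point *)

Section LocalEstimate.
Variable R : realType.
Local Open Scope complex_scope.
Implicit Types (U : set (C2 R)) (f rho psi : C2 R -> R) (F : C2 R -> R[i]).
Implicit Types (p q v : C2 R).

Definition cabs2 (x : R[i]) : R := complex.Re x ^+ 2 + complex.Im x ^+ 2.

Lemma cabs2E (x : R[i]) : (cabs2 x)%:C = x * x^*%C.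
Proof. by rewrite /cabs2 add_Re2_Im2 sqr_normc. Qed.

Lemma conj_realE (x : R[i]) : x^*%C = x -> x = (complex.Re x)%:C.
Proof.
case: x => a b [] /eqP; rewrite eq_sym -subr_eq0 opprK -mulr2n mulrn_eq0/=.
by move=> /eqP ->.
Qed.

Lemma gradsq_ge0 (r : 'I_2 -> R[i]) : 0 <= gradsq r.
Proof. by rewrite addr_ge0 ?mulcJ_ge0. Qed.

Lemma gradsq_gt0 (r : 'I_2 -> R[i]) j : r j != 0 -> 0 < gradsq r.
Proof.
move=> rj; rewrite lt0r gradsq_ge0 andbT.
rewrite paddr_eq0 ?mulcJ_ge0// !mulf_eq0 !conjc_eq0 !orbb.
move: rj; case: j => -[|[|//]] i.
  by rewrite (_ : Ordinal i = 0) => [/negPf ->//|]; exact: val_inj.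
by rewrite (_ : Ordinal i = 1) => [/negPf ->|]; [rewrite andbF|exact: val_inj].
Qed.

Lemma HessE f (Z W : 'rV[R[i]]_2) p : Hess f Z W p = herm (chess f p) (Z 0) (W 0).
Proof. exact: (etrans (sum2 _) (f_equal2 +%R (sum2 _) (sum2 _))). Qed.

Lemma dnorm_sqr rho p : dnorm rho p ^+ 2 = gradsq (cgrad rho p).
Proof.
rewrite /dnorm sqrtCK; apply: etrans (sum2 _) (f_equal2 +%R _ _); exact: sqr_normc.
Qed.

Lemma dnorm_ge0 rho p : 0 <= dnorm rho p.
Proof. by rewrite /dnorm sqrtC_ge0 sumr_ge0// => j _; rewrite exprn_ge0. Qed.

Lemma dnorm_conj rho p : (dnorm rho p)^-1^*%C = (dnorm rho p)^-1.
Proof.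
rewrite conjc_inv; congr (_^-1); have := ger0_Im (dnorm_ge0 rho p).
by case: (dnorm rho p) => a b /= ->; rewrite oppr0.
Qed.

Lemma LfieldE rho p j : Lfield rho p 0 j =
  (dnorm rho p)^-1 * tangential (cgrad rho p) j.
Proof. by rewrite !mxE. Qed.

Lemma NfieldE U rho p j : open U -> smooth_on U rho -> U p ->
  Nfield rho p 0 j = (dnorm rho p)^-1 * normal (cgrad rho p) j.
Proof. by move=> oU sr Up; rewrite !mxE (dz_real j oU sr Up). Qed.

Lemma herm_scale (h : 'I_2 -> 'I_2 -> R[i]) (Z W Z' W' : 'I_2 -> R[i]) (c : R[i]) :
  (forall j, Z j = c * Z' j) -> (forall j, W j = c * W' j) -> c^*%C = c ->
  herm h Z W = c ^+ 2 * herm h Z' W'.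
Proof.
move=> EZ EW cc; rewrite /herm !EZ !EW !conjcM cc.
by move: ((W' 0)^*%C) ((W' 1)^*%C) => *; ring.
Qed.

Lemma Levi_formE rho p : Levi_form rho p = (gradsq (cgrad rho p))^-1 * levi rho p.
Proof.
rewrite /Levi_form HessE (herm_scale _ (LfieldE rho p) (LfieldE rho p)).
  by rewrite exprVn dnorm_sqr.
exact: dnorm_conj.
Qed.

Lemma levi_real U rho p : open U -> smooth_on U rho -> U p ->
  levi rho p = (complex.Re (levi rho p))%:C.
Proof.
by move=> oU sr Up; apply/conj_realE/herm_conj/(chess_hermitian oU sr Up).
Qed.

Lemma Hess_LN_mixed U rho p : open U -> smooth_on U rho -> U p ->
  gradsq (cgrad rho p) != 0 ->
  Hess rho (Lfield rho p) (Nfield rho p) p = 0 -> mixed rho p = 0.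
Proof.
move=> oU sr Up s0; rewrite HessE.
rewrite (herm_scale _ (LfieldE rho p) (fun j => NfieldE j oU sr Up) (dnorm_conj rho p)).
rewrite exprVn dnorm_sqr => /eqP; rewrite mulf_eq0 invr_eq0 (negPf s0)/= => /eqP h0.
by rewrite /mixed -(herm_conj _ _ (chess_hermitian oU sr Up)) h0 conjc0.
Qed.

(** The entries of DF_matrix in the frame (L, N), with their powers of d
    removed: h(L, L) = d (Levi form) + d^2 entryLL, h(L, N) = d entryLN and
    h(N, N) = entryNN. *)
Definition entryLL (tau : R[i]) (r g : 'I_2 -> R[i]) (K : 'I_2 -> 'I_2 -> R[i]) :=
  herm K (tangential r) (tangential r) -
  tau * (pairing g (tangential r) * (pairing g (tangential r))^*%C).
Definition entryLN (tau d : R[i]) (r g : 'I_2 -> R[i]) (H K : 'I_2 -> 'I_2 -> R[i]) :=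
  herm H (tangential r) (normal r) + d * herm K (tangential r) (normal r) -
  tau * gradsq r * pairing g (tangential r) -
  tau * d * (pairing g (tangential r) * (pairing g (normal r))^*%C).
Definition entryNN (tau d : R[i]) (r g : 'I_2 -> R[i]) (H K : 'I_2 -> 'I_2 -> R[i]) :=
  (1 - tau) * (gradsq r * gradsq r) +
  d * (herm H (normal r) (normal r) + d * herm K (normal r) (normal r) -
    tau * gradsq r * ((pairing g (normal r))^*%C + pairing g (normal r)) -
    tau * d * (pairing g (normal r) * (pairing g (normal r))^*%C)).

Section Entries.
Variables (tau d : R[i]) (r g : 'I_2 -> R[i]) (H K : 'I_2 -> 'I_2 -> R[i]).
Let h := DF_matrix tau d r g H K.

Lemma DF_matrix_LL : herm h (tangential r) (tangential r) =
  d * herm H (tangential r) (tangential r) + d ^+ 2 * entryLL tau r g K.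
Proof.
rewrite herm_DF_matrix pairing_tangential conjc0 /entryLL.
move: (herm H _ _) (herm K _ _) (pairing g _) => a b c.
by move: (c^*%C) => *; ring.
Qed.

Lemma DF_matrix_LN : herm h (tangential r) (normal r) =
  d * entryLN tau d r g H K.
Proof.
rewrite herm_DF_matrix pairing_tangential pairing_normal gradsq_conj /entryLN.
move: (herm H _ _) (herm K _ _) (pairing g (tangential r)) (gradsq r) => a b c s.
by move: ((pairing g (normal r))^*%C) => *; ring.
Qed.

Lemma DF_matrix_NN : herm h (normal r) (normal r) = entryNN tau d r g H K.
Proof.
rewrite herm_DF_matrix pairing_normal gradsq_conj /entryNN.
move: (herm H _ _) (herm K _ _) (pairing g (normal r)) (gradsq r) => a b c s.
by move: (c^*%C) => *; ring.
Qed.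

End Entries.

Section Near.
Variables (U : set (C2 R)) (rho psi : C2 R -> R) (tau : R).
Hypotheses (oU : open U) (srho : smooth_on U rho) (spsi : smooth_on U psi).
Let t := tau%:C.
Let d q := (- rho q)%:C.
Let r := cgrad rho.
Let g := cgrad psi.
Let H := chess rho.
Let K := chess psi.

Let sd : csmooth U d. Proof. by apply: csmooth_real => //; exact: smoothN. Qed.
Let sL j : csmooth U (fun q => tangential (r q) j).
Proof. exact: csmooth_tangential oU (fun k => csmooth_cgrad k oU srho). Qed.
Let sN j : csmooth U (fun q => normal (r q) j).
Proof. exact: csmooth_normal oU (fun k => csmooth_cgrad k oU srho). Qed.
Let sg j : csmooth U (fun q => g q j). Proof. exact: csmooth_cgrad. Qed.
Let sr j : csmooth U (fun q => r q j). Proof. exact: csmooth_cgrad. Qed.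
Let sH j k : csmooth U (fun q => H q j k). Proof. exact: csmooth_chess. Qed.
Let sK j k : csmooth U (fun q => K q j k). Proof. exact: csmooth_chess. Qed.
Let ss : csmooth U (fun q => gradsq (r q)).
Proof.
exact: csmoothD oU (csmoothM oU (sr 0) (csmooth_conj oU (sr 0)))
  (csmoothM oU (sr 1) (csmooth_conj oU (sr 1))).
Qed.
Let sgL : csmooth U (fun q => pairing (g q) (tangential (r q))).
Proof. exact: csmooth_pairing oU sg sL. Qed.
Let sgN : csmooth U (fun q => pairing (g q) (normal (r q))).
Proof. exact: csmooth_pairing oU sg sN. Qed.

Let scA : csmooth U (fun q => entryLL t (r q) (g q) (K q)).
Proof.
apply: csmoothB oU (csmooth_herm oU sK sL sL) _.
exact: (csmoothZ t oU (csmoothM oU sgL (csmooth_conj oU sgL))).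
Qed.

Let scB : csmooth U (fun q => entryLN t (d q) (r q) (g q) (H q) (K q)).
Proof.
apply: csmoothB oU (csmoothB oU (csmoothD oU (csmooth_herm oU sH sL sN)
  (csmoothM oU sd (csmooth_herm oU sK sL sN))) _) _.
  exact: (csmoothM oU (csmoothZ t oU ss) sgL).
exact: (csmoothM oU (csmoothZ t oU sd) (csmoothM oU sgL (csmooth_conj oU sgN))).
Qed.

Let scD : csmooth U (fun q => entryNN t (d q) (r q) (g q) (H q) (K q)).
Proof.
apply: csmoothD oU (csmoothZ _ oU (csmoothM oU ss ss)) (csmoothM oU sd _).
apply: csmoothB oU (csmoothB oU (csmoothD oU (csmooth_herm oU sH sN sN)
  (csmoothM oU sd (csmooth_herm oU sK sN sN))) _) _.
  exact: (csmoothM oU (csmoothZ t oU ss) (csmoothD oU (csmooth_conj oU sgN) sgN)).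
exact: (csmoothM oU (csmoothZ t oU sd) (csmoothM oU sgN (csmooth_conj oU sgN))).
Qed.

Lemma continuous_near_gt0 (f : C2 R -> R) p : {for p, continuous f} -> 0 < f p ->
  \forall q \near p, 0 < f q.
Proof. by move=> /cvgr_gt cf f0; exact: cf. Qed.

Let LL_alg (x l a : R) (y z : R[i]) : y = l%:C -> z = a%:C ->
  x%:C * y + x%:C ^+ 2 * z = (x * l + x ^+ 2 * a)%:C.
Proof. by move=> -> ->; rewrite !expr2 rmorphD !rmorphM. Qed.

Let BAD_alg (x ll e : R) (b : R[i]) : x ^+ 2 * cabs2 b <= ll * e ->
  x%:C * b * (x%:C * b)^*%C <= ll%:C * e%:C.
Proof.
move=> h; rewrite conjcM conjc_real mulrACA -cabs2E -!rmorphM lecR.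
by rewrite -expr2.
Qed.

(** Put d = -rho, and let A, B, D be the three entries. For d > 0 near p the bound
    on the Levi form gives h(L, L) >= d^2 (A - m), while |h(L, N)|^2 = d^2 |B|^2
    and h(N, N) = D. After division by d^2 the determinant condition becomes a
    strict inequality that holds at p, hence near p. *)
Lemma DF_matrix_near p (m : R) : U p -> rho p = 0 -> gradsq (r p) != 0 ->
  (\forall q \near p, rho q < 0 -> m * rho q <= complex.Re (levi rho q)) ->
  tau < 1 ->
  cabs2 (entryLN t 0 (r p) (g p) (H p) (K p)) <
    (complex.Re (entryLL t (r p) (g p) (K p)) - m) *
    complex.Re (entryNN t 0 (r p) (g p) (H p) (K p)) ->
  \forall q \near p, rho q < 0 -> forall V,
    0 <= herm (DF_matrix t (d q) (r q) (g q) (H q) (K q)) V V.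
Proof.
move=> Up p0 s0 mlevi tau1 BAD.
pose A q := complex.Re (entryLL t (r q) (g q) (K q)).
pose D q := complex.Re (entryNN t (d q) (r q) (g q) (H q) (K q)).
pose B q := entryLN t (d q) (r q) (g q) (H q) (K q).
have d0 : d p = 0 by rewrite /d p0 oppr0.
have sp0 : 0 < gradsq (r p) by rewrite lt0r s0 gradsq_ge0.
have cS : {for p, continuous (fun q => complex.Re (gradsq (r q)))}.
  exact: smooth_continuous ss.1 Up.
have cD : {for p, continuous D} by exact: smooth_continuous scD.1 Up.
have sE : smooth_on U (fun q => (A q - m) * D q - cabs2 (B q)).
  apply: smoothB oU (smoothM oU (smoothB oU scA.1 (smooth_cst m oU)) scD.1) _.
  exact: smoothD oU (smoothM oU scB.1 scB.1) (smoothM oU scB.2 scB.2).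
have Sp : 0 < complex.Re (gradsq (r p)) by move: sp0; rewrite ltcE => /andP[].
have Dp : 0 < D p.
  rewrite /D d0 /entryNN mul0r addr0 (conj_realE (gradsq_conj (r p))).
  have -> : 1 - t = (1 - tau)%:C by rewrite /t rmorphB rmorph1.
  by rewrite -!rmorphM /= !mulr_gt0// subr_gt0.
have Ep : 0 < (A p - m) * D p - cabs2 (B p) by rewrite subr_gt0 /A /D /B d0.
have nU : \forall q \near p, U q by exact: open_nbhs_nbhs.
have nS := continuous_near_gt0 cS Sp.
have nD := continuous_near_gt0 cD Dp.
have nE := continuous_near_gt0 (smooth_continuous sE Up) Ep.
near=> q => rq V.
have Uq : U q by exact: (near nU q).
have Sq : 0 < complex.Re (gradsq (r q)) by exact: (near nS q).
have Dq : 0 < D q by exact: (near nD q).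
have Eq : 0 < (A q - m) * D q - cabs2 (B q) by exact: (near nE q).
have mq : m * rho q <= complex.Re (levi rho q) by apply: (near mlevi q).
have hH : hermitian_mx (H q) by exact: chess_hermitian Uq.
have hK : hermitian_mx (K q) by exact: chess_hermitian Uq.
have hDF : hermitian_mx (DF_matrix t (d q) (r q) (g q) (H q) (K q)).
  by apply: DF_matrix_hermitian => //; rewrite conjc_real.
have NN : herm (DF_matrix t (d q) (r q) (g q) (H q) (K q)) (normal (r q)) (normal (r q))
    = (D q)%:C.
  by rewrite (conj_realE (herm_conj _ _ hDF)) DF_matrix_NN.
have LL : herm (DF_matrix t (d q) (r q) (g q) (H q) (K q)) (tangential (r q))
    (tangential (r q)) = (- rho q * complex.Re (levi rho q) + (- rho q) ^+ 2 * A q)%:C.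
  rewrite DF_matrix_LL.
  have cA : (entryLL t (r q) (g q) (K q))^*%C = entryLL t (r q) (g q) (K q).
    rewrite /entryLL conjcB !conjcM conjcK (herm_conj _ _ hK) conjc_real.
    by congr (_ - _ * _); rewrite mulrC.
  exact: LL_alg (levi_real oU srho Uq) (conj_realE cA).
have LN : herm (DF_matrix t (d q) (r q) (g q) (H q) (K q)) (tangential (r q))
    (normal (r q)) = d q * B q by rewrite DF_matrix_LN.
apply: (herm_ge0 hDF _ (tangential_normal_basis (r q) V)).
- by apply/eqP => e; move: Sq; rewrite e ltxx.
- by rewrite NN ltcR.
rewrite LL LN NN; apply: BAD_alg.
move: mq Dq Eq rq; move: (A q) (D q) (cabs2 (B q)) (complex.Re (levi rho q)) (rho q).
move=> a e b l ro.
move=> h1 h2 h3 h4.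
have P1 : 0 <= (l - m * ro) * (- ro) * e.
  by rewrite !mulr_ge0 ?subr_ge0 ?oppr_ge0 ?(ltW h2, ltW h4).
have P2 : 0 <= (- ro) ^+ 2 * ((a - m) * e - b) by rewrite mulr_ge0 ?sqr_ge0 ?ltW.
rewrite -subr_ge0; have := addr_ge0 P1 P2; congr (0 <= _); ring.
Unshelve. all: by end_near. Qed.

End Near.
End LocalEstimate.

(** * The weight *)

Section Weight.
Variable R : realType.
Local Open Scope complex_scope.
Implicit Types (U : set (C2 R)) (f rho : C2 R -> R) (F : C2 R -> R[i]).
Implicit Types (p q v : C2 R) (j k : 'I_2).

Definition normsq q : R := cabs2 (ccoord q 0) + cabs2 (ccoord q 1).
(** The first term has no gradient where mixed vanishes, but its complex Hessian
    there is at least M |L mixed|^2 on L; the second one makes the complex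
    Hessian strictly positive, at the cost of a gradient of size eps. *)
Definition weight (M eps : R) rho q : R :=
  M * cabs2 (mixed rho q) + eps * normsq q.

Lemma linear_coord1 j : linear (fun q : C2 R => q.1 ord0 j).
Proof. by move=> a x y; rewrite !mxE. Qed.

Lemma linear_coord2 j : linear (fun q : C2 R => q.2 ord0 j).
Proof. by move=> a x y; rewrite !mxE. Qed.

Lemma continuous_coord1 j : continuous (fun q : C2 R => q.1 ord0 j).
Proof.
move=> q; apply: (@continuous_comp _ _ _ fst (fun A : 'rV[R]_2 => A ord0 j)).
  exact: cvg_fst.
exact: coord_continuous.
Qed.

Lemma continuous_coord2 j : continuous (fun q : C2 R => q.2 ord0 j).
Proof.
move=> q; apply: (@continuous_comp _ _ _ snd (fun A : 'rV[R]_2 => A ord0 j)).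
  exact: cvg_snd.
exact: coord_continuous.
Qed.

Lemma smooth_continuous_linear U f : open U -> linear f -> continuous f ->
  smooth_on U f /\ forall v p, 'D_v f p = f v.
Proof.
move=> oU lf cf; pose fM := GRing.isLinear.Build _ _ _ _ f lf.
pose g : {linear C2 R -> R} := HB.pack f fM.
split; first exact: (@smooth_linear _ U g oU cf).
move=> v p; rewrite (@deriveE _ _ _ f) ?(@diff_lin _ _ _ g)//.
exact: (@linear_differentiable _ _ _ g).
Qed.

Lemma csmooth_coord U j : open U -> csmooth U (fun q => ccoord q j).
Proof.
move=> oU; split; rewrite /ccoord /=.
  by have [] := smooth_continuous_linear oU (@linear_coord1 j) (@continuous_coord1 j).
by have [] := smooth_continuous_linear oU (@linear_coord2 j) (@continuous_coord2 j).
Qed.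

Lemma cderive_coord v j p : cderive v (fun q => ccoord q j) p = ccoord v j.
Proof.
have [_ E1] := smooth_continuous_linear (@openT _) (@linear_coord1 j)
  (@continuous_coord1 j).
have [_ E2] := smooth_continuous_linear (@openT _) (@linear_coord2 j)
  (@continuous_coord2 j).
exact: (f_equal2 (@Complex R) (E1 v p) (E2 v p)).
Qed.

Lemma ccoord_dirx j k : ccoord (dirx R k) j = (j == k)%:R.
Proof. by rewrite /ccoord !mxE /= eq_sym; case: eqP. Qed.

Lemma ccoord_diry j k : ccoord (diry R k) j = 'i * (j == k)%:R.
Proof.
rewrite /ccoord !mxE /= -complexiE; case: eqP => _; apply: complex_ext => /=.
all: by rewrite ?mulr0 ?mulr1 ?mul0r ?mul1r ?subr0 ?addr0 ?add0r.
Qed.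

Lemma dz_coord j k p : dz k (fun q => ccoord q j) p = (j == k)%:R.
Proof.
rewrite /dz !cderive_coord ccoord_dirx ccoord_diry mulrA -expr2 sqrCi.
by case: eqP => _ /=; field.
Qed.

Lemma dzbar_coord j k p : dzbar k (fun q => ccoord q j) p = 0.
Proof.
rewrite /dzbar !cderive_coord ccoord_dirx ccoord_diry mulrA -expr2 sqrCi.
by ring.
Qed.

Lemma dz_absq U F j p : open U -> csmooth U F -> U p ->
  dz j (fun q => F q * (F q)^*%C) p =
  dz j F p * (F p)^*%C + F p * (dzbar j F p)^*%C.
Proof.
move=> oU sF Up; apply: etrans (dzM j oU sF (csmooth_conj oU sF) Up) _.
by rewrite (dz_conj j sF Up).
Qed.

Lemma dzbar_absq U F j p : open U -> csmooth U F -> U p ->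
  dzbar j (fun q => F q * (F q)^*%C) p =
  dzbar j F p * (F p)^*%C + F p * (dz j F p)^*%C.
Proof.
move=> oU sF Up; apply: etrans (dzbarM j oU sF (csmooth_conj oU sF) Up) _.
by rewrite (dzbar_conj j sF Up).
Qed.

Lemma dz_dzbar_absq U F j k p : open U -> csmooth U F -> U p ->
  dz j (dzbar k (fun q => F q * (F q)^*%C)) p =
  (dz j (dzbar k F) p * (F p)^*%C + F p * (dzbar j (dz k F) p)^*%C) +
  (dz j F p * (dz k F p)^*%C + dzbar k F p * (dzbar j F p)^*%C).
Proof.
move=> oU sF Up.
have s1 := csmooth_dzbar k oU sF; have s2 := csmooth_conj oU sF.
have s3 := csmooth_dz k oU sF; have s4 := csmooth_conj oU s3.
apply: etrans (dz_ext j oU (fun q Uq => dzbar_absq k oU sF Uq) Up) _.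
apply: etrans (dzD j (csmoothM oU s1 s2) (csmoothM oU sF s4) Up) _.
rewrite (dzM j oU s1 s2 Up) (dzM j oU sF s4 Up) (dz_conj j sF Up) (dz_conj j s3 Up).
move: (dz j (dzbar k F) p) (dzbar k F p) (dz j F p) => a b c.
move: ((F p)^*%C) ((dzbar j F p)^*%C) ((dz k F p)^*%C) ((dzbar j (dz k F) p)^*%C).
by move=> *; ring.
Qed.

Let herm_weight_alg (h : 'I_2 -> 'I_2 -> R[i]) (M eps : R) (a b L : 'I_2 -> R[i]) :
  (forall j k, h j k = M%:C * (a j * (a k)^*%C + b k * (b j)^*%C) +
                       eps%:C * (j == k)%:R) ->
  herm h L L = (M * (cabs2 (pairing a L) + cabs2 (pairing (fun j => (b j)^*%C) L)) +
    eps * (cabs2 (L 0) + cabs2 (L 1)))%:C.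
Proof.
move=> hE.
transitivity (M%:C * (pairing a L * (pairing a L)^*%C +
    pairing (fun j => (b j)^*%C) L * (pairing (fun j => (b j)^*%C) L)^*%C) +
  eps%:C * (L 0 * (L 0)^*%C + L 1 * (L 1)^*%C)); last first.
  by rewrite -!cabs2E -!rmorphD -!rmorphM -rmorphD.
rewrite /herm /pairing !hE /= !conjcD !conjcM !conjcK.
move: (M%:C) (eps%:C) (a 0) (a 1) (b 0) (b 1) (L 0) (L 1) => m e a0 a1 b0 b1 l0 l1.
move: (a0^*%C) (a1^*%C) (b0^*%C) (b1^*%C) (l0^*%C) (l1^*%C) => *.
by ring.
Qed.

Section WeightDerivatives.
Variables (U : set (C2 R)) (rho : C2 R -> R) (M eps : R).
Hypotheses (oU : open U) (srho : smooth_on U rho).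
Let psi := weight M eps rho.
Let sm := csmooth_mixed oU srho.
Let sc j := csmooth_coord j oU.
Let sabs F (sF : csmooth U F) := csmoothM oU sF (csmooth_conj oU sF).
Let sM := csmoothZ M%:C oU (sabs sm).
Let sn := csmoothD oU (sabs (sc 0)) (sabs (sc 1)).
Let sE := csmoothZ eps%:C oU sn.

Lemma weightE q : (psi q)%:C =
  M%:C * (mixed rho q * (mixed rho q)^*%C) +
  eps%:C * (ccoord q 0 * (ccoord q 0)^*%C + ccoord q 1 * (ccoord q 1)^*%C).
Proof. by rewrite -!cabs2E -!rmorphD -!rmorphM -rmorphD. Qed.

Lemma smooth_weight : smooth_on U psi.
Proof.
have [sR _] : csmooth U (fun q => (psi q)%:C) by
  apply: csmooth_ext (csmoothD oU sM sE) => // q _; rewrite weightE.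
by apply: smooth_ext sR.
Qed.

Lemma cgrad_weight p j : U p -> mixed rho p = 0 ->
  cgrad psi p j = eps%:C * (ccoord p j)^*%C.
Proof.
move=> Up m0.
apply: etrans (dz_ext j oU (fun q _ => weightE q) Up) _.
apply: etrans (dzD j sM sE Up) _.
rewrite (dzZ j M%:C oU (sabs sm) Up) (dz_absq j oU sm Up) m0 conjc0 mulr0 mul0r.
rewrite addr0 mulr0 add0r (dzZ j eps%:C oU sn Up); congr (_ * _).
apply: etrans (dzD j (sabs (sc 0)) (sabs (sc 1)) Up) _.
rewrite (dz_absq j oU (sc 0) Up) (dz_absq j oU (sc 1) Up) !dz_coord !dzbar_coord.
rewrite !conjc0 !mulr0 !addr0; case: j => -[|[|//]] i.
  by rewrite (_ : Ordinal i = 0) ?mul1r ?mul0r ?addr0//; exact: val_inj.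
by rewrite (_ : Ordinal i = 1) ?mul1r ?mul0r ?add0r//; exact: val_inj.
Qed.

Lemma chess_weight p j k : U p -> mixed rho p = 0 ->
  chess psi p j k = M%:C * (dz j (mixed rho) p * (dz k (mixed rho) p)^*%C +
    dzbar k (mixed rho) p * (dzbar j (mixed rho) p)^*%C) + eps%:C * (j == k)%:R.
Proof.
move=> Up m0.
have E1 q : U q -> dzbar k (fun q => (psi q)%:C) q =
    M%:C * dzbar k (fun q => mixed rho q * (mixed rho q)^*%C) q +
    eps%:C * (dzbar k (fun q => ccoord q 0 * (ccoord q 0)^*%C) q +
              dzbar k (fun q => ccoord q 1 * (ccoord q 1)^*%C) q).
  move=> Uq; apply: etrans (dzbar_ext k oU (fun q _ => weightE q) Uq) _.
  apply: etrans (dzbarD k sM sE Uq) (f_equal2 +%R (dzbarZ k M%:C oU (sabs sm) Uq) _).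
  apply: etrans (dzbarZ k eps%:C oU sn Uq) (f_equal (fun x => _ * x) _).
  exact: (dzbarD k (sabs (sc 0)) (sabs (sc 1)) Uq).
apply: etrans (dz_ext j oU E1 Up) _.
have t1 := csmooth_dzbar k oU (sabs sm).
have t2 := csmooth_dzbar k oU (sabs (sc 0)).
have t3 := csmooth_dzbar k oU (sabs (sc 1)).
apply: etrans (dzD j (csmoothZ M%:C oU t1) (csmoothZ eps%:C oU (csmoothD oU t2 t3)) Up) _.
apply: f_equal2.
  apply: etrans (dzZ j M%:C oU t1 Up) (f_equal (fun x => _ * x) _).
  apply: etrans (dz_dzbar_absq j k oU sm Up) _; rewrite m0 conjc0.
  have alg (a b x : R[i]) : a * 0 + 0 * b + x = x by rewrite mulr0 mul0r addr0 add0r.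
  exact: alg.
apply: etrans (dzZ j eps%:C oU (csmoothD oU t2 t3) Up) (f_equal (fun x => _ * x) _).
apply: etrans (dzD j t2 t3 Up) _.
have Ei i : dz j (dzbar k (fun q => ccoord q i * (ccoord q i)^*%C)) p =
    (i == j)%:R * (i == k)%:R.
  rewrite (dz_dzbar_absq j k oU (sc i) Up) !dz_coord !dzbar_coord conjc0 mulr0 addr0.
  have -> : dz j (dzbar k (fun q => ccoord q i)) p = 0.
    apply: etrans (dz_ext j oU (fun q _ => dzbar_coord i k q) Up) _.
    exact: dz_cst.
  have -> : dzbar j (dz k (fun q => ccoord q i)) p = 0.
    apply: etrans (dzbar_ext j oU (fun q _ => dz_coord i k q) Up) _.
    exact: dzbar_cst.
  by rewrite conjc0 mul0r mulr0 !add0r conjc_nat.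
rewrite !Ei; case: j {E1 Ei} => -[|[|//]] i; case: k {t1 t2 t3} => -[|[|//]] i';
by rewrite ?mul0r ?mulr0 ?mul1r ?addr0 ?add0r.
Qed.

Lemma herm_chess_weight p (L : 'I_2 -> R[i]) : U p -> mixed rho p = 0 ->
  herm (chess psi p) L L = (M * (cabs2 (pairing (fun j => dz j (mixed rho) p) L) +
      cabs2 (pairing (fun j => (dzbar j (mixed rho) p)^*%C) L)) +
    eps * (cabs2 (L 0) + cabs2 (L 1)))%:C.
Proof.
move=> Up m0; apply: herm_weight_alg => j k; exact: chess_weight.
Qed.

End WeightDerivatives.
End Weight.

(** * Positivity near the boundary *)

Section NearBoundary.
Variable R : realType.
Local Open Scope complex_scope.
Implicit Types (U : set (C2 R)) (f G rho : C2 R -> R) (p q v : C2 R).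

Lemma near_segment (P : C2 R -> Prop) p v : (\forall q \near p, P q) ->
  exists2 r : R, 0 < r &
    \forall q \near p, forall t, 0 <= t <= r -> P (q + t *: v).
Proof.
move=> /nbhs_normP[e /= e0 eP].
have d0 : 0 < `|v| + 1 by rewrite ltr_wpDl.
have e2 : 0 < e / 2 by rewrite divr_gt0.
exists (e / 2 / (`|v| + 1)); first exact: divr_gt0.
apply/nbhs_normP; exists (e / 2) => //= q pq t /andP[t0 tr].
apply: eP; rewrite /= opprD addrA (le_lt_trans (ler_normB _ _))//.
rewrite [e]splitr ltr_leD// normrZ ger0_norm// (le_trans (ler_wpM2r _ tr))//.
by rewrite mulrAC ler_pdivrMr// ler_pM2l// lerDl.
Qed.

(** From a point with rho < 0, the ray in the direction v, along which rho
    increases, meets {rho = 0}, where G is nonnegative; G has only decreased on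
    the way. *)
Lemma near_line_nonneg U rho G p v : open U -> smooth_on U rho -> smooth_on U G ->
  U p -> rho p = 0 -> 0 < 'D_v rho p -> 'D_v G p < 0 ->
  (forall q, U q -> rho q = 0 -> 0 <= G q) ->
  \forall q \near p, rho q < 0 -> 0 <= G q.
Proof.
move=> oU sr sG Up p0 drho dG G0.
pose c := 'D_v rho p / 2.
have c0 : 0 < c by rewrite divr_gt0.
have n1 : \forall q \near p, U q by exact: open_nbhs_nbhs.
have n2 : \forall q \near p, 0 < 'D_v rho q - c.
  have s1 : smooth_on U (fun q => 'D_v rho q - c).
    exact: smoothB oU (smooth_derive v sr) (smooth_cst c oU).
  apply: continuous_near_gt0 (smooth_continuous s1 Up) _.
  by rewrite subr_gt0 /c ltr_pdivrMr// ltr_pMr// ltr1n.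
have n3 : \forall q \near p, 0 < - 'D_v G q.
  have s1 : smooth_on U (fun q => - 'D_v G q).
    exact: smoothN oU (smooth_derive v sG).
  apply: continuous_near_gt0 (smooth_continuous s1 Up) _.
  by rewrite oppr_gt0.
have [r r0 nr] := near_segment v (filterI n1 (filterI n2 n3)).
have n4 : \forall q \near p, 0 < rho q + c * r.
  apply: continuous_near_gt0.
    exact: (smooth_continuous (smoothD oU sr (smooth_cst (c * r) oU)) Up).
  by rewrite p0 add0r mulr_gt0.
near=> q => rq.
have Hq : forall t, 0 <= t <= r -> U (q + t *: v) /\
    0 < 'D_v rho (q + t *: v) - c /\ 0 < - 'D_v G (q + t *: v).
  exact: (near nr q).
have q4 : 0 < rho q + c * r by exact: (near n4 q).
have Uq t (tr : 0 <= t <= r) : U (q + t *: v) by exact: (Hq t tr).1.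
have [t0 /andP[t00 t0r] E0] := MVT_line r0 sr Uq.
have tr0 : 0 <= t0 <= r by rewrite !ltW.
have rr : 0 < rho (q + r *: v).
  rewrite -(subrK (rho q) (rho (q + r *: v))) E0.
  have := (Hq t0 tr0).2.1; rewrite subr_gt0 => h.
  apply: lt_le_trans q4 _; rewrite addrC lerD2r [c * r]mulrC.
  by rewrite ler_pM2l// ltW.
have [t] : exists2 t, t \in `[0, r] & rho (q + t *: v) = 0.
  apply: (@IVT R (fun t => rho (q + t *: v)) 0 r 0 (ltW r0)).
    exact: within_continuous_line sr Uq.
  rewrite scale0r addr0 ge_min le_max (ltW rq) (ltW rr) orbT.
  done.
rewrite in_itv/= => /andP[tge0 tler] rt0.
have tgt0 : 0 < t.
  rewrite lt_neqAle tge0 andbT; apply/eqP => t0E.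
  by move: rt0; rewrite -t0E scale0r addr0 => rqE; rewrite rqE ltxx in rq.
have Uq' t' : 0 <= t' <= t -> U (q + t' *: v).
  by move=> /andP[a b]; apply: Uq; rewrite a (le_trans b).
have [t1 /andP[t10 t1t] E1] := MVT_line tgt0 sG Uq'.
have := G0 _ (Uq _ _) rt0; rewrite tge0 tler => /(_ isT).
rewrite -(subrK (G q) (G (q + t *: v))) E1 => h.
have t1r : 0 <= t1 <= r by rewrite (ltW t10) (le_trans (ltW t1t)).
have := (Hq t1 t1r).2.2; rewrite oppr_gt0 => h'.
apply: le_trans h _; rewrite -lerBrDr subrr.
by rewrite pmulr_rle0// ltW.
Unshelve. all: by end_near. Qed.

(** Along the real vector v with coordinates N, the derivative of the Levi form
    is 2 Re (L mixed) and that of rho is 2 |grad rho|^2. Hence the difference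
    levi - m rho, which is nonnegative on the boundary, decreases along v. *)
Lemma levi_lower_bound U rho p (m : R) : open U -> smooth_on U rho -> U p ->
  rho p = 0 -> 0 < complex.Re (gradsq (cgrad rho p)) ->
  levi rho p = 0 -> mixed rho p = 0 ->
  (forall q, U q -> rho q = 0 -> 0 <= complex.Re (levi rho q)) ->
  complex.Re (pairing (fun j => dz j (mixed rho) p) (tangential (cgrad rho p))) <
    m * complex.Re (gradsq (cgrad rho p)) ->
  \forall q \near p, rho q < 0 -> m * rho q <= complex.Re (levi rho q).
Proof.
move=> oU sr Up p0 s0 l0 m0 pos hm.
pose v := cvector (normal (cgrad rho p)).
pose f q := complex.Re (levi rho q).
have sf : smooth_on U f by have [] := csmooth_levi oU sr.
have delE (g : C2 R -> R) : pairing (fun j => dz j (fun q => (g q)%:C) p)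
   (normal (cgrad rho p)) = del g v p.
  by rewrite /del /pairing !ccoord_cvector.
have two (a : R) (x : R[i]) : a%:C = x + x^*%C -> a = 2 * complex.Re x.
  case: x => x y /= [-> _]; ring.
have sn : gradsq (cgrad rho p) != 0.
  by apply/eqP => e; rewrite e ltxx in s0.
have E j : dz j (fun q => (f q)%:C) p = dz j (levi rho) p.
  exact: (dz_ext j oU (fun q Uq => esym (levi_real oU sr Uq)) Up).
have Ef : del f v p =
    pairing (fun j => dz j (mixed rho) p) (tangential (cgrad rho p)).
  apply: etrans (esym (delE f)) _.
  apply: etrans _ (normal_derivative_levi oU sr Up sn l0 m0).
  exact: (f_equal2 (fun a b => a * _ + b * _) (E 0) (E 1)).
have df : 'D_v f p = 2 * complex.Re
    (pairing (fun j => dz j (mixed rho) p) (tangential (cgrad rho p))).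
  exact: (etrans (two _ _ (derive_del v oU sf Up))
    (f_equal (fun x => 2 * complex.Re x) Ef)).
have dr : 'D_v rho p = 2 * complex.Re (gradsq (cgrad rho p)).
  exact: (etrans (two _ _ (derive_del v oU sr Up))
    (f_equal (fun x => 2 * complex.Re x) (esym (delE rho)))).
pose G q := f q - m * rho q.
have sG : smooth_on U G by exact: smoothB oU sf (smoothZ m oU sr).
have dG : 'D_v G p = 'D_v f p - m * 'D_v rho p.
  rewrite (smooth_deriveB v sf (smoothZ m oU sr) Up).
  rewrite (smooth_deriveM v (smooth_cst m oU) sr Up).
  by rewrite derive_cst mul0r add0r.
have := near_line_nonneg oU sr sG Up p0 (v := v) _ _ _.
rewrite dG df dr mulr_gt0// => /(_ isT).
rewrite mulrCA -mulrBr pmulr_rlt0// subr_lt0 => /(_ hm).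
have Gpos q : U q -> rho q = 0 -> 0 <= G q.
  by move=> Uq rq; rewrite /G rq mulr0 subr0; exact: pos.
move=> /(_ Gpos) nG; near=> q => rq.
by rewrite -subr_ge0; exact: (near nG q).
Unshelve. all: by end_near. Qed.

(** The number m has to lie between y / s and A - tau^2 g2 / (1 - tau), where
    y = Re (L mixed), s = |grad rho|^2 and g2 = |L psi|^2. The terms in g2, of
    order eps^2, are at most eps s / 2 since eps is small, and
    y / s < M y^2 + eps s / 2 by the inequality of arithmetic and geometric means
    since M is large. *)
Lemma choose_slope (s s0 eps tau Rb M y g2 A : R) : 0 < s0 -> s0 <= s ->
  0 < eps -> 0 < tau < 1 -> eps * Rb * tau <= (1 - tau) / 2 ->
  (eps * s0 ^+ 3)^-1 <= M -> g2 <= eps ^+ 2 * (s * Rb) ->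
  M * y ^+ 2 + eps * s - tau * g2 <= A ->
  exists2 m, y < m * s & tau ^+ 2 * s ^+ 2 * g2 < (A - m) * ((1 - tau) * s ^+ 2).
Proof.
move=> s00 s0s eps0 /andP[tau0 tau1] hR hM hg hA.
have sgt0 : 0 < s by exact: lt_le_trans s0s.
have t1 : 0 < 1 - tau by rewrite subr_gt0.
have D0 : 0 < (1 - tau) * s ^+ 2 by rewrite mulr_gt0// exprn_gt0.
suff key : y / s < A - tau ^+ 2 * g2 / (1 - tau).
  exists ((y / s + (A - tau ^+ 2 * g2 / (1 - tau))) / 2).
    rewrite -ltr_pdivrMr// ltr_pdivlMr// mulr_natr mulr2n.
    by rewrite ltrD2l.
  set B := tau ^+ 2 * g2 / (1 - tau) in key *.
  have -> : tau ^+ 2 * s ^+ 2 * g2 = B * ((1 - tau) * s ^+ 2).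
    by rewrite /B; field; rewrite gt_eqF.
  rewrite ltr_pM2r//; move: key; set Y := y / s; lra.
have h1 : tau * g2 + tau ^+ 2 * g2 / (1 - tau) <= eps * s / 2.
  have -> : tau * g2 + tau ^+ 2 * g2 / (1 - tau) = tau * g2 / (1 - tau).
    by field; rewrite gt_eqF.
  rewrite ler_pdivrMr//.
  apply: (@le_trans _ _ (tau * (eps ^+ 2 * (s * Rb)))); first by rewrite ler_pM2l.
  have -> : tau * (eps ^+ 2 * (s * Rb)) = eps * s * (eps * Rb * tau) by ring.
  have -> : eps * s / 2 * (1 - tau) = eps * s * ((1 - tau) / 2) by ring.
  by rewrite ler_pM2l// mulr_gt0.
have h2 : y / s < M * y ^+ 2 + eps * s / 2.
  have hs : (eps * s ^+ 3)^-1 <= M.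
    apply: le_trans hM; rewrite lef_pV2 ?posrE ?mulr_gt0 ?exprn_gt0//.
    by rewrite ler_pM2l// lerXn2r ?nnegrE// ltW.
  apply: (@lt_le_trans _ _ ((eps * s ^+ 3)^-1 * y ^+ 2 + eps * s / 2)); last first.
    by rewrite lerD2r ler_wpM2r// sqr_ge0.
  (* In terms of w the inequality reads w < w^2 + 1/2. *)
  set w := y / (eps * s ^+ 2).
  have -> : y / s = eps * s * w by rewrite /w; field; rewrite !gt_eqF.
  have -> : (eps * s ^+ 3)^-1 * y ^+ 2 = eps * s * w ^+ 2.
    by rewrite /w; field; rewrite !gt_eqF.
  have -> : eps * s * w ^+ 2 + eps * s / 2 = eps * s * (w ^+ 2 + 2^-1) by ring.
  rewrite ltr_pM2l ?mulr_gt0// -subr_gt0.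
  have -> : w ^+ 2 + 2^-1 - w = (w - 2^-1) ^+ 2 + 4^-1 by field.
  by rewrite ltr_wpDl ?sqr_ge0// invr_gt0.
move: h1 h2 hA; set B := tau ^+ 2 * g2 / (1 - tau); set Y := y / s; lra.
Qed.

Lemma cabs2_ge0 (x : R[i]) : 0 <= cabs2 x.
Proof. by rewrite addr_ge0// sqr_ge0. Qed.

Lemma cabs2M (x y : R[i]) : cabs2 (x * y) = cabs2 x * cabs2 y.
Proof. by rewrite /cabs2 complex_ReM complex_ImM; ring. Qed.

Lemma cabs2_real (a : R) : cabs2 a%:C = a ^+ 2.
Proof. by rewrite /cabs2 /= expr0n addr0. Qed.

Lemma cabs2_conj (x : R[i]) : cabs2 x^*%C = cabs2 x.
Proof. by case: x => a b; rewrite /cabs2 /= sqrrN. Qed.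

Lemma cauchy_schwarz (a b c d : R[i]) :
  cabs2 (a * c + b * d) <= (cabs2 c + cabs2 d) * (cabs2 a + cabs2 b).
Proof.
rewrite -subr_ge0; have -> : (cabs2 c + cabs2 d) * (cabs2 a + cabs2 b) -
    cabs2 (a * c + b * d) = cabs2 (a * d^*%C - b * c^*%C).
  case: a b c d => [a a'] [b b'] [c c'] [d d']; rewrite /cabs2 /=; ring.
exact: cabs2_ge0.
Qed.

Lemma Re_gradsq (r : 'I_2 -> R[i]) : gradsq r = (cabs2 (r 0) + cabs2 (r 1))%:C.
Proof. by rewrite /gradsq -!cabs2E -rmorphD. Qed.

Lemma cabs2_tangential (r : 'I_2 -> R[i]) :
  cabs2 (tangential r 0) + cabs2 (tangential r 1) = complex.Re (gradsq r).
Proof.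
rewrite Re_gradsq [RHS]/= tangential0 tangential1 addrC; congr (_ + _).
by case: (r 0) => a b; rewrite /cabs2 /= !sqrrN.
Qed.

Lemma Re_entryLL (tau k : R) (r g : 'I_2 -> R[i]) (K : 'I_2 -> 'I_2 -> R[i]) :
  herm K (tangential r) (tangential r) = k%:C ->
  complex.Re (entryLL tau%:C r g K) = k - tau * cabs2 (pairing g (tangential r)).
Proof. by move=> hK; rewrite /entryLL hK -cabs2E -rmorphM -rmorphB. Qed.

Lemma cabs2_entryLN (tau : R) (r g : 'I_2 -> R[i]) (H K : 'I_2 -> 'I_2 -> R[i]) :
  herm H (tangential r) (normal r) = 0 ->
  cabs2 (entryLN tau%:C 0 r g H K) =
  tau ^+ 2 * complex.Re (gradsq r) ^+ 2 * cabs2 (pairing g (tangential r)).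
Proof.
move=> hH; rewrite /entryLN hH mul0r addr0 mulr0 mul0r subr0 sub0r.
rewrite {1}(conj_realE (gradsq_conj r)).
move: (pairing g _) (complex.Re (gradsq r)) => x a.
rewrite -mulNr -mulNr !cabs2M -(rmorphN (real_complex R)) !cabs2_real sqrrN.
by [].
Qed.

Lemma Re_entryNN (tau : R) (r g : 'I_2 -> R[i]) (H K : 'I_2 -> 'I_2 -> R[i]) :
  complex.Re (entryNN tau%:C 0 r g H K) = (1 - tau) * complex.Re (gradsq r) ^+ 2.
Proof.
rewrite /entryNN mul0r addr0 {1 2}(conj_realE (gradsq_conj r)).
by rewrite -(rmorph1 (real_complex R)) -rmorphB -!rmorphM /= expr2.
Qed.

(** If the Levi form is positive at p, it is bounded below by m rho near p for
    every m, in particular for a very negative one. Otherwise mixed vanishes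
    at p, so that the gradient of the weight is of size eps and the term
    M |L mixed|^2 compensates the linear loss in levi_lower_bound. The constants
    do not depend on p. *)
Lemma boundary_DF_ge0 U rho p (tau eps s0 Rb M : R) : open U ->
  smooth_on U rho -> U p -> rho p = 0 ->
  (forall q, U q -> rho q = 0 -> 0 <= complex.Re (levi rho q)) ->
  (levi rho p = 0 -> mixed rho p = 0) -> 0 < tau < 1 ->
  0 < s0 -> s0 <= complex.Re (gradsq (cgrad rho p)) -> normsq p <= Rb ->
  0 < eps -> eps * Rb * tau <= (1 - tau) / 2 -> (eps * s0 ^+ 3)^-1 <= M ->
  \forall q \near p, rho q < 0 -> forall V, 0 <= herm
    (DF_matrix tau%:C (- rho q)%:C (cgrad rho q) (cgrad (weight M eps rho) q)
       (chess rho q) (chess (weight M eps rho) q)) V V.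
Proof.
move=> oU sr Up p0 pos flat tau01 s00 ss0 hR eps0 heps hM.
have /andP[tau0 tau1] := tau01.
set r := cgrad rho p; set psi := weight M eps rho.
have spsi : smooth_on U psi := smooth_weight M eps oU sr.
set s := complex.Re (gradsq r) in ss0.
have sE : gradsq r = s%:C by exact: conj_realE (gradsq_conj r).
have sgt0 : 0 < s by exact: lt_le_trans ss0.
have sn0 : gradsq r != 0 by rewrite sE; apply/eqP => -[e]; rewrite e ltxx in sgt0.
have [l0|l0] := eqVneq (levi rho p) 0; last first.
  pose A := complex.Re (entryLL tau%:C r (cgrad psi p) (chess psi p)).
  pose B := cabs2 (entryLN tau%:C 0 r (cgrad psi p) (chess rho p) (chess psi p)).
  apply: (@DF_matrix_near _ U rho psi tau oU sr spsi p
    (A - (B + 1) / ((1 - tau) * s ^+ 2))) => //; last first.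
    rewrite -/r -/A -/B Re_entryNN -/s opprB addrCA subrr addr0 divfK; first by rewrite ltrDl.
    by rewrite mulf_neq0 ?expf_neq0 ?gt_eqF// subr_gt0.
  set m := _ - _.
  have sf : smooth_on U (fun q => complex.Re (levi rho q) - m * rho q).
    apply: (smoothB oU _ (smoothZ m oU sr)); by have [] := csmooth_levi oU sr.
  have lpos : 0 < complex.Re (levi rho p) - m * rho p.
    rewrite p0 mulr0 subr0 lt_neqAle pos// andbT eq_sym; apply/eqP => e.
    by move: l0; rewrite (levi_real oU sr Up) e eqxx.
  have nl := continuous_near_gt0 (smooth_continuous sf Up) lpos.
  near=> q => _; rewrite -subr_ge0 ltW//; exact: (near nl q).
have m0 := flat l0.
pose L := tangential r.
pose x := pairing (fun j => dz j (mixed rho) p) L.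
pose g := pairing (cgrad psi p) L.
have gE : g = eps%:C * ((ccoord p 0)^*%C * L 0 + (ccoord p 1)^*%C * L 1).
  rewrite /g /pairing !(cgrad_weight M eps oU sr)//.
  by move: ((ccoord p 0)^*%C) ((ccoord p 1)^*%C) => *; ring.
have Ls : cabs2 (L 0) + cabs2 (L 1) = s by exact: cabs2_tangential.
have hg : cabs2 g <= eps ^+ 2 * (s * Rb).
  rewrite gE cabs2M cabs2_real ler_wpM2l ?sqr_ge0// -Ls.
  apply: le_trans (cauchy_schwarz _ _ _ _) _; rewrite !cabs2_conj.
  by rewrite ler_wpM2l// addr_ge0// cabs2_ge0.
have hA : M * complex.Re x ^+ 2 + eps * s - tau * cabs2 g <=
    complex.Re (entryLL tau%:C r (cgrad psi p) (chess psi p)).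
  rewrite (Re_entryLL tau (cgrad psi p) (herm_chess_weight M eps oU sr L Up m0)).
  rewrite Ls lerD2r lerD2r ler_wpM2l//.
    by apply: le_trans hM; rewrite invr_ge0 ltW// mulr_gt0// exprn_gt0.
  by rewrite /cabs2 -addrA lerDl addr_ge0 ?sqr_ge0// cabs2_ge0.
have [m hm1 hm2] := choose_slope s00 ss0 eps0 tau01 heps hM hg hA.
apply: (@DF_matrix_near _ U rho psi tau oU sr spsi p m) => //.
  exact: (levi_lower_bound oU sr Up p0 sgt0 l0 m0 pos hm1).
have hLN : herm (chess rho p) (tangential r) (normal r) = 0.
  by rewrite -(herm_conj _ _ (chess_hermitian oU sr Up)) -/(mixed rho p) m0 conjc0.
rewrite [ltLHS](cabs2_entryLN tau (cgrad psi p) (chess psi p) hLN).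
rewrite [X in _ < _ * X](Re_entryNN tau r (cgrad psi p) (chess rho p) (chess psi p)).
exact: hm2.
Unshelve. all: by end_near. Qed.

End NearBoundary.

(** * Flat functions *)

Section FlatFunction.
Variable R : realType.
Implicit Types (x y s c : R) (n : nat).

(** The derivatives of the flat function exp(-1/x) are combinations of the
    functions x^-n exp(-1/x), a family that is closed under differentiation. *)
Definition flat n x : R := if 0 < x then (x ^+ n)^-1 * expR (- x^-1) else 0.

Lemma flat_gt0 n x : 0 < x -> 0 < flat n x.
Proof. by move=> x0; rewrite /flat x0 mulr_gt0 ?expR_gt0// invr_gt0 exprn_gt0. Qed.

Lemma flat_le0 n x : x <= 0 -> flat n x = 0.
Proof. by rewrite /flat ltNge => ->. Qed.

Lemma flat_ge0 n x : 0 <= flat n x.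
Proof. by case: (ltP 0 x) => [/(flat_gt0 n)/ltW//|/flat_le0 ->]. Qed.

Lemma flatS n x : x * flat n.+1 x = flat n x.
Proof.
rewrite /flat; case: ifP => [x0|_]; last by rewrite mulr0.
by rewrite exprS invfM !mulrA divff ?mul1r// gt_eqF.
Qed.

Lemma expRN_le_pow x k : 0 < x -> expR (- x^-1) <= (k.+1%:R * x) ^+ k.+1.
Proof.
move=> x0; have k0 : (0 : R) < k.+1%:R by rewrite ltr0n.
have y0 : 0 < x^-1 / k.+1%:R by rewrite divr_gt0// invr_gt0.
rewrite expRN -[leRHS]invrK lef_pV2 ?posrE ?expR_gt0 ?invr_gt0 ?exprn_gt0 ?mulr_gt0//.
have -> : ((k.+1%:R * x) ^+ k.+1)^-1 = (x^-1 / k.+1%:R) ^+ k.+1.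
  by rewrite -exprVn invfM mulrC.
have -> : expR x^-1 = expR (x^-1 / k.+1%:R) ^+ k.+1.
  by rewrite -expRM_natl mulrC divfK// gt_eqF.
apply: lerXn2r; rewrite ?nnegrE ?expR_ge0 ?ltW//.
by rewrite (lt_le_trans _ (expR_ge1Dx _))// ltrDr.
Qed.

Lemma flat_le_pow n x : 0 <= x -> flat n x <= n.+2%:R ^+ n.+2 * x ^+ 2.
Proof.
rewrite le_eqVlt => /predU1P[<-|x0]; first by rewrite flat_le0 ?expr0n ?mulr0.
rewrite /flat x0 ler_pdivrMl ?exprn_gt0//; apply: le_trans (expRN_le_pow _ x0) _.
by rewrite exprMn mulrCA -exprD addn2.
Qed.

Lemma is_derive_flat n x :
  is_derive x 1 (flat n) (1 * flat n.+2 x + (- n%:R) * flat n.+1 x).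
Proof.
have [x0|x0|->] := ltgtP x 0.
- rewrite !flat_le0 ?ltW// !mulr0 addr0.
  apply: near_eq_is_derive (is_derive_cst (0 : R) x 1).
  near=> y; rewrite flat_le0//; near: y; exact: lt_le_nbhsl.
- pose phi (z : R) := z ^+ n * expR (- z).
  have dphi (z : R) : is_derive z (1 : R) phi (n%:R * z ^+ n.-1 * expR (- z) - phi z).
    have d0 : is_derive z (1 : R) (id : R -> R) 1 by exact: is_derive_id.
    have dN : is_derive z (1 : R) (-%R : R -> R) (- 1) by exact: is_deriveNid.
    have d1 := is_deriveX n d0.
    have d2 := is_derive1_comp (is_derive_expR (- z)) dN.
    have -> : phi = ((id : R -> R) ^+ n) * (expR \o -%R).
      by apply/funext => y; rewrite /phi [RHS]/= exprfctE.
    apply: is_derive_eq (is_deriveM d1 d2) _.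
    by rewrite /GRing.scale/= !fctE /=; ring.
  have xn0 : x != 0 by rewrite gt_eqF.
  have d0 : is_derive x (1 : R) (id : R -> R) 1 by exact: is_derive_id.
  have dinv := is_deriveV xn0 d0.
  apply: (@near_eq_is_derive _ _ _ (phi \o (fun y => y^-1))).
    by near=> y; rewrite /= /phi /flat ifT ?exprVn//; near: y; exact: lt_nbhsr.
  apply: is_derive_eq (is_derive1_comp (dphi x^-1) dinv) _.
  rewrite /phi /flat x0 /GRing.scale/= mulr1; case: (n) => [|k].
    by rewrite /= ?expr0; field.
  by rewrite /= -!exprVn !exprS; field.
- rewrite !flat_le0// !mulr0 addr0.
  have L : h^-1 *: ((flat n \o shift 0) (h *: 1) - flat n 0) @[h --> (0 : R)^'] --> (0 : R).
    apply/cvgrPdist_le => e e0.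
    pose C : R := n.+2%:R ^+ n.+2; have C0 : 0 < C by rewrite exprn_gt0// ltr0n.
    near=> h; rewrite sub0r normrN /= addr0 [h *: 1]mulr1 (@flat_le0 n 0)// subr0.
    have hn0 : h != 0 by near: h; exact: nbhs_dnbhs_neq.
    have he : `|h| <= e / C by near: h; apply: dnbhs0_le; rewrite divr_gt0.
    rewrite normrM normfV ler_pdivrMl ?normr_gt0// ger0_norm ?flat_ge0//.
    have [h0|h0] := leP h 0; first by rewrite flat_le0// mulr_ge0// ltW.
    apply: le_trans (flat_le_pow n (ltW h0)) _; rewrite -/C gtr0_norm//.
    rewrite gtr0_norm// ler_pdivlMr// in he.
    by rewrite expr2 mulrCA ler_pM2l// mulrC.
  by split; [apply/cvg_ex; exists 0|exact: cvg_lim L].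
Unshelve. all: by end_near. Qed.

End FlatFunction.

(** * Flattening inside the domain *)

Section Bend.
Variable R : realType.
Implicit Types (x y s t c : R).

Lemma MVT_everywhere (h h' : R -> R) (a b : R) : a < b ->
  (forall x : R, is_derive x (1 : R) h (h' x)) ->
  exists2 x, a < x < b & h b - h a = h' x * (b - a).
Proof.
move=> ab dh.
have ch : {within `[a, b], continuous h}.
  by apply: derivable_within_continuous => x _; have [] := dh x.
have [x] := MVT ab (fun x _ => dh x) ch.
by rewrite in_itv/= => xab E; exists x.
Qed.

Lemma flat_lt x y : 0 < y -> x < y -> flat 0 x < flat 0 y.
Proof.
move=> y0 xy; have [x0|x0] := leP x 0; first by rewrite flat_le0// flat_gt0.
by rewrite /flat x0 y0 !expr0 invr1 !mul1r ltr_expR ltrN2 ltf_pV2.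
Qed.

(** Composition with bend c makes a function constant where it is at most -c; as
    bend c increases on the rest and bend c 0 = 0, a defining function remains a
    defining function. *)
Definition bend c s := flat 0 (s + c) - flat 0 c.
Definition bend1 c s := flat 2 (s + c).
Definition bend2 c s := flat 4 (s + c) - 2 * flat 3 (s + c).

Lemma is_derive_flat_shift n c s : is_derive s (1 : R) (fun t => flat n (t + c))
  (flat n.+2 (s + c) - n%:R * flat n.+1 (s + c)).
Proof.
have d0 : is_derive s (1 : R) (id : R -> R) 1 by exact: is_derive_id.
have d1 : is_derive s (1 : R) (fun t : R => t + c) 1.
  by apply: is_derive_eq (is_deriveD d0 (is_derive_cst c s 1)) _; rewrite addr0.
have d2 := @is_derive1_comp R (flat n) (fun t => t + c) s _ _
  (is_derive_flat n (s + c)) d1.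
apply: (@is_derive_eq _ _ _ (fun t => flat n (t + c)) _ _ _ _ d2).
by rewrite mulr1 mul1r mulNr.
Qed.

Lemma is_derive_bend c s : is_derive s (1 : R) (bend c) (bend1 c s).
Proof.
have d := is_deriveB (is_derive_flat_shift 0 c s) (is_derive_cst (flat 0 c) s 1).
by apply: is_derive_eq d _; rewrite mul0r !subr0.
Qed.

Lemma is_derive_bend1 c s : is_derive s (1 : R) (bend1 c) (bend2 c s).
Proof. exact: is_derive_flat_shift. Qed.

Lemma smooth_bend U (f : C2 R -> R) c : open U -> smooth_on U f ->
  smooth_on U (fun q => bend c (f q)).
Proof.
move=> oU sf; have sfc := smoothD oU sf (smooth_cst c oU).
have s0 : smooth_on U (fun q => flat 0 (f q + c)).
  have dH n x (_ : [set: R] x) :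
      is_derive x 1 (flat n) (1 * flat n.+2 x + - n%:R * flat n.+1 x).
    exact: is_derive_flat.
  have sH := smooth_comp_family oU (fun q _ => I) dH sfc.
  exact: (sH 0%N).
exact: (smoothB oU s0 (smooth_cst (flat 0 c) oU)).
Qed.

Lemma bend_lt0 c s : 0 < c -> s < 0 -> bend c s < 0.
Proof. by move=> c0 s0; rewrite subr_lt0 flat_lt// -ltrBrDr subrr. Qed.

Lemma bend0 c : bend c 0 = 0. Proof. by rewrite /bend add0r subrr. Qed.

Lemma bend_gt0 c s : 0 < c -> 0 < s -> 0 < bend c s.
Proof. by move=> c0 s0; rewrite subr_gt0 flat_lt ?addr_gt0// ltrDr. Qed.

Lemma bend1_ge0 c s : 0 <= bend1 c s. Proof. exact: flat_ge0. Qed.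

Lemma bend1_gt0 c : 0 < c -> 0 < bend1 c 0.
Proof. by move=> c0; rewrite /bend1 add0r flat_gt0. Qed.

Lemma bend1_eq0 c s : s <= - c -> bend1 c s = 0.
Proof. by move=> sc; rewrite /bend1 flat_le0// -lerBrDr sub0r. Qed.

Lemma bend2_eq0 c s : s <= - c -> bend2 c s = 0.
Proof. by move=> sc; rewrite /bend2 !flat_le0 ?mulr0 ?subrr// -lerBrDr sub0r. Qed.

(** The logarithmic derivative of bend1 c at s is this function of s + c; it is
    nonnegative and nonincreasing on ]0, 1/2]. *)
Let kappa x := x ^- 2 - 2 * x^-1.

Let bend2E c s : 0 < s + c -> bend2 c s = kappa (s + c) * bend1 c s.
Proof.
move=> sc; rewrite /bend2 /bend1 /kappa -[flat 2 _]flatS -[flat 3 _]flatS.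
by field; rewrite gt_eqF.
Qed.

Let kappa_ge0 x : 0 < x <= 1 / 2 -> 0 <= kappa x.
Proof.
move=> /andP[x0 x2]; have -> : kappa x = (1 - 2 * x) / x ^+ 2.
  by rewrite /kappa; field; rewrite gt_eqF.
by rewrite divr_ge0 ?sqr_ge0//; lra.
Qed.

Let kappa_nincr x y : 0 < x -> x <= y -> y <= 1 / 2 -> kappa y <= kappa x.
Proof.
move=> x0 xy y2; have y0 : 0 < y by exact: lt_le_trans xy.
have vxy : y^-1 <= x^-1 by rewrite lef_pV2.
have v2 : 2 <= y^-1 by rewrite -[2]invrK lef_pV2 ?posrE ?invr_gt0//; lra.
rewrite /kappa -!exprVn; nra.
Qed.

(** The function -(- bend c s)^tau of -(-s)^tau is convex: the inequality says
    that its derivative is nondecreasing. The left side measures the failure of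
    bend c to be linear on [s, 0]; it is controlled by bend2 c s since the
    logarithmic derivative kappa of bend1 c is nonincreasing. *)
Lemma bend_convex tau c s : 0 < tau < 1 -> 0 < c <= 1 / 2 -> - c < s < 0 ->
  (1 - tau) * (bend1 c s * (- bend c s - - s * bend1 c s)) <=
  bend2 c s * - s * - bend c s.
Proof.
move=> /andP[tau0 tau1] /andP[c0 c2] /andP[cs s0].
have sc0 : 0 < s + c by lra.
(* bend1 c x is the slope of the chord over [s, 0], and bend2 c y (x - s) is its
   excess over bend1 c s. *)
have [x /andP[sx x0]] := MVT_everywhere s0 (is_derive_bend c).
rewrite bend0 !sub0r => gE.
have [y /andP[sy yx] E1] := MVT_everywhere sx (is_derive_bend1 c).
have [z /andP[yz zx] E2] := MVT_everywhere yx (is_derive_bend1 c).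
have b2ge0 t : - c < t -> t < 0 -> 0 <= bend2 c t.
  move=> h1 h2; rewrite bend2E; last lra.
  by rewrite mulr_ge0 ?bend1_ge0// kappa_ge0//; apply/andP; split; lra.
have yx1 : bend1 c y <= bend1 c x.
  by rewrite -subr_ge0 E2; apply: mulr_ge0; [apply: b2ge0; lra|lra].
have b2y : bend2 c y <= kappa (s + c) * bend1 c x.
  rewrite bend2E; last lra.
  apply: ler_pM => //; [|exact: bend1_ge0|].
    by apply: kappa_ge0; apply/andP; split; lra.
  by apply: kappa_nincr; lra.
have k0 : 0 <= kappa (s + c) by apply: kappa_ge0; apply/andP; split; lra.
have gs0 : 0 <= - bend c s by rewrite oppr_ge0 ltW// bend_lt0.
have X : - bend c s - - s * bend1 c s <= kappa (s + c) * - s * - bend c s.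
  have -> : - bend c s - - s * bend1 c s = - s * (bend2 c y * (x - s)).
    by rewrite -E1 gE; ring.
  rewrite gE (_ : kappa _ * _ * _ = - s * (kappa (s + c) * bend1 c x * - s)); last by ring.
  rewrite ler_pM2l ?oppr_gt0//; apply: ler_pM => //; [|lra|lra].
  by apply: b2ge0; lra.
have Y : bend1 c s * (- bend c s - - s * bend1 c s) <= bend2 c s * - s * - bend c s.
  rewrite bend2E// (_ : _ * bend1 c s * _ * _ =
    bend1 c s * (kappa (s + c) * - s * - bend c s)); last by ring.
  by rewrite ler_wpM2l// bend1_ge0.
have Z : 0 <= bend2 c s * - s * - bend c s.
  by apply: mulr_ge0 => //; apply: mulr_ge0; [exact: b2ge0|lra].
apply: (le_trans (ler_wpM2l _ Y)); first lra.
by rewrite ler_piMl//; lra.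
Qed.

End Bend.

(** * The Laplacian of rho exp(-psi) *)

Section LaplacianCalculus.
Variable R : realType.
Implicit Types (U : set (C2 R)) (f g rho psi : C2 R -> R) (p q v : C2 R).

Lemma derive2_mul U f g v p : open U -> smooth_on U f -> smooth_on U g -> U p ->
  'D_v ('D_v (fun q => f q * g q)) p =
  'D_v ('D_v f) p * g p + 2 * ('D_v f p * 'D_v g p) + f p * 'D_v ('D_v g) p.
Proof.
move=> oU sf sg Up; have df := smooth_derive v sf; have dg := smooth_derive v sg.
have E1 q : U q -> 'D_v (fun q => f q * g q) q = 'D_v f q * g q + f q * 'D_v g q.
  exact: smooth_deriveM.
apply: etrans (eq_on_derive v oU E1 Up) _.
apply: etrans (smooth_deriveD v (smoothM oU df sg) (smoothM oU sf dg) Up) _.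
rewrite (smooth_deriveM v df sg Up) (smooth_deriveM v sf dg Up).
move: ('D_v ('D_v f) p) ('D_v ('D_v g) p) => a b.
move: ('D_v f p) ('D_v g p) => x y; ring.
Qed.

Lemma derive2_comp U f (h h1 h2 : R -> R) v p : open U -> smooth_on U f ->
  smooth_on U (fun q => h1 (f q)) ->
  (forall q, U q -> is_derive (f q) (1 : R) h (h1 (f q))) ->
  is_derive (f p) (1 : R) h1 (h2 (f p)) -> U p ->
  'D_v ('D_v (fun q => h (f q))) p =
  h1 (f p) * 'D_v ('D_v f) p + h2 (f p) * ('D_v f p * 'D_v f p).
Proof.
move=> oU sf sh1 dh dh1 Up; have df := smooth_derive v sf.
have E1 q : U q -> 'D_v (fun q => h (f q)) q = h1 (f q) * 'D_v f q.
  by move=> Uq; exact: derive_comp (smooth_diff sf Uq) (dh q Uq).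
apply: etrans (eq_on_derive v oU E1 Up) _.
apply: etrans (smooth_deriveM v sh1 df Up) _.
rewrite (derive_comp v (smooth_diff sf Up) dh1).
move: ('D_v ('D_v f) p) ('D_v f p) => a x; ring.
Qed.

Let line_laplacian_comp_alg (l1 l2 a b x y z t : R) :
  l1 = a * x + b * y -> l2 = a * z + b * t ->
  l1 + l2 = a * (x + z) + b * (y + t).
Proof. by move=> -> ->; ring. Qed.

Lemma line_laplacian_comp U f (h h1 h2 : R -> R) v p : open U -> smooth_on U f ->
  smooth_on U (fun q => h1 (f q)) ->
  (forall q, U q -> is_derive (f q) (1 : R) h (h1 (f q))) ->
  is_derive (f p) (1 : R) h1 (h2 (f p)) -> U p ->
  line_laplacian (fun q => h (f q)) v p =
  h1 (f p) * line_laplacian f v p + h2 (f p) * line_grad f f v p.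
Proof.
move=> oU sf sh1 dh dh1 Up.
exact: line_laplacian_comp_alg (derive2_comp v oU sf sh1 dh dh1 Up)
  (derive2_comp (J v) oU sf sh1 dh dh1 Up).
Qed.

Definition expweight rho psi q : R := rho q * expR (- psi q).

Section ExpWeight.
Variables (U : set (C2 R)) (rho psi : C2 R -> R).
Hypotheses (oU : open U) (srho : smooth_on U rho) (spsi : smooth_on U psi).
Let sN := smoothN oU spsi.
Let sE := smooth_expR oU sN.

Lemma smooth_expweight : smooth_on U (expweight rho psi).
Proof. exact: smoothM oU srho sE. Qed.

Let derive_exp v q : U q -> 'D_v (fun q => expR (- psi q)) q =
  - expR (- psi q) * 'D_v psi q.
Proof.
move=> Uq.
rewrite (derive_comp v (smooth_diff sN Uq) (is_derive_expR (- psi q))).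
by rewrite (smooth_deriveN v spsi Uq) mulrN mulNr.
Qed.

Let derive2_exp v p : U p -> 'D_v ('D_v (fun q => expR (- psi q))) p =
  expR (- psi p) * ('D_v psi p * 'D_v psi p - 'D_v ('D_v psi) p).
Proof.
move=> Up.
rewrite (derive2_comp v oU sN sE (fun q _ => is_derive_expR (- psi q))
  (is_derive_expR (- psi p)) Up).
have -> : 'D_v ('D_v (fun q => - psi q)) p = - 'D_v ('D_v psi) p.
  apply: etrans (eq_on_derive v oU (fun q Uq => smooth_deriveN v spsi Uq) Up) _.
  exact: (smooth_deriveN v (smooth_derive v spsi) Up).
rewrite (smooth_deriveN v spsi Up).
by move: ('D_v ('D_v psi) p) ('D_v psi p) => *; ring.
Qed.

Lemma derive_expweight v p : U p -> 'D_v (expweight rho psi) p =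
  expR (- psi p) * ('D_v rho p - rho p * 'D_v psi p).
Proof.
move=> Up; apply: etrans (smooth_deriveM v srho sE Up) _; rewrite derive_exp//.
by move: ('D_v rho p) ('D_v psi p) => *; ring.
Qed.

Lemma derive2_expweight v p : U p -> 'D_v ('D_v (expweight rho psi)) p =
  expR (- psi p) * ('D_v ('D_v rho) p - 2 * ('D_v rho p * 'D_v psi p) -
    rho p * 'D_v ('D_v psi) p + rho p * ('D_v psi p * 'D_v psi p)).
Proof.
move=> Up; apply: etrans (derive2_mul v oU srho sE Up) _.
rewrite derive_exp// derive2_exp//.
move: ('D_v ('D_v psi) p) ('D_v ('D_v rho) p) ('D_v rho p) ('D_v psi p) => *.
by ring.
Qed.

Let expweight_alg (tau ro E l1 l2 g1 g2 a a2 b b2 c c2 d d2 : R) :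
  l1 = E * (a2 - 2 * (a * b) - ro * b2 + ro * (b * b)) ->
  l2 = E * (c2 - 2 * (c * d) - ro * d2 + ro * (d * d)) ->
  g1 = E * (a - ro * b) -> g2 = E * (c - ro * d) ->
  - (ro * E) * (l1 + l2) + (1 - tau) * (g1 * g1 + g2 * g2) =
  E ^+ 2 * (- ro * (a2 + c2) + (1 - tau) * (a * a + c * c) +
    ro ^+ 2 * (b2 + d2) + 2 * tau * ro * (a * b + c * d) -
    tau * ro ^+ 2 * (b * b + d * d)).
Proof. by move=> -> -> -> ->; ring. Qed.

(** For r = rho exp(-psi), the left side is the Laplacian of -(-r)^tau on a complex
    line, up to the positive factor tau (-r)^(tau - 2). *)
Lemma expweight_laplacian tau v p : U p ->
  - expweight rho psi p * line_laplacian (expweight rho psi) v p +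
  (1 - tau) * line_grad (expweight rho psi) (expweight rho psi) v p =
  expR (- psi p) ^+ 2 * (- rho p * line_laplacian rho v p +
    (1 - tau) * line_grad rho rho v p + rho p ^+ 2 * line_laplacian psi v p +
    2 * tau * rho p * line_grad rho psi v p -
    tau * rho p ^+ 2 * line_grad psi psi v p).
Proof.
move=> Up; exact: expweight_alg (derive2_expweight v Up)
  (derive2_expweight (J v) Up) (derive_expweight v Up) (derive_expweight (J v) Up).
Qed.

Let herm_DF_alg (tau ro a1 a2 a3 a4 a5 : R) (h1 h2 x y x' y' : R[i]) :
  a1%:C%C = 4 * h1 -> a2%:C%C = 4 * h2 -> a3%:C%C = 2 * (x * x' + x' * x) ->
  a4%:C%C = 2 * (x * y' + x' * y) -> a5%:C%C = 2 * (y * y' + y' * y) ->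
  (- ro * a1 + (1 - tau) * a3 + ro ^+ 2 * a2 + 2 * tau * ro * a4 -
    tau * ro ^+ 2 * a5)%:C%C =
  4 * ((- ro)%:C%C * h1 + (1 - tau%:C%C) * (x * x') + (- ro)%:C%C ^+ 2 * h2 -
    tau%:C%C * (- ro)%:C%C * (x * y' + y * x') -
    tau%:C%C * (- ro)%:C%C ^+ 2 * (y * y')).
Proof.
move=> E1 E2 E3 E4 E5; rewrite !expr2.
rewrite !(rmorphD, rmorphM, rmorphB, rmorphN) /= E1 E2 E3 E4 E5.
by rewrite ?rmorph1; ring.
Qed.

Lemma herm_DF_real tau v p : U p -> (- rho p * line_laplacian rho v p +
    (1 - tau) * line_grad rho rho v p + rho p ^+ 2 * line_laplacian psi v p +
    2 * tau * rho p * line_grad rho psi v p -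
    tau * rho p ^+ 2 * line_grad psi psi v p)%:C%C =
  4 * herm (DF_matrix tau%:C%C (- rho p)%:C%C (cgrad rho p) (cgrad psi p)
       (chess rho p) (chess psi p)) (ccoord v) (ccoord v).
Proof.
move=> Up; rewrite herm_DF_matrix.
exact: herm_DF_alg (line_laplacianE v oU srho Up) (line_laplacianE v oU spsi Up)
  (line_gradE v oU srho srho Up) (line_gradE v oU srho spsi Up)
  (line_gradE v oU spsi spsi Up).
Qed.

End ExpWeight.
End LaplacianCalculus.

(** * The Laplacian of -(- bend c r)^tau *)

Section BendLaplacian.
Variable R : realType.
Implicit Types (U : set (C2 R)) (r : C2 R -> R) (p q v : C2 R).

Lemma line_grad_ge0 r v p : 0 <= line_grad r r v p.
Proof.
have sumsq (a b : R) : 0 <= a * a + b * b by rewrite -!expr2 addr_ge0// sqr_ge0.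
exact: sumsq.
Qed.

Section DFpower.
Variables (c tau : R).
Hypotheses (c0 : 0 < c <= 1 / 2) (tau01 : 0 < tau < 1).

Definition DFpower (s : R) : R := - ((- bend c s) `^ tau).
Let power1 (s : R) : R := tau * (- bend c s) `^ (tau - 1) * bend1 c s.
Let power2 (s : R) : R := tau * ((1 - tau) * (- bend c s) `^ (tau - 1 - 1) *
  bend1 c s ^+ 2 + (- bend c s) `^ (tau - 1) * bend2 c s).

Let nbend_gt0 (s : R) : s < 0 -> 0 < - bend c s.
Proof. by move=> s0; rewrite oppr_gt0 bend_lt0//; case/andP: c0. Qed.

Let is_derive_nbend_pow (a s : R) : s < 0 ->
  is_derive s (1 : R) (fun s => (- bend c s) `^ a)
    (- (a * (- bend c s) `^ (a - 1) * bend1 c s)).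
Proof.
move=> s0; have d1 := is_deriveN (is_derive_bend c s).
have d2 := @is_derive1_comp R (fun x => x `^ a) (fun s => - bend c s) s _ _
  (is_derive1_powR a (nbend_gt0 s0)) d1.
by apply: (@is_derive_eq _ _ _ (fun s => (- bend c s) `^ a) _ _ _ _ d2); rewrite mulrN.
Qed.

Let is_derive_power (s : R) : s < 0 -> is_derive s (1 : R) DFpower (power1 s).
Proof.
move=> s0; have d := is_deriveN (is_derive_nbend_pow tau s0).
by apply: (@is_derive_eq _ _ _ DFpower _ _ _ _ d); rewrite opprK.
Qed.

Let is_derive_power1 (s : R) : s < 0 -> is_derive s (1 : R) power1 (power2 s).
Proof.
move=> s0.
have d := is_deriveM (is_derive_cst tau s 1)
  (is_deriveM (is_derive_nbend_pow (tau - 1) s0) (is_derive_bend1 c s)).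
have -> : power1 = (cst tau * ((fun s => (- bend c s) `^ (tau - 1)) * bend1 c)).
  by apply/funext => x; rewrite /power1 -mulrA.
apply: is_derive_eq d _.
by rewrite /GRing.scale /= /power2; ring.
Qed.

(** Where r <= -c the Laplacian vanishes along with bend1 and bend2. Elsewhere
    the function is an increasing convex function of -(-r)^tau, whose
    Laplacian has the sign of the left side of the hypothesis; the convexity
    is bend_convex. *)
Lemma DFpower_laplacian U r v p : open U -> smooth_on U r ->
  (forall q, U q -> r q < 0) -> U p ->
  (- c < r p -> 0 <= - r p * line_laplacian r v p + (1 - tau) * line_grad r r v p) ->
  0 <= line_laplacian (fun q => DFpower (r q)) v p.
Proof.
move=> oU sr r0 Up hr; have /andP[tau0 tau1] := tau01.
have snb : smooth_on U (fun q => - bend c (r q)) by exact: smoothN oU (smooth_bend c oU sr).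
have sb1 : smooth_on U (fun q => bend1 c (r q)).
  have dH n x (_ : [set: R] x) :
      is_derive x 1 (flat n) (1 * flat n.+2 x + - n%:R * flat n.+1 x).
    exact: is_derive_flat.
  have sH := smooth_comp_family oU (fun q _ => I) dH (smoothD oU sr (smooth_cst c oU)).
  exact: (sH 2%N).
have s1 : smooth_on U (fun q => power1 (r q)).
  apply: (smoothM oU (smoothM oU (smooth_cst tau oU) _) sb1).
  by apply: (smooth_powR _ oU _ snb) => q /r0 /nbend_gt0.
rewrite (line_laplacian_comp v oU sr s1 (fun q Uq => is_derive_power (r0 q Uq))
  (is_derive_power1 (r0 p Up)) Up).
have G0 := line_grad_ge0 r v p.
move: hr G0; set s := r p; have s0 : s < 0 := r0 p Up.
move: (line_laplacian r v p) (line_grad r r v p) => l G hr G0.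
have [sc|cs] := leP s (- c).
  by rewrite /power1 /power2 bend1_eq0// bend2_eq0// expr0n/= !mulr0 mul0r !addr0 mulr0 mul0r.
have {}hr := hr cs; have g0 := nbend_gt0 s0.
set P := (- bend c s) `^ (tau - 1 - 1).
have PE : (- bend c s) `^ (tau - 1) = P * - bend c s.
  rewrite /P -{3}(powRr1 (ltW g0)) -powRD ?subrK//.
  by apply/implyP => _; rewrite gt_eqF.
have P0 : 0 < P by exact: powR_gt0.
have conv := bend_convex tau01 c0 (introT andP (conj cs s0)).
rewrite /power1 /power2 -/P PE; move: conv g0 (bend1_ge0 c s).
move: (bend c s) (bend1 c s) (bend2 c s) => g g1 g2 conv g0 g10.
rewrite -(@pmulr_rge0 _ (- s)) ?oppr_gt0//.
(* The Laplacian of -(-r)^tau and the convexity defect times |grad r|^2. *)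
have -> : - s * (tau * (P * - g) * g1 * l +
    tau * ((1 - tau) * P * g1 ^+ 2 + P * - g * g2) * G) =
  (tau * P) * (- g * g1 * (- s * l + (1 - tau) * G) +
    G * (g2 * - s * - g - (1 - tau) * (g1 * (- g - - s * g1)))).
  by ring.
rewrite mulr_ge0 ?mulr_ge0 ?(ltW tau0) ?(ltW P0)// addr_ge0//.
  by rewrite !mulr_ge0 ?(ltW g0).
by rewrite mulr_ge0// subr_ge0.
Qed.

End DFpower.
End BendLaplacian.

(** * The sub-mean value property *)

Section SubMeanValue.
Variable R : realType.
Implicit Types (U : set (C2 R)) (f u : C2 R -> R) (p q v w : C2 R).
Notation mu := (@lebesgue_measure R).

Lemma is_derive_curve U f (g : R -> C2 R) (t : R) w : smooth_on U f -> U (g t) ->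
  is_derive t (1 : R) g w -> is_derive t (1 : R) (fun t => f (g t)) ('D_w f (g t)).
Proof.
move=> sf Ug [dg gE]; have df := smooth_diff sf Ug.
have dg' : differentiable g t by exact/derivable1_diffP.
have dc : differentiable (fun t => f (g t)) t.
  exact: (@differentiable_comp _ _ _ _ g f).
apply: DeriveDef; first exact/derivable1_diffP.
rewrite [LHS]deriveE// (@diff_comp _ _ _ _ g f)//= -[in X in 'd _ _ X]deriveE//.
by rewrite gE -deriveE.
Qed.

Section UnderIntegral.
Variables (a b : R).
Let B : set R := `[a, b]%classic.
Let mB : @measurable _ (measurableTypeR R) B. Proof. exact: measurable_itv. Qed.
Variables (F F1 : R -> R -> R) (C : R).
Hypotheses (C0 : 0 <= C).
Hypothesis intF : forall x, -1 < x < 1 -> {within B, continuous (F x)}.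
Hypothesis dF : forall x t : R, -1 < x < 1 -> B t ->
  is_derive x (1 : R) (F ^~ t) (F1 x t).
Hypothesis F1C : forall x t, -1 < x < 1 -> B t -> `|F1 x t| <= C.

Lemma is_derive_Rintegral (x : R) : -1 < x < 1 ->
  is_derive x (1 : R) (fun x => \int[mu]_(t in B) F x t) (\int[mu]_(t in B) F1 x t).
Proof.
move=> x1; have xI : `]-1, 1[%classic x by rewrite /= in_itv.
have iF y : `]-1, 1[%classic y -> mu.-integrable B (EFin \o F y).
  rewrite /= in_itv/= => y1.
  exact: continuous_compact_integrable (@segment_compact _ _ _) (intF y1).
have dF' y t : `]-1, 1[%classic y -> B t -> derivable (F ^~ t) y 1.
  by rewrite /= in_itv/= => y1 Bt; have [] := dF y1 Bt.
have iC : mu.-integrable B (EFin \o (fun=> C)).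
  apply: continuous_compact_integrable; first exact: segment_compact.
  by move=> y; exact: cst_continuous.
have E y t : -1 < y < 1 -> B t -> partial1of2 F y t = F1 y t.
  by move=> y1 Bt; rewrite partial1of2E; have [_] := dF y1 Bt.
have bd y t : `]-1, 1[%classic y -> B t -> `|partial1of2 F y t| <= C.
  by rewrite /= in_itv/= => y1 Bt; rewrite E// F1C.
apply: DeriveDef.
  have H := derivable_under_integral mB xI iF dF' (fun=> C0) iC bd.
  exact: H.
rewrite -derive1E (differentiation_under_integral mB xI iF dF' (fun=> C0) iC bd).
apply: eq_Rintegral => t; rewrite inE => Bt; exact: E.
Qed.

End UnderIntegral.

Section Disc.
Variables (U : set (C2 R)) (p v : C2 R).
Hypothesis oU : open U.

Definition circ (t : R) : C2 R := cos t *: v + sin t *: J v.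
Definition dcirc (t : R) : C2 R := - sin t *: v + cos t *: J v.

Lemma cscaleE (a b : R) w : Defs.cscale (Complex a b) w = a *: w + b *: J w.
Proof.
rewrite /J /Defs.cscale /=; case: w => w1 w2; congr pair => /=.
  by rewrite !scale0r !scale1r sub0r scalerN.
by rewrite !scale0r !scale1r addr0 addrC.
Qed.

Lemma JE w : J w = (- w.2, w.1).
Proof. by rewrite /J /Defs.cscale /= !scale0r !scale1r sub0r addr0. Qed.

Lemma J_circ t : J (circ t) = dcirc t.
Proof.
rewrite /circ /dcirc !JE /=; congr pair => /=.
  by rewrite opprD scalerN scaleNr addrC.
by rewrite scalerN scaleNr addrC.
Qed.

Lemma circ2pi : circ (2 * pi) = circ 0.
Proof.
by rewrite /circ mulr_natl cos2pi sin2pi cos0 sin0.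
Qed.

Lemma is_derive_circ (x t : R) :
  is_derive t (1 : R) (fun t => p + x *: circ t) (x *: dcirc t).
Proof.
have dv (h : R -> R) (h' : R) w : is_derive t (1 : R) h h' ->
    is_derive t (1 : R) (fun t => h t *: w) (h' *: w).
  move=> [dh hE]; have dh' : differentiable h t by exact/derivable1_diffP.
  have dc : differentiable (fun t => h t *: w) t by exact: differentiableZl.
  apply: DeriveDef; first exact/derivable1_diffP.
  by rewrite deriveE// diffZl//= -deriveE// hE.
have d1 := dv _ _ v (is_derive_cos t); have d2 := dv _ _ (J v) (is_derive_sin t).
have d3 := is_deriveD d1 d2.
have d4 := is_deriveD (is_derive_cst p t 1) (is_deriveZ x d3).
by apply: (@is_derive_eq _ _ _ (fun t => p + x *: circ t) _ _ _ _ d4); rewrite add0r.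
Qed.

(** Continuity on the closed unit disc in polar coordinates: z.1 is the radius,
    of either sign, and z.2 the angle. *)
Definition dcont (h : R * R -> R) :=
  forall z : R * R, `|z.1| <= 1 -> {for z, continuous h}.

Hypothesis disc : forall x t : R, `|x| <= 1 -> U (p + x *: circ t).

Lemma dcont_comp f : (forall q, U q -> {for q, continuous f}) ->
  dcont (fun z => f (p + z.1 *: circ z.2)).
Proof.
move=> cf z z1; apply: (@continuous_comp _ _ _ (fun z : R * R => p + z.1 *: circ z.2) f).
  apply: cvgD; first exact: cvg_cst.
  apply: cvgZ; first exact: cvg_fst.
  apply: cvgD.
    apply: cvgZr_tmp; apply: (@continuous_comp _ _ _ snd cos); first exact: cvg_snd.
    exact: continuous_cos.
  apply: cvgZr_tmp; apply: (@continuous_comp _ _ _ snd sin); first exact: cvg_snd.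
  exact: continuous_sin.
by apply: cf; exact: disc.
Qed.

Lemma dcontD h k : dcont h -> dcont k -> dcont (fun z => h z + k z).
Proof. by move=> ch ck z z1; apply: cvgD; [exact: ch|exact: ck]. Qed.

Lemma dcontM h k : dcont h -> dcont k -> dcont (fun z => h z * k z).
Proof. by move=> ch ck z z1; apply: cvgM; [exact: ch|exact: ck]. Qed.

Lemma dcont_radius : dcont (fun z => z.1).
Proof. by move=> z _; exact: cvg_fst. Qed.

Lemma dcont_cos : dcont (fun z => cos z.2).
Proof.
move=> z _; apply: (@continuous_comp _ _ _ snd cos); first exact: cvg_snd.
exact: continuous_cos.
Qed.

Lemma dcont_sin : dcont (fun z => sin z.2).
Proof.
move=> z _; apply: (@continuous_comp _ _ _ snd sin); first exact: cvg_snd.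
exact: continuous_sin.
Qed.

Lemma dcontN h : dcont h -> dcont (fun z => - h z).
Proof. by move=> ch z z1; apply: cvgN; exact: ch. Qed.

Lemma dcont_bounded h : dcont h -> exists2 C, 0 <= C &
  forall x t, `|x| <= 1 -> t \in `[0, 2 * pi] -> `|h (x, t)| <= C.
Proof.
move=> ch; pose A : set (R * R) := `[-1, 1]%classic `*` `[0, 2 * pi]%classic.
have cA : compact A by apply: compact_setX; exact: segment_compact.
have A0 : A !=set0.
  exists (0, 0); split; rewrite /= in_itv/= ?lexx ?mulr_ge0 ?pi_ge0//=.
  by rewrite oppr_le0 ler01.
have cn : {within A, continuous (fun z => `|h z|)}.
  apply: continuous_in_subspaceT => z; rewrite inE => -[/= z1 _].
  apply: cvg_norm; apply: ch; rewrite ler_norml.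
  by move: z1; rewrite in_itv.
have [z zA hz] := compact_EVT_max A0 cA cn.
exists `|h z| => // x t x1 t2; apply: hz; rewrite inE; split => //=.
by rewrite in_itv/= -ler_norml.
Qed.

Lemma dcont_slice h x : dcont h -> `|x| <= 1 -> continuous (fun t => h (x, t)).
Proof.
move=> ch x1 t; apply: (@continuous_comp _ _ _ (fun t => (x, t)) h).
  apply: (@differentiable_continuous _ _ _ t (fun t : R => (x, t))).
  exact: (differentiable_pair (differentiable_cst x t) (ex_diff (is_diff_def := is_diff_id t))).
exact: ch.
Qed.

Section SubMean.
Variable u : C2 R -> R.
Hypothesis su : smooth_on U u.
Hypothesis lap : forall q w, U q -> 0 <= line_laplacian u w q.
Let B : set R := `[0, 2 * pi]%classic.

Let pt x t := p + x *: circ t.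
(* The derivatives of f at pt x t along the radius and along the circle. *)
Let dir f x t := cos t * 'D_v f (pt x t) + sin t * 'D_(J v) f (pt x t).
Let ddir f x t := - sin t * 'D_v f (pt x t) + cos t * 'D_(J v) f (pt x t).
Let a1 := 'D_v u.
Let a2 := 'D_(J v) u.
Let sa1 : smooth_on U a1 := smooth_derive v su.
Let sa2 : smooth_on U a2 := smooth_derive (J v) su.

Let deriveE_comb f (a b : R) q : smooth_on U f -> U q ->
  'D_(a *: v + b *: J v) f q = a * 'D_v f q + b * 'D_(J v) f q.
Proof.
move=> sf Uq; rewrite (deriveDdir _ _ sf Uq).
by rewrite (deriveZdir a v sf Uq) (deriveZdir b (J v) sf Uq).
Qed.

Let derive2E_comb (a b : R) q : U q ->
  'D_(a *: v + b *: J v) ('D_(a *: v + b *: J v) u) q =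
  a * (a * 'D_v a1 q + b * 'D_(J v) a1 q) +
  b * (a * 'D_v a2 q + b * 'D_(J v) a2 q).
Proof.
move=> Uq; set w := a *: v + b *: J v.
have E y : U y -> 'D_w u y = a * a1 y + b * a2 y by exact: deriveE_comb.
apply: etrans (eq_on_derive w oU E Uq) _.
apply: etrans (smooth_deriveD w (smoothZ a oU sa1) (smoothZ b oU sa2) Uq) _.
have Z c f : smooth_on U f -> 'D_w (fun y => c * f y) q = c * 'D_w f q.
  move=> sf; rewrite (smooth_deriveM w (smooth_cst c oU) sf Uq).
  by rewrite derive_cst mul0r add0r.
exact: (f_equal2 +%R
  (etrans (Z a a1 sa1) (f_equal (fun x => a * x) (deriveE_comb a b sa1 Uq)))
  (etrans (Z b a2 sa2) (f_equal (fun x => b * x) (deriveE_comb a b sa2 Uq)))).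
Qed.

(* The second derivatives of u along the radius and along the tangent. *)
Let F2 x t := cos t * dir a1 x t + sin t * dir a2 x t.
Let F3 x t := - sin t * ddir a1 x t + cos t * ddir a2 x t.

Let lapE x t : `|x| <= 1 -> 0 <= F2 x t + F3 x t.
Proof.
move=> x1; have Uq := disc t x1.
have E : line_laplacian u (circ t) (pt x t) = F2 x t + F3 x t.
  rewrite /line_laplacian; apply: (f_equal2 +%R).
    exact: (derive2E_comb (cos t) (sin t) Uq).
  exact: (eq_ind_r (fun w => 'D_w ('D_w u) (pt x t) = F3 x t)
    (derive2E_comb (- sin t) (cos t) Uq) (J_circ t)).
by rewrite -E; exact: lap.
Qed.

Let d_radius f (x t : R) : smooth_on U f -> `|x| <= 1 ->
  is_derive x (1 : R) (fun x => f (pt x t)) (dir f x t).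
Proof.
move=> sf x1; have Uq := disc t x1.
by apply: is_derive_eq (is_derive_line sf Uq) _; rewrite /circ deriveE_comb.
Qed.

Let d_angle f (x t : R) : smooth_on U f -> `|x| <= 1 ->
  is_derive t (1 : R) (fun t => f (pt x t)) (x * ddir f x t).
Proof.
move=> sf x1; have Uq := disc t x1.
apply: is_derive_eq (is_derive_curve sf Uq (is_derive_circ x t)) _.
by rewrite (deriveZdir x (dcirc t) sf Uq) /dcirc deriveE_comb.
Qed.

Let dcont_pt f : smooth_on U f -> dcont (fun z => f (pt z.1 z.2)).
Proof. by move=> sf; apply: dcont_comp => q; exact: smooth_continuous. Qed.

Let dcont_dir f : smooth_on U f -> dcont (fun z => dir f z.1 z.2).
Proof.
move=> sf; apply: dcontD; apply: dcontM; try exact: dcont_cos; try exact: dcont_sin.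
  exact: dcont_pt (smooth_derive v sf).
exact: dcont_pt (smooth_derive (J v) sf).
Qed.

Let dcont_ddir f : smooth_on U f -> dcont (fun z => ddir f z.1 z.2).
Proof.
move=> sf; apply: dcontD; apply: dcontM; try exact: dcont_cos.
- exact: dcontN dcont_sin.
- exact: dcont_pt (smooth_derive v sf).
- exact: dcont_pt (smooth_derive (J v) sf).
Qed.

Let dcont_F2 : dcont (fun z => F2 z.1 z.2).
Proof.
apply: dcontD; apply: dcontM; try exact: dcont_cos; try exact: dcont_sin.
  exact: dcont_dir.
exact: dcont_dir.
Qed.

Let dcont_F3 : dcont (fun z => F3 z.1 z.2).
Proof.
apply: dcontD; apply: dcontM; try exact: dcont_cos.
- exact: dcontN dcont_sin.
- exact: dcont_ddir.
- exact: dcont_ddir.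
Qed.

Let xdir_alg (x c s y z D1 D2 : R) :
  x * (c * D1 + y * 0 + (s * D2 + z * 0)) + (c * y + s * z) * 1 =
  c * y + s * z + x * (c * D1 + s * D2).
Proof. by ring. Qed.

Let ddir_alg (x c s y z D1 D2 : R) :
  - s * (x * D1) + y * - c + (c * (x * D2) + z * - s) =
  x * (- s * D1 + c * D2) - (c * y + s * z).
Proof. by ring. Qed.

Let is_derive_xdir (x t : R) : `|x| <= 1 ->
  is_derive x (1 : R) (fun x => x * dir u x t) (dir u x t + x * F2 x t).
Proof.
move=> x1.
have d1 := is_deriveM (is_derive_cst (cos t) x (1 : R)) (d_radius t sa1 x1).
have d2 := is_deriveM (is_derive_cst (sin t) x (1 : R)) (d_radius t sa2 x1).
have d0 : is_derive x (1 : R) (id : R -> R) 1 by exact: is_derive_id.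
have d := is_deriveM d0 (is_deriveD d1 d2).
have d' : is_derive x (1 : R) (fun x => x * dir u x t) _ := d.
apply: is_derive_eq d' _.
rewrite /GRing.scale /=; exact: xdir_alg.
Qed.

Let is_derive_ddir (x t : R) : `|x| <= 1 ->
  is_derive t (1 : R) (ddir u x) (x * F3 x t - dir u x t).
Proof.
move=> x1.
have d1 := is_deriveM (is_deriveN (is_derive_sin t)) (d_angle t sa1 x1).
have d2 := is_deriveM (is_derive_cos t) (d_angle t sa2 x1).
have d := is_deriveD d1 d2.
have d' : is_derive t (1 : R) (ddir u x) _ := d.
apply: is_derive_eq d' _; rewrite /GRing.scale /=; exact: ddir_alg.
Qed.

(* M x is 2 pi times the mean of u on the circle of radius x, and P x = x M'(x). *)
Let M x := \int[mu]_(t in B) u (pt x t).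
Let P x := \int[mu]_(t in B) (x * dir u x t).

Let abs1 (x : R) : -1 < x < 1 -> `|x| <= 1.
Proof. by move=> x1; rewrite ltW// ltr_norml. Qed.

Let integrable_slice h x : dcont h -> `|x| <= 1 ->
  mu.-integrable B (EFin \o (fun t => h (x, t))).
Proof.
move=> ch x1; apply: continuous_compact_integrable; first exact: segment_compact.
exact/continuous_subspaceT/dcont_slice.
Qed.

Let is_derive_M (x : R) : -1 < x < 1 ->
  is_derive x (1 : R) M (\int[mu]_(t in B) dir u x t).
Proof.
move=> x1; have [C C0 hC] := dcont_bounded (dcont_dir su).
apply: (is_derive_Rintegral C0 _ _ _ x1) => [y y1|y t y1 _|y t y1 tB].
- exact/continuous_subspaceT/(dcont_slice (dcont_pt su) (abs1 y1)).
- exact: (d_radius t su (abs1 y1)).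
- by apply: (hC y t (abs1 y1)); move: tB.
Qed.

Let dcont_xdir : dcont (fun z => z.1 * dir u z.1 z.2).
Proof. exact: dcontM dcont_radius (dcont_dir su). Qed.

Let dcont_G1 : dcont (fun z => dir u z.1 z.2 + z.1 * F2 z.1 z.2).
Proof. exact: dcontD (dcont_dir su) (dcontM dcont_radius dcont_F2). Qed.

Let dcont_K : dcont (fun z => z.1 * F3 z.1 z.2 - dir u z.1 z.2).
Proof. exact: dcontD (dcontM dcont_radius dcont_F3) (dcontN (dcont_dir su)). Qed.

Let is_derive_P (x : R) : -1 < x < 1 ->
  is_derive x (1 : R) P (\int[mu]_(t in B) (dir u x t + x * F2 x t)).
Proof.
move=> x1; have [C C0 hC] := dcont_bounded dcont_G1.
apply: (@is_derive_Rintegral 0 (2 * pi) (fun x t => x * dir u x t)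
  (fun x t => dir u x t + x * F2 x t) C C0 _ _ _ x x1) => [y y1|y t y1 _|y t y1 tB].
- exact/continuous_subspaceT/(dcont_slice dcont_xdir (abs1 y1)).
- exact: (is_derive_xdir t (abs1 y1)).
- by apply: (hC y t (abs1 y1)); move: tB.
Qed.

Let twopi_gt0 : 0 < 2 * pi :> R. Proof. by rewrite mulr_gt0// pi_gt0. Qed.

(* The integrand is the derivative in t of the periodic function ddir u x. *)
Let integral_K (x : R) : `|x| <= 1 ->
  \int[mu]_(t in B) (x * F3 x t - dir u x t) = 0.
Proof.
move=> x1.
have dK t := is_derive_ddir t x1.
have cK : continuous (ddir u x).
  by move=> t; apply/differentiable_continuous/derivable1_diffP; have [] := dK t.
have E : (\int[mu]_(t in `[0%R, (2 * pi)%R]) (x * F3 x t - dir u x t)%:E =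
    (ddir u x (2 * pi))%:E - (ddir u x 0)%:E)%E.
  apply: continuous_FTC2 => //.
  - exact/continuous_subspaceT/(dcont_slice dcont_K x1).
  - split=> [t _||]; first by have [] := dK t.
      exact: cvg_at_right_filter (cK 0).
    exact: cvg_at_left_filter (cK (2 * pi)).
  - by move=> t _; rewrite derive1E; have [] := dK t.
rewrite /Rintegral E /ddir /pt circ2pi mulr_natl cos2pi sin2pi cos0 sin0.
by rewrite -EFinB subrr.
Qed.

(* Adding the vanishing integral of integral_K turns P'(x) into x times the
   integral of the Laplacian. *)
Let dP_ge0 (x : R) : 0 <= x < 1 ->
  0 <= \int[mu]_(t in B) (dir u x t + x * F2 x t).
Proof.
move=> /andP[x0 x1]; have ax : `|x| <= 1 by rewrite ger0_norm// ltW.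
have -> : \int[mu]_(t in B) (dir u x t + x * F2 x t) =
    \int[mu]_(t in B) (dir u x t + x * F2 x t) +
    \int[mu]_(t in B) (x * F3 x t - dir u x t) by rewrite (integral_K ax) addr0.
have alg (y z w : R) : y + x * z + (x * w - y) = x * (z + w) by ring.
rewrite -(RintegralD _ (integrable_slice dcont_G1 ax) (integrable_slice dcont_K ax)).
  by apply: Rintegral_ge0 => t _; rewrite alg mulr_ge0// lapE.
exact: measurable_itv.
Qed.

Let PE (x : R) : `|x| <= 1 -> P x = x * \int[mu]_(t in B) dir u x t.
Proof.
move=> x1; apply: RintegralZl; first exact: measurable_itv.
exact: (integrable_slice (dcont_dir su) x1).
Qed.

Let nondecreasing_from0 (h h' : R -> R) :
  (forall x : R, -1 < x < 1 -> is_derive x (1 : R) h (h' x)) ->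
  (forall x : R, 0 < x < 1 -> 0 <= h' x) ->
  forall x, 0 <= x < 1 -> h 0 <= h x.
Proof.
move=> dh h0 x /andP[x0 x1].
have dh' y : 0 <= y <= x -> is_derive y (1 : R) h (h' y).
  move=> /andP[y0 yx]; apply: dh; rewrite (lt_le_trans _ y0) ?ltrN10//.
  exact: le_lt_trans x1.
have ch : {within `[0, x], continuous h}.
  by apply: derivable_within_continuous => y; rewrite in_itv/= => /dh'[].
move: x0; rewrite le_eqVlt => /predU1P[<-//|x0].
have dh'' y : y \in `]0, x[ -> is_derive y (1 : R) h (h' y).
  by rewrite in_itv/= => /andP[/ltW y0 /ltW yx]; apply: dh'; rewrite y0.
have [y] := MVT x0 dh'' ch; rewrite in_itv/= => /andP[y0 yx] E.
rewrite -subr_ge0 E subr0; apply: mulr_ge0; last exact: ltW.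
by apply: h0; rewrite y0 (lt_trans yx).
Qed.

Let M_ge (x : R) : 0 <= x < 1 -> M 0 <= M x.
Proof.
move=> x01; apply: (nondecreasing_from0 is_derive_M) x01 => {}x /andP[x0 x1].
have ax : `|x| <= 1 by rewrite ger0_norm ltW.
have x01 : 0 <= x < 1 by rewrite ltW.
have P0 : P 0 = 0 by rewrite PE ?normr0// mul0r.
have := nondecreasing_from0 is_derive_P _ x01.
rewrite P0 PE// pmulr_rge0//; apply=> y /andP[y0 y1].
by apply: dP_ge0; rewrite ltW.
Qed.

Let M0 : M 0 = 2 * pi * u p.
Proof.
rewrite /M (@eq_Rintegral _ _ _ mu B (fun=> u p)); last first.
  by move=> t _; rewrite /pt scale0r addr0.
have muB : @lebesgue_measure R `[0, 2 * pi]%classic = (2 * pi)%:E.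
  by rewrite lebesgue_measure_itv/= lte_fin twopi_gt0 oppr0 adde0.
transitivity (u p * fine (mu B)); last by rewrite muB mulrC.
by apply: Rintegral_cst; exact: measurable_itv.
Qed.

(** Only the disc of radius 1 is known to lie in U, so that M has no derivative at 1:
    the limit x -> 1 is taken for the radius min(s, 1), with s near 1. *)
Lemma M1_ge : M 0 <= M 1.
Proof.
pose f (s t : R) := u (pt (Num.min s 1) t).
have ms (s : R) : 0 < s -> `|Num.min s 1| <= 1.
  move=> s0; have m0 : 0 <= Num.min s 1 by rewrite le_min (ltW s0) ler01.
  by rewrite ger0_norm// ge_min lexx orbT.
have [C C0 hC] := dcont_bounded (dcont_pt su).
have cM : {in `]0, 2[%classic, continuous (fun s => \int[mu]_(t in B) f s t)}.
  apply: (@continuity_under_integral R _ _ mu f B _ 0 2 _ _ (fun=> C)).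
  - exact: measurable_itv.
  - move=> s /=; rewrite in_itv/= => /andP[s0 _].
    exact: (integrable_slice (dcont_pt su) (ms s s0)).
  - apply/aeW => t _ s; rewrite inE/= in_itv/= => /andP[s0 _].
    apply: (@continuous_comp _ _ _ (fun s : R => Num.min s 1) (fun x => u (pt x t))).
      apply: (@continuous_min R R id (cst 1) s); first exact: cvg_id.
      exact: cvg_cst.
    apply/differentiable_continuous/derivable1_diffP.
    by have [] := d_radius t su (ms s s0).
  - apply: continuous_compact_integrable; first exact: segment_compact.
    by move=> y; exact: cst_continuous.
  - move=> s /=; rewrite in_itv/= => /andP[s0 _]; apply/aeW => t tB.
    by apply: (hC _ t (ms s s0)); move: tB.
have I1 : (1 : R) \in `]0, 2[%classic by rewrite inE/= in_itv/= ltr01 ltr1n.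
have f1 : \int[mu]_(t in B) f 1 t = M 1 by rewrite /f minxx.
rewrite leNgt; apply/negP => M10.
have := cM 1 I1; rewrite /continuous_at f1 => /cvgr_lt /(_ _ M10) near1.
have [e /= e0 He] : \forall s \near (1 : R), \int[mu]_(t in B) f s t < M 0 by exact: near1.
have [d [d0 d2 de]] : exists d : R, [/\ 0 < d, d <= 1 / 2 & d < e].
  exists (Num.min (e / 2) (1 / 2)); split; rewrite ?lt_min ?ge_min ?gt_min.
  - by rewrite !divr_gt0.
  - by rewrite lexx orbT.
  - by rewrite ltr_pdivrMr// ltr_pMr// ltr1n.
have := He (1 - d); rewrite /= opprB addrC subrK gtr0_norm// => /(_ de).
have -> : \int[mu]_(t in B) f (1 - d) t = M (1 - d).
  by rewrite /f min_l// lerBlDr lerDl ltW.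
have m1 : 0 <= 1 - d < 1 by apply/andP; split; lra.
by rewrite ltNge M_ge.
Qed.

(** M'(x) = P(x) / x, where P(0) = 0 and P'(x) is x times the integral of the
    Laplacian over the circle of radius x; hence M is nondecreasing. *)
Lemma laplacian_submean :
  ((2 * pi * u p)%:E <= \int[mu]_(t in B) (u (p + circ t))%:E)%E.
Proof.
have i1 := integrable_slice (dcont_pt su) (x := 1); rewrite normr1 in i1.
have {}i1 := i1 (lexx _).
have -> : (\int[mu]_(t in B) (u (p + circ t))%:E = (M 1)%:E)%E.
  rewrite /M /Rintegral fineK; last
    by apply: integrable_fin_num i1; exact: measurable_itv.
  by apply: eq_integral => t _; rewrite /pt scale1r.
by rewrite lee_fin -M0 M1_ge.
Qed.

End SubMean.
End Disc.
End SubMeanValue.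

(** * The Diederich-Fornaess index *)

Section Assembly.
Variable R : realType.
Local Open Scope complex_scope.
Implicit Types (Omega U : set (C2 R)) (rho : C2 R -> R) (p q v : C2 R).

Lemma bounded_compact_closure Omega : bounded_set Omega -> compact (closure Omega).
Proof.
move=> [M [Mr bM]]; pose N := M + 1.
have bN q : Omega q -> `|q| <= N by apply: bM; rewrite ltrDl.
have cb : compact [set x : 'rV[R]_2 | `|x| <= N].
  apply: bounded_closed_compact.
    exists N; split; first exact: num_real.
    by move=> x Nx y /= /le_trans; apply; exact: ltW.
  apply: (@closed_comp _ _ (fun x : 'rV[R]_2 => `|x|) [set y | y <= N]).
    by move=> x _; exact: norm_continuous.
  exact: closed_le.
have cc := compact_setX cb cb.
apply: subclosed_compact cc _; first exact: closed_closure.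
suff -> : [set x : 'rV[R]_2 | `|x| <= N] `*` [set x : 'rV[R]_2 | `|x| <= N] =
    [set q : C2 R | `|q| <= N].
  suff /(closure_id _).1 -> : closed [set q : C2 R | `|q| <= N].
    by apply: closureS => q /bN.
  apply: (@closed_comp _ _ (fun x : C2 R => `|x|) [set y | y <= N]).
    by move=> x _; exact: norm_continuous.
  exact: closed_le.
by apply/seteqP; split=> -[a b]; rewrite /= prod_normE/= ge_max => /andP.
Qed.

Lemma boundaryE Omega p : open Omega -> boundary Omega p <-> closure Omega p /\ ~ Omega p.
Proof. by move=> oO; rewrite /boundary ((interior_id _).1 oO). Qed.

Lemma gradsq_boundary U rho p : open U -> smooth_on U rho -> U p ->
  (exists j : 'I_2, 'D_(dirx R j) rho p != 0 \/ 'D_(diry R j) rho p != 0) ->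
  0 < gradsq (cgrad rho p).
Proof.
move=> oU sr Up [j dj]; apply: (@gradsq_gt0 R (cgrad rho p) j).
apply/eqP => g0.
have z0 : dz j (fun q => (rho q)%:C) p = 0 by exact: g0.
have zb0 : dzbar j (fun q => (rho q)%:C) p = 0 by rewrite (dz_real j oU sr Up) z0 conjc0.
have Ex : ('D_(dirx R j) rho p)%:C = 0.
  by rewrite -cderive_real cderive_dirx z0 zb0 addr0.
have Ey : ('D_(diry R j) rho p)%:C = 0.
  by rewrite -cderive_real cderive_diry z0 zb0 subrr mulr0.
by case: dj => /eqP; apply; [case: Ex|case: Ey].
Qed.

Lemma normsq_ge0 q : 0 <= normsq q.
Proof. by rewrite addr_ge0// cabs2_ge0. Qed.

Lemma continuous_normsq q : {for q, continuous (@normsq R)}.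
Proof.
have oT : open [set: C2 R] by exact: openT.
have sc j := csmooth_coord j oT.
have sabs j : smooth_on [set: C2 R] (fun q => cabs2 (ccoord q j)).
  exact: (smoothD oT (smoothM oT (sc j).1 (sc j).1) (smoothM oT (sc j).2 (sc j).2)).
exact: (smooth_continuous (smoothD oT (sabs 0) (sabs 1))).
Qed.

Lemma psh_of_laplacian Omega (u : C2 R -> R) : open Omega -> smooth_on Omega u ->
  (forall q w, Omega q -> 0 <= line_laplacian u w q) ->
  plurisubharmonic_on Omega u.
Proof.
move=> oO su lap; split=> [p a Op ua|p v disc].
  by have /cvgr_lt := smooth_continuous su Op; apply.
have disc' x t : `|x| <= 1 -> Omega (p + x *: circ v t).
  move=> x1; have -> : x *: circ v t = Defs.cscale (Complex (x * cos t) (x * sin t)) v.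
    by rewrite cscaleE /circ scalerDr !scalerA.
  apply: disc; rewrite normc_def /= lecR !exprMn -mulrDr cos2Dsin2 mulr1.
  by rewrite sqrtr_sqr.
have := laplacian_submean oO disc' su lap; congr (_ <= _)%E.
by apply: eq_integral => t _; rewrite cscaleE.
Qed.

Section Exponent.
Variables (Omega U : set (C2 R)) (rho : C2 R -> R).
Hypotheses (bOmega : bounded_set Omega) (oOmega : open Omega) (oU : open U).
Hypotheses (clU : closure Omega `<=` U) (srho : smooth_on U rho).
Hypothesis Omega_lt0 : forall p, U p -> Omega p <-> rho p < 0.
Hypothesis bd_eq0 : forall p, U p -> boundary Omega p <-> rho p = 0.
Hypothesis grad_neq0 : forall p, boundary Omega p ->
  exists j : 'I_2, 'D_(dirx R j) rho p != 0 \/ 'D_(diry R j) rho p != 0.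
Hypothesis levi_pos : forall p, boundary Omega p -> 0 <= complex.Re (levi rho p).
Hypothesis flat_mixed : forall p, boundary Omega p -> levi rho p = 0 -> mixed rho p = 0.

Let bdU p : boundary Omega p -> U p. Proof. by move=> [/clU]. Qed.
Let OmegaU p : Omega p -> U p. Proof. by move=> /subset_closure/clU. Qed.

Let closed_boundary : closed (boundary Omega).
Proof.
rewrite /boundary setDE; apply: closedI; first exact: closed_closure.
exact: open_closedC (@open_interior _ _).
Qed.

Let grad_lower_bound : exists2 s0, 0 < s0 &
  forall p, boundary Omega p -> s0 <= complex.Re (gradsq (cgrad rho p)).
Proof.
have [[p bp]|nb] := pselect (boundary Omega !=set0); last first.
  by exists 1 => // p bp; exfalso; apply: nb; exists p.
have pos q : boundary Omega q -> 0 < complex.Re (gradsq (cgrad rho q)).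
  move=> bq; have := gradsq_boundary oU srho (bdU bq) (grad_neq0 bq).
  by rewrite ltcE => /andP[].
have cb : compact (boundary Omega).
  by apply: subclosed_compact (bounded_compact_closure bOmega) _ => // q [].
have cS : {within boundary Omega, continuous
    (fun q => complex.Re (gradsq (cgrad rho q)))}.
  apply: continuous_in_subspaceT => q; rewrite inE => bq.
  have sc j := csmooth_cgrad j oU srho.
  exact: (smooth_continuous (csmoothD oU
    (csmoothM oU (sc 0) (csmooth_conj oU (sc 0)))
    (csmoothM oU (sc 1) (csmooth_conj oU (sc 1)))).1 (bdU bq)).
have [q bq hq] := compact_EVT_min (ex_intro _ p bp) cb cS.
rewrite inE in bq.
exists (complex.Re (gradsq (cgrad rho q))); first exact: pos.
by move=> y /mem_set; exact: hq.
Qed.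

Let norm_upper_bound : exists2 Rb, 0 <= Rb &
  forall p, closure Omega p -> normsq p <= Rb.
Proof.
have [[p Op]|nO] := pselect (closure Omega !=set0); last first.
  by exists 0 => // p Op; exfalso; apply: nO; exists p.
have cn : {within closure Omega, continuous (@normsq R)}.
  by apply: continuous_in_subspaceT => q _; exact: continuous_normsq.
have [q _ hq] := compact_EVT_max (ex_intro _ p Op) (bounded_compact_closure bOmega) cn.
by exists (normsq q); [exact: normsq_ge0|move=> y /mem_set; exact: hq].
Qed.

(* The points of the closure where P may fail form a compact subset of Omega, on
   which r has a negative maximum. *)
Let level_near_boundary (r : C2 R -> R) (P : C2 R -> Prop) :
  (forall q, U q -> {for q, continuous r}) -> (forall q, Omega q -> r q < 0) ->
  (forall p, boundary Omega p -> \forall q \near p, rho q < 0 -> P q) ->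
  exists2 c, 0 < c <= 1 / 2 & forall q, Omega q -> - c < r q -> P q.
Proof.
move=> cr r0 nP; pose S := [set q | rho q < 0 -> P q].
pose K := closure Omega `\` S^°.
have KO q : K q -> Omega q.
  move=> [cq nS]; have [//|nOq] := pselect (Omega q); exfalso; apply: nS.
  by apply: nP; apply/(boundaryE _ oOmega).
have SP q : Omega q -> ~ K q -> P q.
  move=> Oq nK; have Sq : S^° q.
    by apply: contrapT => nS; apply: nK; split => //; exact: subset_closure.
  by apply: (interior_subset Sq); apply/Omega_lt0 => //; exact: OmegaU.
have half : 0 < (1 / 2 : R) <= 1 / 2 by rewrite lexx andbT divr_gt0.
have [[k Kk]|nK] := pselect (K !=set0); last first.
  by exists (1 / 2) => // q Oq _; apply: SP => // Kq; apply: nK; exists q.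
have cK : compact K.
  apply: subclosed_compact (bounded_compact_closure bOmega) _; last by move=> q [].
  rewrite /K setDE; apply: closedI; first exact: closed_closure.
  exact: open_closedC (@open_interior _ _).
have crK : {within K, continuous r}.
  apply: continuous_in_subspaceT => q; rewrite inE => -[/clU Uq _]; exact: cr.
have [q0 Kq0 hq0] := compact_EVT_max (ex_intro _ k Kk) cK crK.
rewrite inE in Kq0; have rq0 := r0 _ (KO _ Kq0).
exists (Num.min (1 / 2) (- r q0)).
  by rewrite lt_min oppr_gt0 rq0 divr_gt0//= ge_min lexx.
move=> q Oq hq; apply: SP => // Kq.
have rq : r q <= r q0 by exact: hq0 (mem_set Kq).
have hm : Num.min (1 / 2) (- r q0) <= - r q0 by rewrite ge_min lexx orbT.
by lra.
Qed.

(** With r = rho exp(-psi), the function -(-r)^tau is plurisubharmonic near the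
    boundary, hence where r > -c for some c > 0; the defining function bend c r
    is constant on the rest of Omega. The constants eps and M only depend on
    bounds over the compact boundary. *)
Lemma DF_exponent_of_flat_mixed tau : 0 < tau < 1 -> DF_exponent Omega tau.
Proof.
move=> tau01; have /andP[tau0 tau1] := tau01.
have [s0 s00 hs0] := grad_lower_bound.
have [Rb Rb0 hRb] := norm_upper_bound.
pose eps := (1 - tau) / (2 * (Rb + 1)).
have Rb1 : 0 < Rb + 1 by lra.
have eps0 : 0 < eps by rewrite divr_gt0 ?mulr_gt0 ?subr_gt0.
have heps : eps * Rb * tau <= (1 - tau) / 2.
  have -> : (1 - tau) / 2 = eps * (Rb + 1) by rewrite /eps; field; rewrite gt_eqF.
  rewrite -mulrA ler_pM2l//; nra.
pose M := (eps * s0 ^+ 3)^-1.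
pose psi := weight M eps rho; pose r := expweight rho psi.
have spsi : smooth_on U psi := smooth_weight M eps oU srho.
have sr : smooth_on U r := smooth_expweight oU srho spsi.
have rE q : r q = rho q * expR (- psi q) by [].
have r_lt0 q : Omega q -> r q < 0.
  by move=> Oq; rewrite rE pmulr_llt0 ?expR_gt0//; apply/Omega_lt0 => //; exact: OmegaU.
pose P q := forall v,
  0 <= - r q * line_laplacian r v q + (1 - tau) * line_grad r r v q.
have near_bd p : boundary Omega p -> \forall q \near p, rho q < 0 -> P q.
  move=> bp; have Up := bdU bp.
  have near_DF := boundary_DF_ge0 oU srho Up ((bd_eq0 Up).1 bp)
    (fun q Uq rq => levi_pos ((bd_eq0 Uq).2 rq)) (flat_mixed bp) tau01 s00
    (hs0 p bp) (hRb p bp.1) eps0 heps (lexx M).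
  have near_U : \forall q \near p, U q by exact: open_nbhs_nbhs.
  apply: filterS2 near_DF near_U => q hq Uq rq v.
  rewrite (expweight_laplacian oU srho spsi tau v Uq).
  apply: mulr_ge0; first exact: sqr_ge0.
  rewrite -ler0c (herm_DF_real oU srho spsi tau v Uq).
  apply: mulr_ge0; first exact: ler0n.
  exact: (hq rq (ccoord v)).
have [c c01 hP] := level_near_boundary (fun q => @smooth_continuous _ U r q sr)
  r_lt0 near_bd.
have /andP[c0 _] := c01.
split=> //; exists (fun q => bend c (r q)); last first.
  have sO := smoothS (fun q => @OmegaU q) sr.
  have snb := smoothN oOmega (smooth_bend c oOmega sO).
  have sDF : smooth_on Omega (fun q => DFpower c tau (r q)).
    apply: (smoothN oOmega); apply: (smooth_powR _ oOmega _ snb) => q Oq.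
    by rewrite oppr_gt0 bend_lt0// r_lt0.
  apply: (psh_of_laplacian oOmega sDF) => q v Oq.
  apply: (DFpower_laplacian c01 tau01 oOmega sO r_lt0 Oq) => cr.
  exact: hP.
exists U; split => //.
- exact: smooth_bend.
- split=> p Up.
    rewrite Omega_lt0//; split=> [h|].
      by rewrite bend_lt0// rE pmulr_llt0 ?expR_gt0.
    rewrite rE; case: (ltgtP (rho p) 0) => // [h|->].
      by rewrite ltNge ltW// bend_gt0// mulr_gt0 ?expR_gt0.
    by rewrite mul0r bend0 ltxx.
  rewrite bd_eq0// rE; split=> [->|]; first by rewrite mul0r bend0.
  case: (ltgtP (rho p) 0) => // h b0.
    have : bend c (rho p * expR (- psi p)) < 0 by rewrite bend_lt0// pmulr_llt0 ?expR_gt0.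
    by rewrite b0 ltxx.
  have : 0 < bend c (rho p * expR (- psi p)) by rewrite bend_gt0// mulr_gt0 ?expR_gt0.
  by rewrite b0 ltxx.
move=> p bp; have Up := bdU bp; have p0 := (bd_eq0 Up).1 bp.
have DE w : 'D_w (fun q => bend c (r q)) p =
    bend1 c 0 * (expR (- psi p) * 'D_w rho p).
  apply: etrans (derive_comp w (smooth_diff sr Up) (is_derive_bend c (r p))) _.
  apply: (f_equal2 *%R); first by rewrite rE p0 mul0r.
  by apply: etrans (derive_expweight oU srho spsi w Up) _; rewrite p0 mul0r subr0.
have DN w : 'D_w rho p != 0 -> 'D_w (fun q => bend c (r q)) p != 0.
  move=> h; rewrite DE; apply: mulf_neq0; first by rewrite gt_eqF// bend1_gt0.
  by apply: mulf_neq0 => //; rewrite gt_eqF// expR_gt0.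
by have [j [h|h]] := grad_neq0 bp; exists j; [left|right]; exact: DN.
Qed.

End Exponent.
End Assembly.

Lemma DF_exponent_lt1 (R : realType) (Omega : set (C2 R)) (tau : R) :
  bounded_domain Omega -> pseudoconvex Omega ->
  (exists2 rho : C2 R -> R, defining_function Omega rho &
     forall p : C2 R, Levi_flat Omega p ->
       Hess rho (Lfield rho p) (Nfield rho p) p = 0) ->
  0 < tau < 1 -> DF_exponent Omega tau.
Proof.
move=> [_ oO _ bO] psc [rho drho flat].
have [U [oU clU srho [lt0 eq0] grad0]] := drho.
have bdU p : boundary Omega p -> U p by move=> [/clU].
have gpos p : boundary Omega p -> 0 < gradsq (cgrad rho p).
  by move=> bp; exact: gradsq_boundary oU srho (bdU p bp) (grad0 p bp).
have levi_ge0 p : boundary Omega p -> 0 <= complex.Re (levi rho p).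
  move=> bp; have := psc rho drho p bp; rewrite Levi_formE.
  have vpos : 0 < (gradsq (cgrad rho p))^-1 by rewrite invr_gt0; exact: gpos.
  rewrite (pmulr_rge0 _ vpos).
  by rewrite (levi_real oU srho (bdU p bp)) ler0c.
have flat_mixed p : boundary Omega p -> levi rho p = 0 -> mixed rho p = 0.
  move=> bp l0; apply: (Hess_LN_mixed oU srho (bdU p bp)).
    by rewrite gt_eqF// gpos.
  by apply: flat; split=> //; exists rho => //; rewrite Levi_formE l0 mulr0.
exact: (DF_exponent_of_flat_mixed bO oO oU clU srho lt0 eq0 grad0 levi_ge0 flat_mixed).
Qed.

Theorem theorem1 (R : realType) (Omega : set (C2 R))
    (hdom : bounded_domain Omega) (hsmooth : smooth_boundary Omega)
    (hpsc : pseudoconvex Omega)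
    (hrho : exists2 rho : C2 R -> R, defining_function Omega rho &
       forall p : C2 R, Levi_flat Omega p ->
         Hess rho (Lfield rho p) (Nfield rho p) p = 0) :
  DF_index Omega = 1.
Proof.
pose S := [set tau | DF_exponent Omega tau].
have S_gt tau : 0 < tau < 1 -> S tau by exact: DF_exponent_lt1.
have ubS : ubound S 1 by move=> tau [/andP[_ /ltW]].
have half : S (1 / 2) by apply: S_gt; apply/andP; split; lra.
have leS tau : 0 < tau < 1 -> tau <= sup S.
  by move=> /S_gt; apply: ub_le_sup; exists 1.
rewrite /DF_index -/S; apply/eqP; rewrite eq_le; apply/andP; split.
  by apply: ge_sup => //; exists (1 / 2).
rewrite leNgt; apply/negP => S1.
have half_le : 1 / 2 <= sup S by apply: leS; apply/andP; split; lra.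
have mid_le : (sup S + 1) / 2 <= sup S by apply: leS; apply/andP; split; lra.
by lra.
Qed.
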